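(* Let $V_5\to V_4\to V_3\to V_2\to V_1\to V_0=\mathbb P(\mathrm{Sym}^3(W))$ be the sequence of five blow-ups described in the context. Then the intersection of all line conditions in $V_5$ is empty, i.e. $\bigcap_{\ell}L_5^{\ell}=\emptyset$, where $\ell$ ranges over all lines in $\mathbb P^n$ and $L_5^\ell\subseteq V_5$ is the proper transform of the hypersurface $L^\ell\subseteq V_0$ of cubics tangent to $\ell$.
   Context: Setting. $k$ is an algebraically closed field of characteristic $\neq 2,3$, $n\ge 2$, and $W$ is the $(n+1)$-dimensional space of linear forms in the homogeneous coordinates $x_0,\dots,x_n$ of $\mathbb P^n$. $\mathbb P(\cdot)$ denotes the projective space (bundle) of one-dimensional subspaces. Points $[\lambda]\in\mathbb P(W)\cong\mathbb P^n$ are hyperplanes, and points of $V_0=\mathbb P(\mathrm{Sym}^3(W))$ are cubic hypersurfaces in $\mathbb P^n$. For a line $\ell\subseteq\mathbb P^n$ the line condition $L^\ell\subseteq V_0$ is the hypersurface of cubics tangent to $\ell$ (the zero locus of the discriminant of $f|_\ell$). Loci in $V_0$. $\phi_0:\mathbb P(W)\times\mathbb P(W)\to V_0$, $([\lambda],[\mu])\mapsto[\lambda\mu^2]$; $S_0$ is its image, $\Delta$ is the diagonal and $B_0=\phi_0(\Delta)$ is the locus of triple hyperplanes. Blow-ups. $V_{i+1}$ is the blow-up of $V_i$ along $B_i$ with exceptional divisor $E_{i+1}$ ($i=0,\dots,4$); $L_i^\ell$ and $S_i$ denote the proper transforms of $L^\ell$ and $S_0$ in $V_i$; the $L_i^\ell$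 are called the line conditions in $V_i$. The centers are: - $B_0=\phi_0(\Delta)=\{[\lambda^3]:[\lambda]\in\mathbb P(W)\}\subseteq V_0$, the locus of triple hyperplanes; - $B_1\subseteq E_1=\mathbb P(N_{B_0}V_0)$: the fiber of $E_1$ over $[\lambda^3]$ is $\mathbb P(\mathrm{Sym}^3(W)/\lambda^2 W)$, and the fiber of $B_1$ over $[\lambda^3]$ is the subspace $\mathbb P(\lambda\,\mathrm{Sym}^2(W)/\lambda^2W)$ of cubics divisible by $\lambda$; - $B_2=\tilde E_1\cap E_2\subseteq V_2$, where $\tilde E_1$ is the proper transform of $E_1$ in $V_2$; - $B_3=S_3\subseteq V_3$; - $B_4\subseteq E_4\subseteq V_4$ is the set-theoretic intersection of all line conditions $L_4^\ell$ in $V_4$, with reduced structure; it is a smooth variety of the form $\mathbb P(\mathcal E)$ for a vector subbundle $\mathcal E\subseteq N_{B_3}V_3$ of rank $\binom n2$. *)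

(* Defs.v *)
From HB Require Import structures.
From mathcomp Require Import all_boot all_order all_algebra.
From mathcomp Require Export mpoly.

Set Implicit Arguments.
Unset Strict Implicit.
Unset Printing Implicit Defensive.

Import GRing.Theory.
Local Open Scope ring_scope.

(* Classical projective geometry over an algebraically closed field, with      *)
(* varieties identified with their sets of closed points. A point of P^(N-1)   *)
(* is represented by a nonzero row vector x : 'rV_N; a subset of P^(N-1) is    *)
(* a predicate on vectors that is invariant under nonzero scaling and false    *)
(* at 0.                                                                       *)

Definition pset (k : fieldType) (N : nat) := 'rV[k]_N -> Prop.

Definition same_point (k : fieldType) (N : nat) (x y : 'rV[k]_N) : Prop :=
  exists2 c : k, c != 0 & y = c *: x.

Definition vanishes (k : fieldType) (N : nat) (A : pset k N)
    (g : {mpoly k[N]}) : Prop :=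
  forall x, A x -> g.@[x 0] = 0.

Definition zariski_closure (k : fieldType) (N : nat) (A : pset k N) : pset k N :=
  fun y => y != 0 /\
    forall (e : nat) (g : {mpoly k[N]}),
      g \is e.-homog -> vanishes A g -> g.@[y 0] = 0.

(* The Segre embedding P^(N-1) x P^(M-1) -> P^(NM-1). *)
Definition segre (k : fieldType) (N M : nat) (x : 'rV[k]_N) (z : 'rV[k]_M) :
    'rV[k]_(N * M) :=
  mxvec (x^T *m z).

Definition eval_forms (k : fieldType) (N M : nat) (f : 'I_M -> {mpoly k[N]})
    (x : 'rV[k]_N) : 'rV[k]_M :=
  \row_j (f j).@[x 0].

(* Derivative of the tuple f at x in the direction v. *)
Definition diff_forms (k : fieldType) (N M : nat) (f : 'I_M -> {mpoly k[N]})
    (x v : 'rV[k]_N) : 'rV[k]_M :=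
  \row_j \sum_(i < N) v 0 i * ((f j)^`M(i)).@[x 0].

(* At every point x of V, the stalk at x of the ideal sheaf of B in V (both    *)
(* with their reduced structures) is generated by f_0, ..., f_(M-1): every     *)
(* form vanishing on B lies, after multiplication by some form not vanishing   *)
(* at x, in the ideal (f_0, ..., f_(M-1)) + I(V).                              *)
Definition generates_ideal_sheaf (k : fieldType) (N M : nat) (V B : pset k N)
    (f : 'I_M -> {mpoly k[N]}) : Prop :=
  forall x, V x ->
  forall (e : nat) (g : {mpoly k[N]}), g \is e.-homog -> vanishes B g ->
  exists (m : nat) (h : {mpoly k[N]}) (a : 'I_M -> {mpoly k[N]}),
    [/\ h \is m.-homog, h.@[x 0] != 0
      & vanishes V (h * g - \sum_(j < M) a j * f j)].

(* The blow-up of V along B is realised, as usual, as the closure of the graph *)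
(* of V \ B -> P^(M-1), x |-> [f_0(x) : ... : f_(M-1)(x)], where the f_j are   *)
(* forms of one common degree generating the ideal sheaf of B in V. Such       *)
(* families exist (the twist I_B(d) is globally generated for d large) and any *)
(* two of them give canonically isomorphic blow-ups, so a blow-up is recorded  *)
(* as an arbitrary choice of f.                                                *)
Record blowup (k : fieldType) (N : nat) (V B : pset k N) := Blowup {
  bl_size : nat;
  bl_deg : nat;
  bl_form : 'I_bl_size -> {mpoly k[N]};
  bl_homog : forall j, bl_form j \is bl_deg.-homog;
  bl_vanishes : forall j, vanishes B (bl_form j);
  bl_generates : generates_ideal_sheaf V B bl_form
}.

Arguments bl_form {k N V B} b _.

(* Proper transform of Z: the closure of the inverse image of Z \ B. *)
Definition transform (k : fieldType) (N : nat) (V B : pset k N)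
    (b : blowup V B) (Z : pset k N) : pset k (N * bl_size b) :=
  zariski_closure (fun y => exists x,
    [/\ Z x, ~ B x & same_point (segre x (eval_forms (bl_form b) x)) y]).

Arguments transform {k N V B} b Z _.

Definition blowup_variety (k : fieldType) (N : nat) (V B : pset k N) (b : blowup V B) :
    pset k (N * bl_size b) :=
  transform b V.

Arguments blowup_variety {k N V B} b _.

(* Inverse image of B; the blow-down map is (x, z) |-> x. *)
Definition exceptional (k : fieldType) (N : nat) (V B : pset k N)
    (b : blowup V B) : pset k (N * bl_size b) :=
  fun y => blowup_variety b y /\ exists x z, B x /\ y = segre x z.

Arguments exceptional {k N V B} b _.

(* The identification of P(N_x), N_x the normal space to B in V at x, with the *)
(* fibre of the exceptional divisor over x: the class of a tangent vector v    *)
(* goes to (x, [df_0(x)(v) : ... : df_(M-1)(x)(v)]), the limit as t -> 0 of    *)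
(* the point of the graph over x + t v.                                        *)
Definition normal_direction (k : fieldType) (N : nat) (V B : pset k N)
    (b : blowup V B) (x v : 'rV[k]_N) : 'rV[k]_(N * bl_size b) :=
  segre x (diff_forms (bl_form b) x v).

(* Number of coordinates on Sym^3(W), and the cubic form with given            *)
(* coordinates in a fixed basis of Sym^3(W).                                   *)
Definition cubic_dim (k : fieldType) (n : nat) : nat :=
  \dim {: dhomog n.+1 k 3%N}.

Definition cubic_of (k : fieldType) (n : nat) (v : 'rV[k]_(cubic_dim k n)) :
    {mpoly k[n.+1]} :=
  \sum_(i < cubic_dim k n)
    v 0 i *: mpoly_of_dhomog (vbasis {: dhomog n.+1 k 3%N})`_i.

Definition V0 (k : fieldType) (n : nat) : pset k (cubic_dim k n) :=
  fun v => v != 0.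

Arguments V0 {k n} _.

Definition linear_form (k : fieldType) (n : nat) (l : {mpoly k[n.+1]}) : Prop :=
  l \is 1%N.-homog.

Definition hyperplane (k : fieldType) (n : nat) (l : {mpoly k[n.+1]}) : Prop :=
  linear_form l /\ l != 0.

(* y = phi_0([l], [m]) *)
Definition phi0 (k : fieldType) (n : nat) (l m : {mpoly k[n.+1]}) :
    pset k (cubic_dim k n) :=
  fun y => exists2 c : k, c != 0 & cubic_of y = c *: (l * m ^+ 2).

Definition S0 (k : fieldType) (n : nat) : pset k (cubic_dim k n) :=
  fun y => exists l m, [/\ hyperplane l, hyperplane m & phi0 l m y].

Arguments S0 {k n} _.

Definition B0 (k : fieldType) (n : nat) : pset k (cubic_dim k n) :=
  fun y => exists l, hyperplane l /\ phi0 l l y.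

Arguments B0 {k n} _.

Definition B1 (k : fieldType) (n : nat) (b0 : blowup (@V0 k n) B0) :
    pset k (cubic_dim k n * bl_size b0) :=
  fun y => exists (l q : {mpoly k[n.+1]}) (x v : 'rV[k]_(cubic_dim k n)),
    [/\ hyperplane l, q \is 2%N.-homog,
        forall m, linear_form m -> l * q <> l ^+ 2 * m,
        cubic_of x = l ^+ 3 /\ cubic_of v = l * q
      & same_point (normal_direction b0 x v) y].

Arguments B1 {k n} b0 _.

Definition B2 (k : fieldType) (n : nat) (b0 : blowup (@V0 k n) B0)
    (b1 : blowup (blowup_variety b0) (B1 b0)) :
    pset k (cubic_dim k n * bl_size b0 * bl_size b1) :=
  fun y => transform b1 (exceptional b0) y /\ exceptional b1 y.

Arguments B2 {k n b0} b1 _.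

(* Lines in P^n are row spaces of matrices ell of rank 2; the restriction of f *)
(* to the line is the binary form f (s * row 0 + t * row 1), written with      *)
(* t = 1 as a polynomial in s = 'X whose coefficients 0..3 are those of the    *)
(* binary cubic.                                                               *)
Definition restrict_to_line (k : fieldType) (n : nat) (ell : 'M[k]_(2, n.+1))
    (f : {mpoly k[n.+1]}) : {poly k} :=
  mmap (@polyC k)
    (fun i => ell 0 i *: 'X + (ell 1 i)%:P) f.

(* Discriminant of a s^3 + b s^2 t + c s t^2 + d t^3. *)
Definition cubic_disc (k : fieldType) (a b c d : k) : k :=
  b ^+ 2 * c ^+ 2 - 4%:R * a * c ^+ 3 - 4%:R * b ^+ 3 * d
  - 27%:R * a ^+ 2 * d ^+ 2 + 18%:R * a * b * c * d.

Definition line_condition (k : fieldType) (n : nat) (ell : 'M[k]_(2, n.+1)) :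
    pset k (cubic_dim k n) :=
  fun y => V0 y /\
    let p := restrict_to_line ell (cubic_of y) in
    cubic_disc p`_3 p`_2 p`_1 p`_0 = 0.

Arguments line_condition {k n} ell _.

Definition B3 (k : fieldType) (n : nat)
    (b0 : blowup (@V0 k n) B0) (b1 : blowup (blowup_variety b0) (B1 b0))
    (b2 : blowup (blowup_variety b1) (B2 b1)) :
    pset k (cubic_dim k n * bl_size b0 * bl_size b1 * bl_size b2) :=
  transform b2 (transform b1 (transform b0 S0)).

Arguments B3 {k n b0 b1} b2 _.

Definition line_condition4 (k : fieldType) (n : nat)
    (b0 : blowup (@V0 k n) B0) (b1 : blowup (blowup_variety b0) (B1 b0))
    (b2 : blowup (blowup_variety b1) (B2 b1))
    (b3 : blowup (blowup_variety b2) (B3 b2))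
    (ell : 'M[k]_(2, n.+1)) :
    pset k (cubic_dim k n * bl_size b0 * bl_size b1 * bl_size b2 * bl_size b3) :=
  transform b3 (transform b2 (transform b1 (transform b0 (line_condition ell)))).

Arguments line_condition4 {k n b0 b1 b2} b3 ell _.

Definition B4 (k : fieldType) (n : nat)
    (b0 : blowup (@V0 k n) B0) (b1 : blowup (blowup_variety b0) (B1 b0))
    (b2 : blowup (blowup_variety b1) (B2 b1)) (b3 : blowup (blowup_variety b2) (B3 b2)) :
    pset k (cubic_dim k n * bl_size b0 * bl_size b1 * bl_size b2 * bl_size b3) :=
  fun y => forall ell : 'M[k]_(2, n.+1), row_free ell -> line_condition4 b3 ell y.

Arguments B4 {k n b0 b1 b2} b3 _.

(* Main.v *)
From HB Require Import structures.
Require Import Defs.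
From mathcomp Require Import all_boot all_order all_algebra.
From mathcomp Require Import ring.
From mathcomp Require classical_sets.
From Stdlib Require Import Classical ClassicalEpsilon.

(** Why the intersection is empty.

    Suppose that [y5] in [V_5] lies on the proper transforms of all line
    conditions.  Let [K] be the function field of the space of cubics.  The
    tautological cubic over [K] is a generic point of [V_0], and since a blow-up
    is the closure of a graph it lifts to a generic point of each [V_i].  The
    local ring of [V_5] at [y5] is dominated by the ring of a place [W] of [K]
    with values in [k] ([generic_place], by Zorn's lemma and Chevalley's
    argument).  In that ring, of any two elements one divides the other, and the
    contradiction is a comparison of divisibilities in it.  No smoothness of
    the [V_i] or of the centers is used.

    Invariants.  Choose a point [p0] on which the cubic below [y5] does not
    vanish and complete the cube: up to a scalar the cubic is
    [X^3 - 3 P X + 2 G] with [X] a linear form, [P] a quadratic form and [G] a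
    cubic form, both forms on the quotient by
    [p0].  The discriminant on the line through
    [p0] and [p] is [D = P(p)^3 - G(p)^2] up to a unit.  On [B_0] the forms [P]
    and [G] vanish, and on [S_0] they are [M^2] and [M^3] for a linear form [M].

    Upper bounds.  Let [pi_i] be a local equation of the exceptional divisor of
    the [i]-th blow-up.  A function that vanishes on the center remains regular
    after division by [pi_i] ([regular_div]), and a function on the blow-up that
    vanishes on [Z] after multiplication by a power of [pi_i] vanishes on the
    proper transform of [Z] ([regular_transform]).  As [P], [G] vanish on [B_0],
    [G / pi_0] on [B_1], [pi_0 / pi_1] and [pi_1] on [B_2], as [B_3] is the
    proper transform of [S_0], which lies on all line conditions, and as [B_4]
    lies on all of them by definition, the quotient
    [D / (pi_0^2 pi_1 pi_2 pi_3 pi_4)] vanishes on the last proper transform of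
    the line condition ([disc_regular]).  So it has the value [0] for every
    [p] ([disc_value]).

    Lower bounds.  The blow-ups are parametrised by polynomial charts
    [psi_0, ..., psi_4] in one set of variables, related by explicit
    substitutions.  Certain coordinate planes of each chart map into the next
    center ([center0_point] to [center4_point]); hence [pi_i] lies in the ideal
    of those coordinates ([lower0] to [lower4]).  The essential case is the
    last one: a point of the plane lies on the proper transform of every line
    condition, because for every line there is an explicit arc of cubics
    tangent to that line whose lift ends at the point ([center4_good_line]).

    Contradiction.  In [first_pass], [P] and [G] are divided by the
    coefficients of smallest order.  The vanishing of the quotient of [D] for
    all [p] forces a point [p1] at which [P(p1)], [G(p1)] have exactly the
    orders of [pi_0], [pi_0 pi_1], with [P(p1)^3 / G(p1)^2] of value [1] and
    [pi_1 / pi_2] a unit.  In [second_pass], with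
    [m = P(p1, -) / P(p1)], the normalised invariants are [m^2 + q] and
    [m^3 + 3/2 m q + g], and [eps = P(p1)^3 / G(p1)^2 - 1]; here [q], [g] and
    [eps] vanish on [B_3].  Dividing them by the terms of smallest order and
    restricting to the lines through [p1], the value of the quotient of [D] is
    a polynomial in one variable, and its coefficients vanish; so all the
    quotients have the value [0], whereas the divisors were chosen among the
    terms and one of the quotients is [1]. *)

Set Implicit Arguments.
Unset Strict Implicit.
Unset Printing Implicit Defensive.
Import GRing.Theory.
Local Open Scope ring_scope.

(** * Evaluation of polynomials at points over an algebra *)

(** One evaluation map serves for values at points over [k] and over [K], for
    polynomial arcs, and (with [phi] the constants) for substitution. *)
Definition pev (k A : comNzRingType) (phi : k -> A) (N : nat) (x : 'rV[A]_N)
  (g : {mpoly k[N]}) : A := mmap phi (x 0) g.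

Section Evaluation.
Variable k : comNzRingType.

Lemma pev_ext (A : comNzRingType) (phi psi : k -> A) N (x : 'rV[A]_N) g :
  phi =1 psi -> pev phi x g = pev psi x g.
Proof. by move=> e; apply: eq_bigr => m _; rewrite e. Qed.

Lemma pev_id N (x : 'rV[k]_N) (g : {mpoly k[N]}) : g.@[x 0] = pev idfun x g.
Proof. by []. Qed.

Lemma pevX (A : comNzRingType) (phi : {rmorphism k -> A}) N (x : 'rV[A]_N) i :
  pev phi x 'X_i = x 0 i.
Proof. by rewrite /pev mmapX mmap1U. Qed.

Lemma pevC (A : comNzRingType) (phi : {rmorphism k -> A}) N (x : 'rV[A]_N) c :
  pev phi x c%:MP = phi c.
Proof. by rewrite /pev mmapC. Qed.

Lemma pev_comp (A B : comNzRingType) (phi : {rmorphism k -> A})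
  (chi : {rmorphism A -> B}) N (x : 'rV[A]_N) (g : {mpoly k[N]}) :
  chi (pev phi x g) = pev (chi \o phi) (map_mx chi x) g.
Proof.
rewrite /pev /mmap rmorph_sum; apply: eq_bigr => m _ /=.
rewrite rmorphM; congr (_ * _); rewrite /mmap1 rmorph_prod.
by apply: eq_bigr => i _; rewrite rmorphXn mxE.
Qed.

Lemma pev_subst (A : comNzRingType) (phi : {rmorphism k -> A}) r N
  (c : 'rV[A]_r) (x : 'rV[{mpoly k[r]}]_N) (g : {mpoly k[N]}) :
  pev phi c (pev (@mpolyC r k) x g) = pev phi (map_mx (pev phi c) x) g.
Proof.
have := pev_comp (@mpolyC r k) (mmap phi (c 0)) x g.
rewrite /pev => ->; apply: (@pev_ext _ _ phi _ _ g) => a.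
by rewrite /= mmapC.
Qed.

Lemma pev_homog (A : comNzRingType) (phi : {rmorphism k -> A}) N e
  (g : {mpoly k[N]}) (c : A) (x : 'rV[A]_N) :
  g \is e.-homog -> pev phi (c *: x) g = c ^+ e * pev phi x g.
Proof.
move=> /dhomogP hg; rewrite /pev /mmap mulr_sumr.
rewrite big_seq [RHS]big_seq; apply: eq_bigr => m /hg hm.
rewrite mulrCA; congr (_ * _); rewrite /mmap1 -hm -[Measure.sort _ m]/(mdeg m) mdegE.
rewrite (eq_bigr (fun i => c ^+ m i * x 0 i ^+ m i)); last first.
  by move=> i _; rewrite mxE exprMn.
by rewrite big_split /= prodrXr.
Qed.

Lemma pev_homog0 (A : comNzRingType) (phi : {rmorphism k -> A}) N e
  (g : {mpoly k[N]}) : (0 < e)%N -> g \is e.-homog -> pev phi (0 : 'rV[A]_N) g = 0.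
Proof.
by move=> e0 hg; rewrite -(scale0r (0 : 'rV[A]_N)) (pev_homog _ _ _ hg) expr0n
   eqn0Ngt e0 mul0r.
Qed.

Lemma dhomogX1 N (i : 'I_N) : ('X_i : {mpoly k[N]}) \is 1.-homog.
Proof. by rewrite dhomogX; apply/eqP; exact: mdeg1. Qed.

Lemma dhomogC N (c : k) : (c%:MP : {mpoly k[N]}) \is 0.-homog.
Proof. by rewrite -mul_mpolyC mulr1 || rewrite -[c%:MP]mulr1 mul_mpolyC rpredZ // dhomog1. Qed.

Lemma dhomogMC N e (c : k) (g : {mpoly k[N]}) :
  g \is e.-homog -> c%:MP * g \is e.-homog.
Proof. by move=> h; rewrite mul_mpolyC rpredZ. Qed.

Lemma pev_dhomog r N d e (x : 'rV[{mpoly k[r]}]_N) (g : {mpoly k[N]}) :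
  (forall i, x 0 i \is d.-homog) -> g \is e.-homog ->
  pev (@mpolyC r k) x g \is (d * e).-homog.
Proof.
move=> hx /dhomogP hg; rewrite /pev /mmap big_seq; apply: rpred_sum => m /hg hm.
apply: dhomogMC; rewrite /mmap1 -hm -[Measure.sort _ m]/(mdeg m) mdegE.
elim/big_ind2: _ => [|a p b q hp hq|i _]; first by rewrite muln0 dhomog1.
  by rewrite mulnDr; apply: dhomogM.
by apply: dhomogMn; apply: hx.
Qed.

(** Polynomial maps respect congruences modulo a principal ideal.  The subset
    [S] is a subring; it will be a valuation ring in a field or a whole ring. *)
Lemma pev_congr (A : comNzRingType) (phi : {rmorphism k -> A}) (S : A -> Prop)
  (al : A) N (x x0 : 'rV[A]_N) (g : {mpoly k[N]}) :
  (forall c, S (phi c)) -> (forall u v, S u -> S v -> S (u + v)) ->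
  (forall u v, S u -> S v -> S (u * v)) ->
  (forall i, S (x 0 i)) -> (forall i, S (x0 0 i)) ->
  (forall i, exists2 u, S u & x 0 i - x0 0 i = al * u) ->
  exists2 u, S u & pev phi x g - pev phi x0 g = al * u.
Proof.
move=> hC hD hM hx hx0 hd.
have h0 : S 0 by rewrite -(rmorph0 phi).
have h1 : S 1 by rewrite -(rmorph1 phi).
have key : forall p q p' q', S p -> S q -> S p' -> S q' ->
  (exists2 u, S u & p - p' = al * u) -> (exists2 u, S u & q - q' = al * u) ->
  exists2 u, S u & p * q - p' * q' = al * u.
  move=> p q p' q' Sp Sq Sp' Sq' [u Su eu] [v Sv ev].
  exists (u * q + p' * v); first by apply: hD; apply: hM.
  rewrite mulrDr [al * (p' * v)]mulrCA -ev mulrA -eu; ring.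
have hmon : forall m : 'X_{1..N}, [/\ S (mmap1 (x 0) m), S (mmap1 (x0 0) m) &
   exists2 u, S u & mmap1 (x 0) m - mmap1 (x0 0) m = al * u].
  move=> m; rewrite /mmap1.
  elim/big_ind2: _ => [|p p' q q' [a b c] [a' b' c']|i _].
  - by split=> //; exists 0 => //; rewrite mulr0 subrr.
  - by split; [exact: hM|exact: hM|exact: key].
  elim: (m i) => [|j [IH1 IH2 IH3]]; first by split=> //; exists 0 => //; rewrite mulr0 subrr.
  by rewrite !exprS; split; [exact: hM|exact: hM|exact: key].
rewrite /pev /mmap; elim/big_ind2: _ => [|p p' q q' [u Su eu] [v Sv ev]|m _].
- by exists 0 => //; rewrite mulr0 subrr.
- by exists (u + v); [exact: hD|rewrite mulrDr -eu -ev; ring].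
have [a b [u Su eu]] := hmon m; exists (phi g@_m * u); first exact: hM.
by rewrite -mulrBr eu mulrCA.
Qed.

Lemma pev_closed (A : comNzRingType) (phi : {rmorphism k -> A}) (S : A -> Prop)
  N (x : 'rV[A]_N) (g : {mpoly k[N]}) :
  (forall c, S (phi c)) -> (forall u v, S u -> S v -> S (u + v)) ->
  (forall u v, S u -> S v -> S (u * v)) ->
  (forall i, S (x 0 i)) -> S (pev phi x g).
Proof.
move=> hC hD hM hx; rewrite /pev /mmap.
have h0 : S 0 by rewrite -(rmorph0 phi).
have h1 : S 1 by rewrite -(rmorph1 phi).
elim/big_ind: _ => [//|u v|m _]; [exact: hD|apply: (hM) => //; rewrite /mmap1].
elim/big_ind: _ => [//|u v|i _]; [exact: hM|].
by elim: (m i) => [//|j IH]; rewrite exprS; apply: hM.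
Qed.

End Evaluation.

HB.instance Definition _ (k A : comNzRingType) (phi : {rmorphism k -> A}) N (x : 'rV[A]_N) :=
  GRing.RMorphism.copy (pev phi x) (mmap phi (x 0)).

Section ZeroTest.
Variable k : closedFieldType.

Lemma closed_poly0 (p : {poly k}) : (forall a, p.[a] = 0) -> p = 0.
Proof.
move=> h; have [//|/closed_nonrootP [x]] := eqVneq p 0.
by rewrite /root h eqxx.
Qed.

(** An algebraically closed field is infinite, so one may cancel a nonzero
    factor when testing a polynomial for zero on all values. *)
Lemma poly_dense (p q : {poly k}) : q != 0 ->
  (forall a, q.[a] != 0 -> p.[a] = 0) -> p = 0.
Proof.
move=> q0 h; apply/eqP; have /eqP : q * p = 0.
  apply: closed_poly0 => a; rewrite hornerM.
  by have [->|/h->] := eqVneq q.[a] 0; rewrite ?mul0r ?mulr0.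
by rewrite mulf_eq0 (negbTE q0).
Qed.

Lemma muni_inj n (g : {mpoly k[n.+1]}) : muni g = 0 -> g = 0.
Proof.
move=> h; apply/mpolyP => m; rewrite mcoeff0.
pose w (i : 'I_n) := widen_ord (leqnSn n) i.
pose rst (m : 'X_{1..n.+1}) : 'X_{1..n} := [multinom m (w i) | i < n].
have := congr1 (fun P : {poly {mpoly k[n]}} => (P`_(m ord_max))@_(rst m)) h.
rewrite coef0 mcoeff0 muniE coef_sum raddf_sum /= => e.
rewrite -[RHS]e {e}; apply/esym.
have E (m' : 'X_{1..n.+1}) : ((g@_m' *: 'X_[rst m'] *: 'X^(m' ord_max))`_(m ord_max))@_(rst m)
   = g@_m' * (m' == m)%:R.
  rewrite coefZ coefXn.
  have -> : (m' == m) = (m ord_max == m' ord_max) && (rst m' == rst m).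
    apply/eqP/andP => [->|[/eqP e1 /eqP e2]]; first by rewrite !eqxx.
    apply/mnmP => i; case: (unliftP ord_max i) => [j ->|->]; last by rewrite e1.
    have -> : lift ord_max j = w j.
      by apply: val_inj; rewrite /= /bump leqNgt ltn_ord add0n.
    by move/mnmP: e2 => /(_ j); rewrite !mnmE.
  case: (_ == m' ord_max); rewrite ?mulr0 ?mcoeff0 ?mulr0 //.
  by rewrite mulr1 mcoeffZ mcoeffX.
rewrite (eq_bigr (fun m' => g@_m' * (m' == m)%:R)); last by move=> m' _; exact: E.
case: (boolP (m \in msupp g)) => hm.
  rewrite (bigD1_seq m) ?msupp_uniq //= eqxx mulr1 big1 ?addr0 // => m' /negbTE->.
  by rewrite mulr0.
rewrite memN_msupp_eq0 // big_seq big1 // => m' hm'.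
by case: eqP hm => [<-|]; rewrite ?hm' ?mulr0.
Qed.

Lemma mpoly_zero_test n (g : {mpoly k[n]}) :
  (forall x : 'rV[k]_n, pev idfun x g = 0) -> g = 0.
Proof.
elim: n g => [|n IH] g h.
  apply/mpolyP => m; rewrite mcoeff0.
  have e : \sum_(m' <- msupp g) g@_m' = 0.
    rewrite -[RHS](h 0); apply: eq_bigr => m' _.
    by rewrite /mmap1 big_ord0 mulr1.
  case: (boolP (m \in msupp g)) => hm; last exact: memN_msupp_eq0.
  rewrite -[RHS]e (bigD1_seq m) ?msupp_uniq //= big1 ?addr0 // => m'.
  by have -> : m' = m; [apply/mnmP; case|rewrite eqxx].
apply: muni_inj; apply/polyP => i; rewrite coef0; apply: IH => x.
have E (a : k) : (map_poly (pev idfun x) (muni g)).[a]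
   = pev idfun (\row_j if unlift ord_max j is Some i then x 0 i else a) g.
  rewrite muniE rmorph_sum horner_sum; apply: eq_bigr => m _.
  rewrite -mul_polyC rmorphM /= map_polyXn map_polyC /= hornerM hornerC hornerXn.
  rewrite /pev mmapZ mmapX -mulrA; congr (_ * _).
  rewrite /mmap1 big_ord_recr /= mxE unlift_none; congr (_ * _).
  apply: eq_bigr => j _; rewrite mxE mnmE.
  have -> : widen_ord (leqnSn n) j = lift ord_max j.
    by apply: val_inj; rewrite /= /bump leqNgt ltn_ord add0n.
  by rewrite liftK.
rewrite -[LHS]/(pev idfun x _) -(coef_map (pev idfun x)).
by rewrite (_ : map_poly _ _ = 0) ?coef0 //; apply: closed_poly0 => a; rewrite E.
Qed.

End ZeroTest.

(** * Places with values in an algebraically closed field *)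

Section Places.
Variables (k : closedFieldType) (K : fieldType) (io : {rmorphism k -> K}).
Implicit Types (W : K -> k -> Prop) (P Q : {poly K}) (p q : {poly k}).

(** The graph of a ring morphism to [k] from a subring of [K] that contains [k];
    as a relation, so that extensions are inclusions. *)
Definition partial_place W : Prop :=
  [/\ forall c, W (io c) c,
      forall x y a b, W x a -> W y b -> W (x - y) (a - b),
      forall x y a b, W x a -> W y b -> W (x * y) (a * b)
    & forall a, W 0 a -> a = 0].

(** The subring is a valuation ring. *)
Definition place W : Prop :=
  partial_place W /\ forall x, (exists a, W x a) \/ (x != 0 /\ W x^-1 0).

Definition maximal_place W : Prop := partial_place W /\
  forall W', partial_place W' -> (forall x a, W x a -> W' x a) ->
    forall x a, W' x a -> W x a.

(** Zorn's lemma on the graphs that contain [W0]; the graph of [W0] is joined to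
    each element of a chain, so that the empty chain is bounded too. *)
Lemma exists_maximal_place W0 : partial_place W0 ->
  exists2 W, maximal_place W & forall x a, W0 x a -> W x a.
Proof.
move=> pW0; pose U (A : K * k -> Prop) x a := A (x, a) \/ W0 x a.
have [F sF tF|A [pA mA]] := @classical_sets.Zorn_bigcup (K * k)%type
    (fun A => partial_place (U A)).
  have two x y a b : U (classical_sets.bigcup F id) x a ->
     U (classical_sets.bigcup F id) y b ->
     exists B, [/\ partial_place (U B), U B x a, U B y b &
       forall x a, U B x a -> U (classical_sets.bigcup F id) x a].
    move=> [[A FA Axa]|wx] [[B FB Byb]|wy].
    - have [sAB|sBA] := tF A B FA FB.
        exists B; split; [exact: sF|left; exact: sAB|by left|].
        by move=> z c [Bz|]; [left; exists B|right].
      exists A; split; [exact: sF|by left|left; exact: sBA|].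
      by move=> z c [Bz|]; [left; exists A|right].
    - exists A; split; [exact: sF|by left|by right|].
      by move=> z c [Bz|]; [left; exists A|right].
    - exists B; split; [exact: sF|by right|by left|].
      by move=> z c [Bz|]; [left; exists B|right].
    exists (fun _ => False); split; [|by right|by right|by move=> z c []; right].
    have e z c : U (fun _ => False) z c <-> W0 z c by split=> [[]|]; [|exact|right].
    case: pW0 => w1 w2 w3 w4; split.
    - by move=> c; right.
    - by move=> z t c d /e h1 /e h2; apply/e; exact: w2.
    - by move=> z t c d /e h1 /e h2; apply/e; exact: w3.
    - by move=> c /e; exact: w4.
  split.
  - by move=> c; right; case: pW0.
  - by move=> x y a b /two h /h [B [[_ w2 _ _] h1 h2 hB]]; apply: hB; exact: w2.
  - by move=> x y a b /two h /h [B [[_ _ w3 _] h1 h2 hB]]; apply: hB; exact: w3.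
  - by move=> a h; have [B [[_ _ _ w4] h1 _ _]] := two _ _ _ _ h h; exact: w4.
exists (U A); last by right.
split=> // W' pW' sW' x a hxa; left; apply: NNPP => nA.
apply: (mA (fun z => W' z.1 z.2)).
  split=> [[z c] hz|/(_ (x, a) hxa)//].
  by apply: sW'; left.
have e z c : U (fun z => W' z.1 z.2) z c <-> W' z c.
  by split=> [[//|h]|]; [apply: sW'; right|left].
case: pW' => w1 w2 w3 w4; split.
- by move=> c; apply/e.
- by move=> z t c d /e h1 /e h2; apply/e; exact: w2.
- by move=> z t c d /e h1 /e h2; apply/e; exact: w3.
- by move=> c /e; exact: w4.
Qed.

Section PartialPlace.
Variable W : K -> k -> Prop.
Hypothesis pW : partial_place W.

Lemma plC c : W (io c) c. Proof. by case: pW. Qed.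
Lemma plB x y a b : W x a -> W y b -> W (x - y) (a - b).
Proof. by case: pW => _ h _ _; exact: h. Qed.
Lemma plM x y a b : W x a -> W y b -> W (x * y) (a * b).
Proof. by case: pW => _ _ h _; exact: h. Qed.
Lemma pl0_inv a : W 0 a -> a = 0. Proof. by case: pW => _ _ _; exact. Qed.
Lemma pl0 : W 0 0. Proof. by rewrite -{1}(rmorph0 io); exact: plC. Qed.
Lemma pl1 : W 1 1. Proof. by rewrite -{1}(rmorph1 io); exact: plC. Qed.
Lemma plN x a : W x a -> W (- x) (- a).
Proof. by move=> h; rewrite -[- x]sub0r -[- a]sub0r; exact: plB pl0 h. Qed.
Lemma plD x y a b : W x a -> W y b -> W (x + y) (a + b).
Proof. by move=> hx /plN hy; rewrite -[y]opprK -[b]opprK; exact: plB. Qed.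
Lemma plX x a i : W x a -> W (x ^+ i) (a ^+ i).
Proof. by move=> h; elim: i => [|i IH]; [exact: pl1|rewrite !exprS; exact: plM]. Qed.
Lemma pl_inj x a b : W x a -> W x b -> a = b.
Proof.
by move=> ha hb; apply/eqP; rewrite -subr_eq0; apply/eqP/pl0_inv; rewrite -(subrr x); exact: plB.
Qed.
Lemma pl_sum (I : Type) (r : seq I) (Q : pred I) (F : I -> K) (f : I -> k) :
  (forall i, Q i -> W (F i) (f i)) ->
  W (\sum_(i <- r | Q i) F i) (\sum_(i <- r | Q i) f i).
Proof.
by move=> h; apply: (big_ind2 W) => // [|x a y b]; [exact: pl0|exact: plD].
Qed.

(** The place extended coefficientwise to polynomials. *)
Definition poly_place P p := forall i, W P`_i p`_i.

Lemma poly_placeM P Q p q :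
  poly_place P p -> poly_place Q q -> poly_place (P * Q) (p * q).
Proof. by move=> h1 h2 i; rewrite !coefM; apply: pl_sum => j _; exact: plM. Qed.

Lemma poly_placeB P Q p q :
  poly_place P p -> poly_place Q q -> poly_place (P - Q) (p - q).
Proof. by move=> h1 h2 i; rewrite !coefB; exact: plB. Qed.

Lemma poly_placeC c a : W c a -> poly_place c%:P a%:P.
Proof. by move=> h [|i]; rewrite !coefC //=; exact: pl0. Qed.

Lemma poly_place_io p : poly_place (map_poly io p) p.
Proof. by move=> i; rewrite coef_map; exact: plC. Qed.

Lemma poly_placeX : poly_place 'X 'X.
Proof. by move=> i; rewrite !coefX; case: (i == 1%N); [exact: pl1|exact: pl0]. Qed.

(** Either the place extends to the ring generated by [x], or the maximal ideal
    of its ring blows up to the unit ideal there. *)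
Lemma place_extension x :
  (exists W' a, [/\ partial_place W', forall y b, W y b -> W' y b & W' x a]) \/
  exists2 P, poly_place P 1 & P.[x] = 0.
Proof.
pose I p := exists2 P, poly_place P p & P.[x] = 0.
have IB p q : I p -> I q -> I (p - q).
  move=> [P hP eP] [Q hQ eQ]; exists (P - Q); first exact: poly_placeB.
  by rewrite hornerD hornerN eP eQ subrr.
have IM p q : I p -> I (q * p).
  move=> [P hP eP]; exists (map_poly io q * P).
    by apply: poly_placeM => //; exact: poly_place_io.
  by rewrite hornerM eP mulr0.
have [I1|nI1] := classic (I 1); [by right|left].
suff [a ha] : exists a, forall p, I p -> p.[a] = 0.
  exists (fun z c => exists P p, [/\ poly_place P p, z = P.[x] & c = p.[a]]), a; split.
  - split.
    + move=> c; exists (io c)%:P, c%:P; rewrite !hornerC; split=> //.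
      by apply: poly_placeC; exact: plC.
    + move=> _ _ _ _ [P [p [h -> ->]]] [Q [q [h' -> ->]]].
      by exists (P - Q), (p - q); rewrite !hornerE; split=> //; exact: poly_placeB.
    + move=> _ _ _ _ [P [p [h -> ->]]] [Q [q [h' -> ->]]].
      by exists (P * Q), (p * q); rewrite !hornerM; split=> //; exact: poly_placeM.
    + by move=> _ [P [p [h e ->]]]; apply: ha; exists P.
  - move=> y b h; exists y%:P, b%:P; rewrite !hornerC; split=> //.
    exact: poly_placeC.
  - by exists 'X, 'X; rewrite !hornerX; split=> //; exact: poly_placeX.
have [I0|nI0] := classic (exists2 p, I p & p != 0); last first.
  exists 0 => p Ip; have [->|p0] := eqVneq p 0; first by rewrite horner0.
  by case: nI0; exists p.
have [p0 [Ip0 p00 hmin]] : exists p0, [/\ I p0, p0 != 0 &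
    forall q, I q -> (size q < size p0)%N -> q = 0].
  case: I0 => p; have [m] := ubnP (size p); elim: m p => // m IH p hm Ip hp.
  have [[q Iq /andP[hs hq]]|h] := classic (exists2 q, I q & (size q < size p)%N && (q != 0)).
    by apply: (IH q) => //; exact: leq_trans hs _.
  exists p; split=> // q Iq hs; apply/eqP; apply: contra_notT h => hq.
  by exists q => //; rewrite hs.
have [a ra] : exists a, root p0 a.
  apply/closed_rootP; apply/negP => /size_poly1P [c c0 e]; apply: nI1.
  by rewrite -(polyC1 k) -(mulVf c0) polyCM -e; exact: IM.
exists a => p Ip.
have e : p %% p0 = 0.
  apply: hmin; last by rewrite ltn_modp.
  have -> : p %% p0 = p - p %/ p0 * p0 by rewrite {2}(divp_eq p p0) addrAC subrr add0r.
  exact: IB Ip (IM _ _ Ip0).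
by rewrite (divp_eq p p0) e addr0 hornerM (rootP ra) mulr0.
Qed.

End PartialPlace.

(** Chevalley's argument.  If [W] extends neither to [x] nor to [1/x] then both
    satisfy a relation [P(x) = 0], [Q(1/x) = 0] with [P], [Q] of value [1]; the
    constant coefficient of [Q] is a unit, so the relation of larger degree can
    be shortened by a multiple of the other. *)
Lemma maximal_place_place W : maximal_place W -> place W.
Proof.
move=> [pW mW]; split=> //.
have dich x : (exists a, W x a) \/ exists2 P, poly_place W P 1 & P.[x] = 0.
  have [[W' [a [pW' sW' hx]]]|h] := place_extension pW x; [left|by right].
  by exists a; exact: mW pW' sW' _ _ hx.
have hinv u a : W u a -> a != 0 -> W u^-1 a^-1.
  move=> hu a0.
  have u0 : u != 0 by apply: contraNneq a0 => u0; apply/eqP/(pl0_inv pW); rewrite -u0.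
  have [[b hb]|[P hP eP]] := dich u^-1.
    have /(pl_inj pW (pl1 pW)) e : W 1 (a * b) by rewrite -(mulfV u0); exact: plM.
    by rewrite -[a^-1]mulr1 e mulKf.
  have [m hm] : exists m, (size P <= m.+1)%N by exists (size P).
  have e0 : \sum_(i < m.+1) P`_i * u ^+ (m - i) = 0.
    transitivity (u ^+ m * P.[u^-1]); last by rewrite eP mulr0.
    rewrite (horner_coef_wide _ hm) mulr_sumr.
    apply: eq_bigr => i _; rewrite exprVn mulrCA; congr (_ * _).
    by rewrite expfB_cond // (negbTE u0) add0n -ltnS ltn_ord.
  have h : W 0 (\sum_(i < m.+1) (1 : {poly k})`_i * a ^+ (m - i)).
    by rewrite -e0; apply: pl_sum => // i _; apply: plM => //; exact: plX.
  have := pl0_inv pW h; rewrite big_ord_recl big1 ?addr0; last first.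
    by move=> i _; rewrite coef1 mul0r.
  by rewrite coef1 mul1r subn0 => /eqP; rewrite expf_eq0 (negbTE a0) andbF.
(* By induction on the sum of the degrees of the two relations. *)
have noboth : forall N n m x P Q, (n + m < N)%N -> x != 0 ->
    poly_place W P 1 -> P.[x] = 0 -> (size P <= n.+1)%N ->
    poly_place W Q 1 -> Q.[x^-1] = 0 -> (size Q <= m.+1)%N -> False.
  elim=> // N IH n m x P Q hN x0 hP eP sP hQ eQ sQ.
  wlog lemn : n m x x0 P Q hN hP eP sP hQ eQ sQ / (m <= n)%N.
    move=> H; case: (leqP m n) => h; first exact: (H n m x x0 P Q).
    apply: (H m n x^-1 _ Q P); rewrite ?invr_eq0 ?invrK 1?addnC //.
    exact: ltnW.
  case: n => [|n] in hN sP lemn *.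
    have e : P = (P`_0)%:P by apply: size1_polyC.
    have := hP 0%N; rewrite coef1 /=.
    move: eP; rewrite e hornerC coefC /= => -> /(pl0_inv pW) /eqP.
    by rewrite oner_eq0.
  have hQ0 : W (Q`_0)^-1 1.
    by rewrite -(invr1 k); apply: hinv; rewrite ?oner_eq0 //; have := hQ 0%N; rewrite coef1.
  have Q00 : Q`_0 != 0.
    apply/eqP => e; have := hQ 0%N; rewrite e coef1 => /(pl0_inv pW)/eqP.
    by rewrite oner_eq0.
  pose R := \sum_(j < m.+1) Q`_j *: 'X^(n.+1 - j).
  have Rx : R.[x] = 0.
    transitivity (x ^+ n.+1 * Q.[x^-1]); last by rewrite eQ mulr0.
    rewrite (horner_coef_wide _ sQ) mulr_sumr.
    rewrite /R horner_sum; apply: eq_bigr => j _.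
    rewrite hornerZ hornerXn exprVn mulrCA; congr (_ * _).
    by rewrite expfB_cond // (negbTE x0) add0n (leq_trans _ lemn) // -ltnS ltn_ord.
  have hR i : exists r, W R`_i r.
    exists (\sum_(j < m.+1) (1 : {poly k})`_j * (i == n.+1 - j)%N%:R).
    rewrite /R coef_sum; apply: pl_sum => // j _; rewrite coefZ coefXn.
    by apply: (plM pW (hQ j)); case: (i == (n.+1 - j)%N); [exact: (pl1 pW)|exact: (pl0 pW)].
  pose c := P`_n.+1 / Q`_0.
  have hc : W c 0.
    by rewrite -(mul0r 1) /c; apply: (plM pW _ hQ0); have := hP n.+1; rewrite coef1.
  apply: (IH n m x (P - c *: R) Q) => //.
  - move=> i; rewrite coefB coefZ; have [r hr] := hR i.
    by have := plB pW (hP i) (plM pW hc hr); rewrite mul0r subr0.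
  - by rewrite hornerD hornerN hornerZ Rx eP mulr0 subrr.
  apply/leq_sizeP => i; rewrite leq_eqVlt => /orP[/eqP <-|hi].
    rewrite coefB coefZ /R coef_sum big_ord_recl big1 => [|j _]; last first.
      rewrite coefZ coefXn; case: eqP; rewrite ?mulr0 //=.
      by rewrite /bump /= add1n subSS => e; have := leq_subr j n; rewrite -e ltnn.
    by rewrite addr0 coefZ coefXn subn0 eqxx mulr1 /c divfK // subrr.
  rewrite nth_default //; apply: leq_trans (size_polyD _ _) _.
  rewrite geq_max size_polyN (leq_trans sP) //=.
  apply: leq_trans (size_scale_leq _ _) _.
  apply: leq_trans (size_sum _ _ _) _; apply/bigmax_leqP => j _.
  apply: leq_trans (size_scale_leq _ _) _; rewrite size_polyXn.
  by rewrite (leq_trans _ hi) // ltnS leq_subr.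
move=> x; have [->|x0] := eqVneq x 0; first by left; exists 0; exact: (pl0 pW).
have [//|[P hP eP]] := dich x; [by left|right].
have [[b hb]|[Q hQ eQ]] := dich x^-1; last first.
  by case: (@noboth _ (size P) (size Q) x P Q (ltnSn _)).
split=> //; have [<- //|b0] := eqVneq b 0.
have := hinv _ _ hb b0; rewrite invrK => hx.
have h : W P.[x] ((1 : {poly k}).[b^-1]).
  rewrite (horner_coef_wide _ (leqnSn _)).
  rewrite (@horner_coef_wide _ (size P).+1); last by rewrite size_poly1.
  by apply: (pl_sum pW) => i _; apply: (plM pW (hP i)); exact: (plX pW).
by move: h; rewrite eP hornerC => /(pl0_inv pW)/eqP; rewrite oner_eq0.
Qed.

Lemma exists_place W0 : partial_place W0 ->
  exists2 W, place W & forall x a, W0 x a -> W x a.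
Proof.
by move=> /exists_maximal_place [W /maximal_place_place]; exists W.
Qed.

End Places.

(** * Segre products, pull-backs and closures *)

Definition segreR (A : comNzRingType) N M (x : 'rV[A]_N) (z : 'rV[A]_M) : 'rV[A]_(N * M) :=
  mxvec (x^T *m z).

Lemma segreRE (A : comNzRingType) N M (x : 'rV[A]_N) (z : 'rV[A]_M) i j :
  segreR x z 0 (mxvec_index i j) = x 0 i * z 0 j.
Proof. by rewrite /segreR mxvecE mxE big_ord1 mxE. Qed.

Lemma row_pairP (A : Type) N M (x y : 'rV[A]_(N * M)) :
  (forall i j, x 0 (mxvec_index i j) = y 0 (mxvec_index i j)) -> x = y.
Proof. by move=> h; apply/rowP => l; case/mxvec_indexP: l => i j. Qed.

Lemma segreRZ (A : comNzRingType) N M (a b : A) (x : 'rV[A]_N) (z : 'rV[A]_M) :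
  segreR (a *: x) (b *: z) = (a * b) *: segreR x z.
Proof. by apply: row_pairP => i j; rewrite mxE !segreRE !mxE mulrACA. Qed.

Lemma segreR0r (A : comNzRingType) N M (x : 'rV[A]_N) : segreR x (0 : 'rV[A]_M) = 0.
Proof. by apply: row_pairP => i j; rewrite segreRE !mxE mulr0. Qed.

Lemma segreR0l (A : comNzRingType) N M (z : 'rV[A]_M) : segreR (0 : 'rV[A]_N) z = 0.
Proof. by apply: row_pairP => i j; rewrite segreRE !mxE mul0r. Qed.

Lemma map_segreR (A B : comNzRingType) (f : {rmorphism A -> B}) N M
  (x : 'rV[A]_N) (z : 'rV[A]_M) :
  map_mx f (segreR x z) = segreR (map_mx f x) (map_mx f z).
Proof. by apply: row_pairP => i j; rewrite mxE !segreRE !mxE rmorphM. Qed.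

Definition evf (k A : comNzRingType) (phi : k -> A) N M (f : 'I_M -> {mpoly k[N]})
  (x : 'rV[A]_N) : 'rV[A]_M := \row_j pev phi x (f j).

(** The form [x |-> g (x, f(x))] on the base of a blow-up. *)
Definition pullback (k : comNzRingType) N M (f : 'I_M -> {mpoly k[N]})
    (g : {mpoly k[N * M]}) : {mpoly k[N]} :=
  pev (@mpolyC N k) (segreR (\row_i 'X_i) (\row_j f j)) g.

(** The first projection of the Segre variety, on the chart given by a
    nonzero coordinate [j] of the second factor. *)
Definition lift_form (k : comNzRingType) N M (j : 'I_M) (g : {mpoly k[N]}) :
    {mpoly k[N * M]} :=
  pev (@mpolyC (N * M) k) (\row_i 'X_(mxvec_index i j)) g.

Section Pullback.
Variable k : comNzRingType.

Lemma pev_pullback (A : comNzRingType) (phi : {rmorphism k -> A}) N M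
  (f : 'I_M -> {mpoly k[N]}) (x : 'rV[A]_N) g :
  pev phi x (pullback f g) = pev phi (segreR x (evf phi f x)) g.
Proof.
rewrite /pullback pev_subst map_segreR; congr (pev _ (segreR _ _) _).
  by apply/rowP => i; rewrite !mxE /= pevX.
by apply/rowP => i; rewrite !mxE.
Qed.

Lemma pullback_homog N M (f : 'I_M -> {mpoly k[N]}) d e g :
  (forall j, f j \is d.-homog) -> g \is e.-homog -> pullback f g \is (d.+1 * e).-homog.
Proof.
move=> hf hg; apply: pev_dhomog => // l; case/mxvec_indexP: l => i j.
by rewrite segreRE !mxE -add1n; apply: dhomogM => //; apply: dhomogX1.
Qed.

Lemma lift_form_homog N M (j : 'I_M) e (g : {mpoly k[N]}) :
  g \is e.-homog -> lift_form j g \is e.-homog.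
Proof.
move=> hg; rewrite -[X in X.-homog]mul1n; apply: pev_dhomog => // i.
by rewrite mxE; apply: dhomogX1.
Qed.

Lemma pev_lift_form (A : comNzRingType) (phi : {rmorphism k -> A}) N M (j : 'I_M)
  (x : 'rV[A]_N) (z : 'rV[A]_M) e g : g \is e.-homog ->
  pev phi (segreR x z) (lift_form j g) = z 0 j ^+ e * pev phi x g.
Proof.
move=> hg; rewrite /lift_form pev_subst -(pev_homog _ _ _ hg).
by congr (pev _ _ _); apply/rowP => i; rewrite !mxE pevX segreRE mulrC.
Qed.

End Pullback.

Section Closures.
Variable k : closedFieldType.
Implicit Types (N : nat).

Definition closed_set N (V : pset k N) := forall y : 'rV[k]_N, y != 0 ->
  (forall e g, (0 < e)%N -> g \is e.-homog -> vanishes V g -> pev idfun y g = 0) -> V y.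

Lemma closed_closure N (A : pset k N) : closed_set (zariski_closure A).
Proof.
move=> y y0 h; split=> // e g hg vg.
have /rV0Pn [i yi] := y0.
have : pev idfun y (g * 'X_i) = 0.
  apply: (h e.+1) => //; first by rewrite -addn1; apply: dhomogM => //; exact: dhomogX1.
  by move=> x [x0 hx]; rewrite pev_id rmorphM -[X in X * _]/(g.@[x 0]) (hx e) // mul0r.
by rewrite rmorphM /= pevX => /eqP; rewrite mulf_eq0 (negbTE yi) orbF => /eqP.
Qed.

Lemma sub_closure N (A : pset k N) y : y != 0 -> A y -> zariski_closure A y.
Proof. by move=> y0 Ay; split=> // e g _; apply. Qed.

Lemma closed_V0 n : closed_set (@V0 k n).
Proof. by move=> y. Qed.

Lemma closure_mono N (A A' : pset k N) : (forall x, A x -> A' x) ->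
  forall x, zariski_closure A x -> zariski_closure A' x.
Proof.
move=> sA x [x0 h]; split=> // e g hg v; apply: h hg _ => z /sA; exact: v.
Qed.

Definition cone N (V : pset k N) := forall c x, c != 0 -> V x -> V (c *: x).

Lemma cone_closure N (A : pset k N) : cone (zariski_closure A).
Proof.
move=> c x c0 [x0 h]; split; first by rewrite scaler_eq0 negb_or c0.
by move=> e g hg v; rewrite pev_id (pev_homog _ _ _ hg) -pev_id (h e) // mulr0.
Qed.

Lemma cone_V0 n : cone (@V0 k n).
Proof. by move=> c x c0 x0; rewrite /V0 scaler_eq0 negb_or c0. Qed.

Section OneBlowup.
Variables (N : nat) (V B : pset k N) (b : blowup V B).
Notation f := (bl_form b).

Lemma transform_mono Z Z' : (forall x, Z x -> Z' x) ->
  forall y, transform b Z y -> transform b Z' y.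
Proof. by move=> s; apply: closure_mono => y [x [/s]]; exists x. Qed.

Lemma evf_center x : B x -> evf idfun f x = 0.
Proof. by move=> Bx; apply/rowP => j; rewrite !mxE; exact: bl_vanishes. Qed.

Lemma in_transform Z x : Z x -> segreR x (evf idfun f x) != 0 ->
  transform b Z (segreR x (evf idfun f x)).
Proof.
move=> Zx h0; apply: sub_closure => //; exists x; split=> //.
  by move=> /evf_center h; rewrite h segreR0r eqxx in h0.
by exists 1; rewrite ?oner_eq0 // scale1r.
Qed.

(** Since the forms [f] vanish on the center, the points of the center may be
    included when one tests a form on a proper transform. *)
Lemma transform_vanishes Z e g : (0 < e)%N -> g \is e.-homog ->
  vanishes (transform b Z) g <-> vanishes Z (pullback f g).
Proof.
move=> e0 hg; split=> [v x Zx|v y [y0 h]].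
  rewrite pev_id pev_pullback.
  have [->|h0] := eqVneq (segreR x (evf idfun f x)) 0; first exact: pev_homog0 hg.
  by rewrite -pev_id; apply: v; exact: in_transform.
apply: (h e) => // t [x [Zx _ [c c0 ->]]].
rewrite pev_id (pev_homog _ _ _ hg) -[segre _ _]/(segreR x (evf idfun f x)).
by rewrite -pev_pullback -pev_id v // mulr0.
Qed.

End OneBlowup.
End Closures.

(** * Homogeneous components of relations on a cone *)

Section Components.
Variable k : closedFieldType.

Lemma pihomog_cone N (F : {mpoly k[N]}) (x : 'rV[k]_N) e :
  (forall c, c != 0 -> pev idfun (c *: x) F = 0) -> pev idfun x (pihomog mdeg e F) = 0.
Proof.
move=> h; pose n := maxn e.+1 (msize F).
pose p := \poly_(i < n) pev idfun x (pihomog mdeg i F).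
have hp c : p.[c] = pev idfun (c *: x) F.
  rewrite horner_poly [in RHS](@pihomog_partitionE _ _ mdeg n F) ?leq_maxr //.
  rewrite rmorph_sum; apply: eq_bigr => i _ /=.
  by rewrite (pev_homog _ _ _ (pihomogP mdeg i F)) mulrC.
have : p = 0 by apply: (@poly_dense _ p 'X); rewrite ?polyX_eq0 // => a; rewrite hornerX hp; exact: h.
by move/(congr1 (fun q : {poly k} => q`_e)); rewrite coef0 coef_poly leq_max ltnSn.
Qed.

Lemma pihomogM N (a f : {mpoly k[N]}) d e : f \is d.-homog ->
  pihomog mdeg (e + d) (a * f) = pihomog mdeg e a * f.
Proof.
move=> hf; pose n := maxn e.+1 (msize a).
have ea := @pihomog_partitionE _ _ mdeg n a (leq_maxr _ _).
have hp i : pihomog mdeg i a * f \is (i + d).-homog by apply: dhomogM => //; exact: pihomogP.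
rewrite {1}ea mulr_suml raddf_sum /=.
have en : (e < n)%N by rewrite leq_max ltnSn.
rewrite (bigD1 (Ordinal en)) //= pihomog_dE // big1 ?addr0 // => i ni.
apply: (pihomog_ne0 _ (hp i)); rewrite eqn_add2r; apply: contraNneq ni => ei.
exact/eqP/val_inj.
Qed.

End Components.

(** * Generic points and their specialisations *)

Section GenericPoint.
Variables (k : closedFieldType) (K : fieldType) (io : {rmorphism k -> K}).

(** A generic point of [V] in the sense of Weil, with coordinates in [K]. *)
Definition generic_point N (V : pset k N) (s : 'rV[K]_N) := forall e g,
  (0 < e)%N -> g \is e.-homog -> (vanishes V g <-> pev io s g = 0).

Definition next_point N (V B : pset k N) (b : blowup V B) (s : 'rV[K]_N) :=
  segreR s (evf io (bl_form b) s).

(** A form vanishes on the blow-up when its pull-back vanishes on the base, and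
    the pull-back at [s] is the form at the lifted point. *)
Lemma generic_next N (V B : pset k N) (b : blowup V B) s :
  generic_point V s -> generic_point (blowup_variety b) (next_point b s).
Proof.
move=> gs e g e0 hg; have h1 := @transform_vanishes _ _ _ _ b V e g e0 hg.
have := gs _ _ _ (pullback_homog (@bl_homog _ _ _ _ b) hg).
by rewrite muln_gt0 e0 pev_pullback => /(_ isT) h2; split=> [/h1/h2|/h2/h1].
Qed.

Section Specialisation.
Variable W : K -> k -> Prop.
Hypothesis plW : place io W.
Let pW : partial_place io W. Proof. by case: plW. Qed.

Definition integral u := exists a, W u a.

Lemma plV u a : W u a -> a != 0 -> W u^-1 a^-1.
Proof.
move=> hu a0; have u0 : u != 0.
  by apply: contraNneq a0 => u0; apply/eqP/(pl0_inv pW); rewrite -u0.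
have [_ /(_ u^-1) [[b hb]|[_]]] := plW.
  have /(pl_inj pW (pl1 pW)) e : W 1 (a * b) by rewrite -(mulfV u0); exact: (plM pW).
  by rewrite -[a^-1]mulr1 e mulKf.
by rewrite invrK => /(pl_inj pW hu) a0'; rewrite a0' eqxx in a0.
Qed.

Lemma int_or_inv x : integral x \/ x != 0 /\ W x^-1 0.
Proof. by case: plW => _; exact. Qed.

Lemma integralC c : integral (io c). Proof. by exists c; exact: (plC pW). Qed.
Lemma integral0 : integral 0. Proof. by exists 0; exact: (pl0 pW). Qed.
Lemma integral1 : integral 1. Proof. by exists 1; exact: (pl1 pW). Qed.
Lemma integralM u v : integral u -> integral v -> integral (u * v).
Proof. by move=> [a ha] [b hb]; exists (a * b); exact: (plM pW). Qed.
Lemma integralD u v : integral u -> integral v -> integral (u + v).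
Proof. by move=> [a ha] [b hb]; exists (a + b); exact: (plD pW). Qed.
Lemma integralX u i : integral u -> integral (u ^+ i).
Proof. by move=> [a ha]; exists (a ^+ i); exact: (plX pW). Qed.

Lemma pl_pev N (x : 'rV[K]_N) (y : 'rV[k]_N) g :
  (forall j, W (x 0 j) (y 0 j)) -> W (pev io x g) (pev idfun y g).
Proof.
move=> h; rewrite /pev /mmap; apply: (pl_sum pW) => m _; apply: (plM pW); first exact: (plC pW).
rewrite /mmap1; apply: (big_ind2 W) => [|u a v b|i _]; [exact: (pl1 pW)|exact: (plM pW)|exact: (plX pW)].
Qed.

(** The values of the coordinates of [s], scaled by a common factor, are those of
    [y]: [y] is the center of the place. *)
Definition specialises N (s : 'rV[K]_N) (y : 'rV[k]_N) :=
  y != 0 /\ exists c, forall j, W (c * s 0 j) (y 0 j).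

Lemma spec_scale N (s : 'rV[K]_N) y : specialises s y ->
  exists2 c, c != 0 & forall j, W ((c *: s) 0 j) (y 0 j).
Proof.
move=> [/rV0Pn [i yi] [c h]]; exists c; last by move=> j; rewrite mxE.
by apply: contraNneq yi => c0; apply/eqP/(pl0_inv pW); have := h i; rewrite c0 mul0r.
Qed.

Lemma spec_neq0 N (s : 'rV[K]_N) y i : specialises s y -> y 0 i != 0 -> s 0 i != 0.
Proof.
move=> /spec_scale [c c0 h] yi; apply: contraNneq yi => si; apply/eqP/(pl0_inv pW).
by have := h i; rewrite mxE si mulr0.
Qed.

(** The relations between the coordinates of a decomposable tensor pass to their
    values. *)
Lemma spec_segre N M (s : 'rV[K]_N) (t : 'rV[K]_M) y' :
  specialises (segreR s t) y' ->
  exists y z, [/\ y' = segreR y z, specialises s y & specialises t z].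
Proof.
move=> [y0 [c h]]; pose Y i j := y' 0 (mxvec_index i j).
have hY i j : W (c * (s 0 i * t 0 j)) (Y i j) by have := h (mxvec_index i j); rewrite segreRE.
have [i0 [j0 Y0]] : exists i j, Y i j != 0.
  apply: NNPP => no; move/eqP: y0; apply; apply: row_pairP => i j; rewrite mxE.
  by apply/eqP/negPn/negP => nz; apply: no; exists i, j.
exists (\row_i Y i j0), (\row_j (Y i0 j / Y i0 j0)); split.
- apply: row_pairP => i j; rewrite segreRE !mxE -/(Y i j) mulrA.
  apply: (canRL (mulfK Y0)).
  have h1 := plM pW (hY i j) (hY i0 j0); have h2 := plM pW (hY i j0) (hY i0 j).
  have e : c * (s 0 i * t 0 j) * (c * (s 0 i0 * t 0 j0)) =
    c * (s 0 i * t 0 j0) * (c * (s 0 i0 * t 0 j)) by ring.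
  by rewrite e in h1; exact: (pl_inj pW h1 h2).
- split; first by apply/rV0Pn; exists i0; rewrite mxE.
  by exists (c * t 0 j0) => i; rewrite mxE -mulrA [t 0 j0 * _]mulrC.
split; first by apply/rV0Pn; exists j0; rewrite mxE mulfV ?oner_eq0.
exists (c * s 0 i0 * io (Y i0 j0)^-1) => j; rewrite mxE.
have -> : c * s 0 i0 * io (Y i0 j0)^-1 * t 0 j = c * (s 0 i0 * t 0 j) * io (Y i0 j0)^-1 by ring.
by apply: (plM pW) => //; exact: (plC pW).
Qed.

Lemma spec_below N (V B : pset k N) (b : blowup V B) y z :
  closed_set V -> blowup_variety b (segreR y z) -> V y.
Proof.
move=> clV [yz0 hyz]; have y0 : y != 0 by apply: contraNneq yz0 => ->; rewrite segreR0l.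
have /rV0Pn [j zj] : z != 0 by apply: contraNneq yz0 => ->; rewrite segreR0r.
apply: clV => // e g e0 hg v.
have : pev idfun (segreR y z) (lift_form j g) = 0.
  apply: (hyz e); first exact: lift_form_homog.
  move=> t [x [Vx _ [c c0 ->]]]; rewrite pev_id (pev_homog _ _ _ (lift_form_homog j hg)).
  by rewrite (pev_lift_form _ _ _ _ hg) -pev_id v // !mulr0.
by rewrite (pev_lift_form _ _ _ _ hg) => /eqP; rewrite mulf_eq0 expf_eq0 (negbTE zj) andbF /= => /eqP.
Qed.

(** [regular s y Z u]: the rational function [u] is regular at [y] and its
    numerator can be chosen to vanish on [Z]; so this is the stalk at [y] of
    the ideal of [Z], and of the structure sheaf when [Z] is empty. *)
Definition regular N (s : 'rV[K]_N) (y : 'rV[k]_N) (Z : pset k N) (u : K) :=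
  exists e g h, [/\ g \is e.-homog, h \is e.-homog, pev idfun y h != 0, vanishes Z g
    & u = pev io s g / pev io s h].

Definition pempty N : pset k N := fun _ => False.
Notation regular0 s y := (regular s y (@pempty _)).

Section RegularRing.
Variables (N : nat) (s : 'rV[K]_N) (y : 'rV[k]_N).
Hypothesis sy : specialises s y.

Lemma spec_pev_neq0 e h : h \is e.-homog -> pev idfun y h != 0 -> pev io s h != 0.
Proof.
move=> hh h0; have [c c0 /(pl_pev h)] := spec_scale sy.
rewrite (pev_homog _ _ _ hh); apply: contraPneq => ->; rewrite mulr0 => /(pl0_inv pW) e0.
by rewrite e0 eqxx in h0.
Qed.

Lemma spec_ratio e g h : g \is e.-homog -> h \is e.-homog -> pev idfun y h != 0 ->
  W (pev io s g / pev io s h) (pev idfun y g / pev idfun y h).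
Proof.
move=> hg hh h0; have [c c0 hc] := spec_scale sy.
have -> : pev io s g / pev io s h = pev io (c *: s) g / pev io (c *: s) h.
  rewrite (pev_homog _ _ _ hh) (pev_homog _ _ _ hg) invfM mulrACA divff ?mul1r //.
  by rewrite expf_eq0 negb_and c0 orbT.
by apply: (plM pW) (pl_pev g hc) (plV (pl_pev h hc) h0).
Qed.

Lemma regular_integral Z u : regular s y Z u -> integral u.
Proof.
move=> [e [g [h [hg hh h0 _ ->]]]]; exists (pev idfun y g / pev idfun y h).
exact: spec_ratio hg hh h0.
Qed.

Lemma regular_value0 (Z : pset k N) u : Z y -> regular s y Z u -> W u 0.
Proof.
move=> Zy [e [g [h [hg hh h0 v ->]]]].
have := spec_ratio hg hh h0; have := v y Zy; rewrite pev_id => ->.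
by rewrite mul0r.
Qed.

Lemma regular_mono (Z Z' : pset k N) u : (forall x, Z' x -> Z x) ->
  regular s y Z u -> regular s y Z' u.
Proof.
by move=> sZ [e [g [h [hg hh h0 v ->]]]]; exists e, g, h; split=> // x /sZ; exact: v.
Qed.

Lemma regular_regular0 Z u : regular s y Z u -> regular0 s y u.
Proof. by apply: regular_mono. Qed.

Lemma regularD Z u v : regular s y Z u -> regular s y Z v -> regular s y Z (u + v).
Proof.
move=> [e [g [h [hg hh h0 vg ->]]]] [e' [g' [h' [hg' hh' h0' vg' ->]]]].
exists (e + e')%N, (g * h' + g' * h), (h * h'); split.
- by apply: rpredD; [|rewrite addnC]; apply: dhomogM.
- exact: dhomogM.
- by rewrite rmorphM mulf_neq0.
- by move=> x Zx; rewrite pev_id rmorphD !rmorphM /= -!pev_id vg ?vg' // !mul0r addr0.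
rewrite rmorphD !rmorphM /=.
have := spec_pev_neq0 hh h0; have := spec_pev_neq0 hh' h0'.
move: (pev io s g) (pev io s h) (pev io s g') (pev io s h') => a b c d d0 b0.
by field; rewrite d0 b0.
Qed.

Lemma regularM Z u v : regular s y Z u -> regular0 s y v -> regular s y Z (u * v).
Proof.
move=> [e [g [h [hg hh h0 vg ->]]]] [e' [g' [h' [hg' hh' h0' _ ->]]]].
exists (e + e')%N, (g * g'), (h * h'); split.
- exact: dhomogM.
- exact: dhomogM.
- by rewrite rmorphM mulf_neq0.
- by move=> x Zx; rewrite pev_id !rmorphM /= -!pev_id vg // !mul0r.
by rewrite !rmorphM /= invfM mulrACA.
Qed.

Lemma regularC c : regular0 s y (io c).
Proof.
exists 0%N, c%:MP, 1; split=> //; rewrite ?dhomogC ?dhomog1 // ?rmorph1 ?oner_eq0 //.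
by rewrite pevC divr1.
Qed.

Lemma regularN Z u : regular s y Z u -> regular s y Z (- u).
Proof. by move=> hu; rewrite -mulrN1 -(rmorph1 io) -rmorphN; apply: regularM => //; exact: regularC. Qed.

Lemma regularB Z u v : regular s y Z u -> regular s y Z v -> regular s y Z (u - v).
Proof. by move=> hu hv; apply: regularD => //; exact: regularN. Qed.

Lemma regular1 : regular0 s y 1.
Proof. by rewrite -(rmorph1 io); exact: regularC. Qed.

Lemma regularX u m : regular0 s y u -> regular0 s y (u ^+ m).
Proof.
move=> hu; elim: m => [|m IH]; first exact: regular1.
by rewrite exprS; apply: regularM.
Qed.

Lemma regularV u a : regular0 s y u -> W u a -> a != 0 -> regular0 s y u^-1.
Proof.
move=> [e [g [h [hg hh h0 _ ->]]]] hu a0; exists e, h, g; split=> //.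
  have /(pl_inj pW hu) ea := spec_ratio hg hh h0.
  by apply: contraNneq a0 => g0; rewrite ea g0 mul0r.
by rewrite invf_div.
Qed.

Lemma regular_form e (g h : {mpoly k[N]}) (Z : pset k N) : g \is e.-homog -> h \is e.-homog ->
  pev idfun y h != 0 -> vanishes Z g -> regular s y Z (pev io s g / pev io s h).
Proof. by move=> *; exists e, g, h. Qed.

Lemma regular_sum Z (I : Type) (r : seq I) (F : I -> K) : 
  regular s y Z 0 -> (forall i, regular s y Z (F i)) -> regular s y Z (\sum_(i <- r) F i).
Proof. by move=> h0 h; elim/big_ind: _ => // u v; exact: regularD. Qed.

End RegularRing.
End Specialisation.
End GenericPoint.

Notation regular0 io s y := (regular io s y (@pempty _ _)).

(** * One blow-up at the center of a place *)

Section Step.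
Variables (k : closedFieldType) (K : fieldType) (io : {rmorphism k -> K}).
Variable W : K -> k -> Prop.
Hypothesis plW : place io W.
Let pW : partial_place io W. Proof. by case: plW. Qed.

(** A polynomial chart at the centre of the place: polynomials [psi] and a
    point [c] with integral coordinates such that [psi(c)] represents the
    generic point and reduces to a representative of [y]. *)
Definition chart N (s : 'rV[K]_N) (y : 'rV[k]_N) r (psi : 'rV[{mpoly k[r]}]_N) (c : 'rV[K]_r) :=
  (exists2 ga, ga != 0 & s = ga *: evf io (psi 0) c) /\
  exists2 a, a != 0 & forall j, W (pev io c (psi 0 j)) (a * y 0 j).

Variables (N : nat) (V B : pset k N) (b : blowup V B).
Notation f := (bl_form b).
Notation d := (bl_deg b).
Variables (s : 'rV[K]_N) (y : 'rV[k]_N) (z : 'rV[k]_(bl_size b)).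
Hypothesis gs : generic_point io V s.
Hypothesis cV : cone V.
Hypothesis Vy : V y.
Hypothesis sy : specialises W s y.
Hypothesis sz : specialises W (evf io f s) z.
Notation s' := (next_point io b s).
Notation y' := (segreR y z).
Variables (i0 : 'I_N) (j0 : 'I_(bl_size b)).
Hypothesis yi0 : y 0 i0 != 0.
Hypothesis zj0 : z 0 j0 != 0.

(** A local equation of the exceptional divisor at the points where the fibre
    coordinate [j0] does not vanish; the denominator makes it a function. *)
Definition exc_eq := pev io s (f j0) / s 0 i0 ^+ d.

Let si0 : s 0 i0 != 0. Proof. exact (spec_neq0 plW sy yi0). Qed.
Let fj0 : pev io s (f j0) != 0.
Proof. by have := spec_neq0 plW sz zj0; rewrite mxE. Qed.

Lemma exc_eq_neq0 : exc_eq != 0.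
Proof. by rewrite mulf_neq0 // invr_eq0 expf_neq0. Qed.

Lemma spec_step : specialises W s' y'.
Proof.
split.
  apply/eqP => e; have := segreRE y z i0 j0; rewrite e mxE => /esym/eqP.
  by rewrite mulf_eq0 (negbTE yi0) (negbTE zj0).
have [c c0 hc] := spec_scale plW sy; have [e e0 he] := spec_scale plW sz.
exists (c * e) => l; case/mxvec_indexP: l => i j; rewrite !segreRE mulrACA.
by have := plM pW (hc i) (he j); rewrite !mxE.
Qed.

Lemma exc_eq_regular : regular io s y B exc_eq.
Proof.
have -> : exc_eq = pev io s (f j0) / pev io s ('X_i0 ^+ d).
  by rewrite rmorphXn /= pevX.
apply: (@regular_form _ _ _ _ _ _ d); first exact: bl_homog.
- by rewrite -[X in X.-homog]mul1n; apply: dhomogMn; exact: dhomogX1.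
- by rewrite rmorphXn /= pevX expf_neq0.
- exact: bl_vanishes.
Qed.

(** Local generation of the ideal of the center, at the generic point and with
    homogeneous coefficients. *)
Lemma generates_homog e g : g \is e.-homog -> vanishes B g ->
  exists m h D (a : 'I_(bl_size b) -> {mpoly k[N]}),
   [/\ h \is m.-homog, pev idfun y h != 0, forall j, a j \is D.-homog, (D + d = m + e)%N &
     vanishes V (h * g - \sum_j a j * f j)].
Proof.
move=> hg vg; have [m [h [a [hh h0 ha]]]] := bl_generates b Vy hg vg.
exists (m + d)%N, (h * 'X_i0 ^+ d), (m + e)%N,
  (fun j => pihomog mdeg (m + e)%N (a j * 'X_i0 ^+ d)).
have hX : ('X_i0 ^+ d : {mpoly k[N]}) \is d.-homog.
  by rewrite -[X in X.-homog]mul1n; apply: dhomogMn; exact: dhomogX1.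
split.
- exact: dhomogM.
- rewrite rmorphM mulf_neq0 //; last by rewrite rmorphXn /= pevX expf_neq0.
- by move=> j; apply: pihomogP.
- by rewrite addnAC.
move=> x Vx.
have -> : h * 'X_i0 ^+ d * g - \sum_j pihomog mdeg (m + e) (a j * 'X_i0 ^+ d) * f j =
   pihomog mdeg (m + e + d) ((h * g - \sum_j a j * f j) * 'X_i0 ^+ d).
  rewrite mulrBl raddfB mulr_suml (raddf_sum (pihomog mdeg (m + e + d))) /=.
  rewrite [pihomog _ _ (h * g * _)]pihomog_dE; last by apply: dhomogM => //; apply: dhomogM.
  congr (_ - _); first by ring.
  apply: eq_bigr => j _; rewrite -(pihomogM _ _ (@bl_homog _ _ _ _ b j)); congr pihomog; ring.
rewrite pev_id; apply: pihomog_cone => c c0.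
by rewrite rmorphM /= -pev_id ha ?mul0r //; exact: cV.
Qed.

Lemma vanishes_generic e g : g \is e.-homog -> vanishes V g -> pev io s g = 0.
Proof.
move=> hg v; have := gs (e := e.+1) (g := g * 'X_i0) isT.
rewrite -addn1; case; first by apply: dhomogM => //; exact: dhomogX1.
move=> h _; have : pev io s (g * 'X_i0) = 0.
  by apply: h => x Vx; rewrite pev_id rmorphM /= -pev_id v // mul0r.
by rewrite rmorphM /= pevX => /eqP; rewrite mulf_eq0 (negbTE si0) orbF => /eqP.
Qed.

Lemma generic_vanishes e g : g \is e.-homog -> pev io s g = 0 ->
  forall x, V x -> pev idfun x (g * 'X_i0) = 0.
Proof.
move=> hg v x Vx; have := gs (e := e.+1) (g := g * 'X_i0) isT.
rewrite -addn1; case; first by apply: dhomogM => //; exact: dhomogX1.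
move=> _ h; rewrite -pev_id; apply: h => //.
by rewrite rmorphM /= v mul0r.
Qed.

Lemma generic_relation e g m h D (a : 'I_(bl_size b) -> {mpoly k[N]}) :
  g \is e.-homog -> h \is m.-homog -> (forall j, a j \is D.-homog) -> (D + d = m + e)%N ->
  vanishes V (h * g - \sum_j a j * f j) ->
  pev io s h * pev io s g = \sum_j pev io s (a j) * pev io s (f j).
Proof.
move=> hg hh ha e1 v; apply/eqP; rewrite -subr_eq0; apply/eqP.
transitivity (pev io s (h * g - \sum_j a j * f j)).
  by rewrite rmorphB rmorphM rmorph_sum; congr (_ - _); apply: eq_bigr => j _; rewrite rmorphM.
apply: (@vanishes_generic (m + e)) => //; apply: rpredB; first exact: dhomogM.
by apply: rpred_sum => j _; rewrite -e1; apply: dhomogM => //; exact: bl_homog.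
Qed.

Let y'i0j0 : pev idfun y' 'X_(mxvec_index i0 j0) != 0.
Proof. by rewrite pevX segreRE mulf_neq0. Qed.

Lemma regular_proj (Z : pset k N) (Z' : pset k (N * bl_size b)) u :
  (forall t, Z' t -> exists x w, Z x /\ t = segre x w) ->
  regular io s y Z u -> regular io s' y' Z' u.
Proof.
move=> hZ [e [g [h [hg hh h0 v ->]]]].
exists e, (lift_form j0 g), (lift_form j0 h); split; try exact: lift_form_homog.
- by rewrite (pev_lift_form _ _ _ _ hh) mulf_neq0 ?expf_neq0.
- move=> t /hZ [x [w [Zx ->]]]; rewrite pev_id (pev_lift_form _ _ _ _ hg) -pev_id v //.
  by rewrite mulr0.
rewrite !(pev_lift_form _ _ _ _ hg, pev_lift_form _ _ _ _ hh) invfM mulrACA divff ?mul1r //.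
by rewrite mxE expf_neq0.
Qed.

Lemma regular_fiber_coord j :
  regular0 io s' y' (pev io s (f j) / pev io s (f j0)).
Proof.
have -> : pev io s (f j) / pev io s (f j0) =
    pev io s' 'X_(mxvec_index i0 j) / pev io s' 'X_(mxvec_index i0 j0).
  by rewrite !pevX !segreRE !mxE invfM mulrACA divff // mul1r.
by apply: (@regular_form _ _ _ _ _ _ 1) => //; exact: dhomogX1.
Qed.

(** Near [y] the numerator is a combination of the forms of the blow-up, and
    their quotients by the form [j0] are the fibre coordinates. *)
Lemma regular_div u : regular io s y B u -> regular0 io s' y' (u / exc_eq).
Proof.
move=> [e [g [h0 [hg hh0 h00 v ->]]]].
have [m [h [D [a [hh hne ha eD hv]]]]] := generates_homog hg v.
have rel := generic_relation hg hh ha eD hv.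
have hs0 := spec_pev_neq0 plW sy hh hne; have h0s0 := spec_pev_neq0 plW sy hh0 h00.
have -> : pev io s g / pev io s h0 / exc_eq = \sum_j
   (pev io s (a j * 'X_i0 ^+ d) / pev io s (h * h0)) * (pev io s (f j) / pev io s (f j0)).
  transitivity ((pev io s h * pev io s g) *
     (s 0 i0 ^+ d / (pev io s h * pev io s h0 * pev io s (f j0)))).
    rewrite /exc_eq; field; by rewrite ?expf_neq0 ?hs0 ?h0s0 ?fj0 ?si0.
  rewrite rel mulr_suml; apply: eq_bigr => j _; rewrite !rmorphM rmorphXn /= pevX.
  by field; rewrite ?hs0 ?h0s0 ?fj0.
apply: (regular_sum plW spec_step).
  by rewrite -(rmorph0 io); apply: regularC.
move=> j; apply: regularM; last exact: regular_fiber_coord.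
apply: (@regular_proj (@pempty _ _)) => //.
apply: (@regular_form _ _ _ _ _ _ (D + d)) => //.
- apply: dhomogM => //; rewrite -[X in X.-homog]mul1n; apply: dhomogMn; exact: dhomogX1.
- by rewrite eD; apply: dhomogM.
- by rewrite rmorphM mulf_neq0.
Qed.

(** Outside the center the equation of the exceptional divisor is a unit, so [u]
    vanishes over [Z] minus the center, and then on its closure. *)
Lemma regular_transform (Z : pset k N) u m : (forall x, Z x -> V x) ->
  regular0 io s' y' u -> regular io s y Z (exc_eq ^+ m * u) ->
  regular io s' y' (transform b Z) u.
Proof.
move=> ZV [e [g [h [hg hh hne _ eu]]]] [e0 [g0 [h0 [hg0 hh0 h00 v eu0]]]].
pose t := mxvec_index i0 j0.
pose G := lift_form j0 h0 * 'X_t ^+ m.+1.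
have hX q N' (i : 'I_N') : ('X_i ^+ q : {mpoly k[N']}) \is q.-homog.
  by rewrite -[X in X.-homog]mul1n; apply: dhomogMn; exact: dhomogX1.
have hG : G \is (e0 + m.+1).-homog by apply: dhomogM; [exact: lift_form_homog|].
have G0 : pev idfun y' G != 0.
  rewrite rmorphM rmorphXn /= (pev_lift_form _ _ _ _ hh0) mulf_neq0 ?expf_neq0 //.
  by rewrite mulf_neq0 ?expf_neq0.
have Gs := spec_pev_neq0 plW spec_step hG G0.
have hs := spec_pev_neq0 plW spec_step hh hne.
have h0s := spec_pev_neq0 plW sy hh0 h00.
exists (e + (e0 + m.+1))%N, (g * G), (h * G); split.
- exact: dhomogM.
- exact: dhomogM.
- by rewrite rmorphM mulf_neq0.
- apply/(@transform_vanishes _ _ _ _ b Z (e + (e0 + m.+1))%N); first by rewrite !addnS.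
    exact: dhomogM.
  move=> x Zx; rewrite pev_id pev_pullback rmorphM /= -pev_pullback rmorphM rmorphXn /= pevX.
  rewrite (pev_lift_form _ _ _ _ hh0) segreRE mxE.
  pose F := pullback f g * h0 * f j0 ^+ m - g0 * pullback f h * 'X_i0 ^+ (d * m).
  have hF : F \is (d.+1 * e + e0 + d * m).-homog.
    apply: rpredB.
      by apply: dhomogM; [apply: dhomogM => //; apply: pullback_homog => //; exact: bl_homog|
        apply: dhomogMn; exact: bl_homog].
    rewrite [(d.+1 * e + e0)%N]addnC; apply: dhomogM => //; apply: dhomogM => //.
    by apply: pullback_homog => //; exact: bl_homog.
  have Fs : pev io s F = 0.
    rewrite /F rmorphB !rmorphM !rmorphXn /= !pev_pullback pevX.
    apply/eqP; rewrite subr_eq0; apply/eqP.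
    move: eu0; rewrite eu /exc_eq -[segreR s _]/(s') exprMn exprVn -exprM => eu0.
    have -> : pev io s g0 = pev io s h0 * (pev io s g0 / pev io s h0) by rewrite mulrCA divff ?mulr1.
    rewrite -eu0; move: hs h0s (expf_neq0 (d * m) si0).
    move: (pev io s' g) (pev io s' h) (pev io s h0) (s 0 i0 ^+ (d * m)) => A C E H C0 E0 H0.
    by field; rewrite C0 H0.
  have := generic_vanishes hF Fs (ZV _ Zx).
  rewrite rmorphM /= pevX /F rmorphB !rmorphM !rmorphXn /=.
  rewrite -[pev idfun x g0]pev_id v // mul0r mul0r subr0.
  move=> h1; set P := pev idfun x _ in h1 *.
  transitivity (P * pev idfun x h0 * pev idfun x (f j0) ^+ m * x 0 i0 *
    (pev idfun x (f j0) ^+ e0 * x 0 i0 ^+ m * pev idfun x (f j0))); last by rewrite h1 mul0r.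
  rewrite exprMn !exprS; ring.
by rewrite eu (rmorphM (pev io s') g) (rmorphM (pev io s') h) /= invfM mulrACA mulfV // mulr1.
Qed.

(** The quotients [A] represent the fibre coordinate: the integrality of
    [T / exc_eq] prevents all of them from having the value [0]. *)
Lemma chart_step r (psi : 'rV[{mpoly k[r]}]_N) (A : 'rV[{mpoly k[r]}]_(bl_size b)) T
    (c : 'rV[K]_r) :
  (forall i, integral W (c 0 i)) -> chart s y psi c ->
  (forall j, pev (@mpolyC r k) psi (f j) = T * A 0 j) ->
  integral W (pev io c T / exc_eq) ->
  chart s' y' (segreR psi A) c.
Proof.
move=> hc [[ga ga0 es] [a a0 ha]] hA [tau hT].
pose psc := evf io (psi 0) c; pose Ac := evf io (A 0) c.
have ef j : pev io s (f j) = ga ^+ d * (pev io c T * Ac 0 j).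
  rewrite es (pev_homog _ _ _ (@bl_homog _ _ _ _ b j)) /Ac mxE -rmorphM /= -hA pev_subst.
  by congr (_ * pev _ _ _); apply/rowP => i; rewrite !mxE.
have T0 : pev io c T != 0.
  by apply: contraNneq fj0 => T0; rewrite ef T0 mul0r mulr0.
have Aj0 : Ac 0 j0 != 0.
  by apply: contraNneq fj0 => A0; rewrite ef A0 !mulr0.
have esegre : evf io (segreR psi A 0) c = segreR psc Ac.
  by apply: row_pairP => i j; rewrite mxE !segreRE rmorphM !mxE.
have hAint j : integral W (Ac 0 j).
  rewrite mxE; apply: pev_closed => //.
  - exact: (integralC plW).
  - exact: (integralD plW).
  - exact: (integralM plW).
have [e e0 he] := spec_scale plW sz.
have [al hal] := hAint j0.
have al0 : al != 0.
  have h1 : W (pev io c T / exc_eq * Ac 0 j0) (tau * al) := plM pW hT hal.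
  have : W (psc 0 i0 ^+ d) ((a * y 0 i0) ^+ d) by apply: (plX pW); rewrite mxE.
  have -> : psc 0 i0 ^+ d = pev io c T / exc_eq * Ac 0 j0.
    have es0 : s 0 i0 = ga * psc 0 i0 by rewrite es mxE.
    have P0 : psc 0 i0 != 0 by apply: contraNneq si0 => P0; rewrite es0 P0 mulr0.
    rewrite /exc_eq ef es0 exprMn.
    move: (ga ^+ d) (psc 0 i0 ^+ d) (expf_neq0 d ga0) (expf_neq0 d P0) => X Y X0 Y0.
    by field; rewrite Y0 X0 Aj0.
  move/(pl_inj pW h1) => e1; apply/eqP => al0; move: e1; rewrite al0 mulr0 => /esym/eqP.
  by rewrite expf_eq0 mulf_eq0 (negbTE a0) (negbTE yi0) andbF.
split.
  exists (ga * (ga ^+ d * pev io c T)); first by rewrite !mulf_neq0 ?expf_neq0.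
  rewrite esegre /next_point -segreRZ; congr segreR => //.
  by apply/rowP => j; rewrite mxE ef [in RHS]mxE mulrA.
exists (a * (al / z 0 j0)); first by rewrite !mulf_neq0 ?invr_eq0.
move=> l; case/mxvec_indexP: l => i j; rewrite !segreRE rmorphM /= mulrACA.
apply: (plM pW (ha i)); rewrite -mulrA.
have -> : pev io c (A 0 j) = Ac 0 j0 * ((e * pev io s (f j0))^-1 * (e * pev io s (f j))).
  have -> : pev io c (A 0 j) = Ac 0 j by rewrite mxE.
  rewrite !ef; move: (expf_neq0 d ga0) T0 Aj0 (Ac 0 j).
  move: (ga ^+ d) (pev io c T) (Ac 0 j0) => X Y U X0 Y0 U0 V'.
  by field; rewrite e0 X0 Y0 U0.
apply: (plM pW hal); apply: (plM pW); last by have := he j; rewrite !mxE.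
by apply: (plV plW) zj0; have := he j0; rewrite !mxE.
Qed.

End Step.

(** * Polynomial charts of a blow-up *)

Notation pat psi x := (evf idfun (psi 0) x).

Definition psubst (k : comNzRingType) r r' N (sg : 'rV[{mpoly k[r']}]_r)
  (psi : 'rV[{mpoly k[r]}]_N) : 'rV[{mpoly k[r']}]_N :=
  map_mx (pev (@mpolyC r' k) sg) psi.

(** Restriction to a coordinate subspace. *)
Definition kill (k : comNzRingType) r (L : pred 'I_r) : 'rV[{mpoly k[r]}]_r :=
  \row_i (if L i then 0 else 'X_i).

Section Subst.
Variable k : comNzRingType.

Lemma evf_psubst (A : comNzRingType) (phi : {rmorphism k -> A}) r r' N
  (sg : 'rV[{mpoly k[r']}]_r) (psi : 'rV[{mpoly k[r]}]_N) (c : 'rV[A]_r') :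
  evf phi (psubst sg psi 0) c = evf phi (psi 0) (evf phi (sg 0) c).
Proof.
apply/rowP => i; rewrite !mxE pev_subst; congr (pev _ _ _).
by apply/rowP => j; rewrite !mxE.
Qed.

Lemma evf_comp (A : comNzRingType) (phi : {rmorphism k -> A}) r N
  (psi : 'rV[{mpoly k[r]}]_N) (c : 'rV[A]_r) g :
  pev phi (evf phi (psi 0) c) g = pev phi c (pev (@mpolyC r k) psi g).
Proof. by rewrite pev_subst; congr (pev _ _ _); apply/rowP => j; rewrite !mxE. Qed.

Lemma evf_segre (A : comNzRingType) (phi : {rmorphism k -> A}) r N M
  (psi : 'rV[{mpoly k[r]}]_N) (B : 'rV[{mpoly k[r]}]_M) (c : 'rV[A]_r) :
  evf phi (segreR psi B 0) c = segreR (evf phi (psi 0) c) (evf phi (B 0) c).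
Proof. by apply: row_pairP => i j; rewrite mxE !segreRE rmorphM !mxE. Qed.

Lemma pev_vars r (F : {mpoly k[r]}) : pev (@mpolyC r k) (\row_i 'X_i) F = F.
Proof.
rewrite [RHS]mpolyE; apply: eq_bigr => m _; rewrite mul_mpolyC; congr (_ *: _).
by rewrite mpolyXE_id /mmap1; apply: eq_bigr => i _; rewrite mxE.
Qed.

Lemma evf_kill (A : comNzRingType) (phi : {rmorphism k -> A}) r (L : pred 'I_r) (c : 'rV[A]_r) :
  evf phi (kill k L 0) c = \row_i (if L i then 0 else c 0 i).
Proof.
by apply/rowP => i; rewrite !mxE; case: (L i); rewrite ?rmorph0 ?pevX.
Qed.

End Subst.

Section Divisibility.
Variable k : closedFieldType.

Lemma mpoly_kill0 r (L : pred 'I_r) (F : {mpoly k[r]}) :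
  (forall x : 'rV[k]_r, (forall i, L i -> x 0 i = 0) -> pev idfun x F = 0) ->
  pev (@mpolyC r k) (kill k L) F = 0.
Proof.
move=> h; apply: mpoly_zero_test => x; rewrite -(evf_comp idfun) evf_kill.
by apply: h => i Li; rewrite mxE Li.
Qed.

(** Modulo the coordinate a polynomial is congruent to its restriction. *)
Lemma mpoly_divX r (l : 'I_r) (F : {mpoly k[r]}) :
  (forall x : 'rV[k]_r, x 0 l = 0 -> pev idfun x F = 0) -> exists F', F = 'X_l * F'.
Proof.
move=> h; have h0 : pev (@mpolyC r k) (kill k (pred1 l)) F = 0.
  by apply: mpoly_kill0 => x hx; apply: h; apply: hx => /=.
have [||||||u _ e] := @pev_congr k _ (@mpolyC r k) (fun _ => True) 'X_l r
   (\row_i 'X_i) (kill k (pred1 l)) F => //.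
  move=> i; rewrite !mxE /=; case: eqP => [->|_]; first by exists 1; rewrite ?mulr1 ?subr0.
  by exists 0; rewrite // subrr mulr0.
by exists u; rewrite -e h0 subr0 pev_vars.
Qed.

(** A chart of a cone may pass through the vertex. *)
Definition point_of N (Z : pset k N) x := x = 0 \/ Z x.

Lemma point_of_vanishes N (Z : pset k N) e g x : (0 < e)%N -> g \is e.-homog ->
  vanishes Z g -> point_of Z x -> pev idfun x g = 0.
Proof. by move=> e0 hg v [->|/v//]; exact: pev_homog0 hg. Qed.

Lemma point_of_scale N (Z : pset k N) c x : cone Z -> c != 0 ->
  point_of Z (c *: x) -> point_of Z x.
Proof.
move=> cZ c0 [/eqP|h]; first by rewrite scaler_eq0 (negbTE c0) /= => /eqP; left.
by right; rewrite -[x]scale1r -(mulVf c0) -scalerA; apply: cZ; rewrite ?invr_eq0.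
Qed.

Lemma horner_pev r (xi : 'rV[{poly k}]_r) (F : {mpoly k[r]}) t :
  (pev (@polyC k) xi F).[t] = pev idfun (map_mx (horner_eval t) xi) F.
Proof.
rewrite -[LHS]/(horner_eval t _) (pev_comp (@polyC k) (horner_eval t)).
by apply: pev_ext => a; rewrite /= /horner_eval hornerC.
Qed.

(** A closed condition on an arc is polynomial in the parameter. *)
Lemma point_of_density N (Z : pset k N) r (psi : 'rV[{mpoly k[r]}]_N) (xi : 'rV[{poly k}]_r) q :
  closed_set Z -> q != 0 ->
  (forall t, q.[t] != 0 -> point_of Z (pat psi (map_mx (horner_eval t) xi))) ->
  forall t, point_of Z (pat psi (map_mx (horner_eval t) xi)).
Proof.
move=> cZ q0 h t; set p := pat _ _; have [->|p0] := eqVneq p 0; [by left|right].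
apply: cZ => // e g e0 hg v; rewrite /p (evf_comp idfun) -horner_pev.
rewrite (_ : pev _ xi _ = 0) ?horner0 //; apply: (poly_dense q0) => a qa.
rewrite horner_pev -(evf_comp idfun); apply: point_of_vanishes e0 hg v _; exact: h.
Qed.

Section Blowup.
Variables (N : nat) (V B : pset k N) (b : blowup V B) (r : nat).
Notation f := (bl_form b).

(** The forms of the blow-up, restricted to the chart [psi], are divisible by
    the equation [T] of the exceptional divisor, and [A] is the quotient.  The
    equation is the coordinate [l], unless the center is empty. *)
Definition factors (psi : 'rV[{mpoly k[r]}]_N) (l : 'I_r) (A : 'rV[{mpoly k[r]}]_(bl_size b)) :=
  exists2 T, T = 'X_l \/ T = 1 /\ (forall x, ~ B x) &
    forall j, pev (@mpolyC r k) psi (f j) = T * A 0 j.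

Lemma chart_factor (psi : 'rV[{mpoly k[r]}]_N) l :
  (forall x : 'rV[k]_r, x 0 l = 0 -> point_of B (pat psi x)) ->
  exists A, factors psi l A.
Proof.
move=> h; have [[b0 Bb0]|no] := classic (exists x, B x); last first.
  exists (\row_j pev (@mpolyC r k) psi (f j)), 1.
    by right; split=> // x Bx; apply: no; exists x.
  by move=> j; rewrite mxE mul1r.
have : forall j, exists F', pev (@mpolyC r k) psi (f j) = 'X_l * F'.
  move=> j; apply: mpoly_divX => x /h hx; rewrite -(evf_comp idfun).
  case: hx => [->|Bx]; last exact: bl_vanishes.
  rewrite -(scale0r b0) (pev_homog _ _ _ (@bl_homog _ _ _ _ b j)).
  by rewrite -[pev _ _ _]pev_id bl_vanishes // mulr0.
move/fin_all_exists => [A hA]; exists (\row_j A j), 'X_l; first by left.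
by move=> j; rewrite mxE.
Qed.

Variables (psi : 'rV[{mpoly k[r]}]_N) (A : 'rV[{mpoly k[r]}]_(bl_size b)) (l : 'I_r).
Hypothesis hA : factors psi l A.

Lemma factorsE (x : 'rV[k]_r) : x 0 l != 0 ->
  exists2 t, t != 0 & evf idfun f (pat psi x) = t *: pat A x.
Proof.
move=> xl; have [T hT eT] := hA; exists (pev idfun x T).
  by case: hT => [->|[-> _]]; rewrite ?pevX ?rmorph1 ?oner_eq0.
by apply/rowP => j; rewrite !mxE (evf_comp idfun) eT rmorphM.
Qed.

Lemma point_of_step (Z : pset k N) (x : 'rV[k]_r) : x 0 l != 0 -> point_of Z (pat psi x) ->
  point_of (transform b Z) (pat (segreR psi A) x).
Proof.
move=> /factorsE [t t0 et] hZ; have e : t *: pat (segreR psi A) x =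
    segreR (pat psi x) (evf idfun f (pat psi x)).
  by rewrite et (evf_segre idfun) -[in RHS](scale1r (pat psi x)) segreRZ mul1r.
apply: (point_of_scale (@cone_closure _ _ _) t0); rewrite e.
case: hZ => [->|Zx]; first by left; rewrite segreR0l.
have [->|ne] := eqVneq (segreR (pat psi x) (evf idfun f (pat psi x))) 0; first by left.
by right; apply: in_transform.
Qed.

End Blowup.
End Divisibility.

Arguments factors {k N V B} b {r} psi l A.

Section ChartBounds.
Variables (k : closedFieldType) (K : fieldType) (io : {rmorphism k -> K}).
Variable W : K -> k -> Prop.
Hypothesis plW : place io W.
Let pW : partial_place io W. Proof. by case: plW. Qed.

Definition divides al u := exists2 v, integral W v & u = al * v.

Lemma chart_subst N (s : 'rV[K]_N) y r r' (psi : 'rV[{mpoly k[r]}]_N)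
  (sg : 'rV[{mpoly k[r']}]_r) c :
  chart io W s y psi (evf io (sg 0) c) -> chart io W s y (psubst sg psi) c.
Proof.
move=> [[ga ga0 es] [a a0 ha]]; split.
  by exists ga => //; rewrite evf_psubst.
exists a => // j; have := evf_psubst io sg psi c => /rowP/(_ j).
by rewrite mxE [in RHS]mxE => ->.
Qed.

(** In the chart the numerator is a polynomial that vanishes on the coordinate
    subspace, so it lies in the ideal of those coordinates. *)
Lemma chart_regular N (s : 'rV[K]_N) y (B : pset k N) r (psi : 'rV[{mpoly k[r]}]_N) c
  (L : pred 'I_r) al u :
  specialises W s y -> chart io W s y psi c -> (forall i, integral W (c 0 i)) ->
  (forall x : 'rV[k]_r, (forall i, L i -> x 0 i = 0) -> point_of B (pat psi x)) ->
  (forall i, L i -> divides al (c 0 i)) ->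
  regular io s y B u -> divides al u.
Proof.
move=> sy [[ga ga0 es] [a a0 ha]] hc hB hal [e [g [h [hg hh h0 v ->]]]].
have [/rV0Pn [i yi] _] := sy.
pose g' := g * 'X_i; pose h' := h * 'X_i.
have hg' : g' \is e.+1.-homog by rewrite -addn1; apply: dhomogM => //; exact: dhomogX1.
have hh' : h' \is e.+1.-homog by rewrite -addn1; apply: dhomogM => //; exact: dhomogX1.
have v' : vanishes B g' by move=> x Bx; rewrite pev_id rmorphM /= -pev_id v // mul0r.
have h0' : pev idfun y h' != 0 by rewrite rmorphM /= pevX mulf_neq0.
have si : s 0 i != 0 by exact: (spec_neq0 plW sy yi).
have -> : pev io s g / pev io s h = pev io s g' / pev io s h'.
  by rewrite /g' /h' !rmorphM /= pevX invfM mulrACA divff // mulr1.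
rewrite es !(pev_homog _ _ _ hg', pev_homog _ _ _ hh').
rewrite invfM mulrACA divff ?mul1r ?expf_neq0 //.
set q := evf io (psi 0) c.
have hqv : W (pev io q h') (pev idfun (a *: y) h').
  by apply: pl_pev => // j; rewrite !mxE; exact: ha.
have hqi : integral W (pev io q h')^-1.
  exists (pev idfun (a *: y) h')^-1; apply: (plV plW hqv).
  by rewrite (pev_homog _ _ _ hh') mulf_neq0 // expf_neq0.
suff [w hw ew] : divides al (pev io q g').
  by exists (w / pev io q h'); [exact: (integralM plW)|rewrite ew mulrA].
rewrite /q (evf_comp io); set F := pev _ psi g'.
have kF : pev (@mpolyC r k) (kill k L) F = 0.
  apply: mpoly_kill0 => x hx; rewrite -(evf_comp idfun).
  exact: point_of_vanishes hg' v' (hB x hx).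
have := @pev_congr k _ io (integral W) al r c (evf io (kill k L 0) c) F
  (integralC plW) (integralD plW) (integralM plW) hc.
rewrite (evf_comp io) kF rmorph0 subr0; case => //.
- by move=> j; rewrite evf_kill mxE; case: (L j) => //; exact: (integral0 plW).
- move=> j; rewrite evf_kill mxE; case: ifP => [/hal [w hw ew]|_].
    by exists w; rewrite // subr0.
  by exists 0; [exact: (integral0 plW)|rewrite subrr mulr0].
by move=> w hw ew; exists w.
Qed.

End ChartBounds.

(** * Cubic forms as symmetric tensors *)

Definition lin (A : comNzRingType) n (b : 'I_n -> A) (u : 'I_n -> A) := \sum_i b i * u i.
Definition quad (A : comNzRingType) n (P : 'I_n -> 'I_n -> A) (u : 'I_n -> A) :=
  \sum_i \sum_j P i j * (u i * u j).
Definition cubt (A : comNzRingType) n (G : 'I_n -> 'I_n -> 'I_n -> A) (u : 'I_n -> A) :=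
  \sum_i \sum_j \sum_l G i j l * (u i * u j * u l).

(** Coefficients of [X^3 - 3 P X + 2 G], symmetrised. *)
Definition tcub (A : comNzRingType) n (b : 'I_n -> A) P G (i j l : 'I_n) : A :=
  b i * b j * b l - (P i j * b l + P i l * b j + P j l * b i) + G i j l *+ 2.

Lemma cubt_tcub (A : comNzRingType) n (b : 'I_n -> A) P G u :
  cubt (tcub b P G) u = lin b u ^+ 3 - 3%:R * quad P u * lin b u + 2%:R * cubt G u.
Proof.
pose c3 (F : 'I_n -> 'I_n -> 'I_n -> A) := \sum_i \sum_j \sum_l F i j l.
have cD F F' : c3 (fun i j l => F i j l + F' i j l) = c3 F + c3 F'.
  rewrite /c3 -big_split; apply: eq_bigr => i _; rewrite -big_split; apply: eq_bigr => j _.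
  by rewrite -big_split.
have cZ a F : c3 (fun i j l => a * F i j l) = a * c3 F.
  rewrite /c3 mulr_sumr; apply: eq_bigr => i _; rewrite mulr_sumr; apply: eq_bigr => j _.
  by rewrite mulr_sumr.
have cE F F' : (forall i j l, F i j l = F' i j l) -> c3 F = c3 F'.
  by move=> h; rewrite /c3; apply: eq_bigr => i _; apply: eq_bigr => j _; apply: eq_bigr => l _.
have e1 : c3 (fun i j l => (b i * u i) * (b j * u j) * (b l * u l)) = lin b u ^+ 3.
  rewrite /c3 /lin !exprS expr0 mulr1 mulr_suml; apply: eq_bigr => i _.
  rewrite mulr_suml mulr_sumr; apply: eq_bigr => j _.
  by rewrite !mulr_sumr; apply: eq_bigr => l _; ring.
have e2 : c3 (fun i j l => (P i j * (u i * u j)) * (b l * u l)) = quad P u * lin b u.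
  rewrite /c3 /quad mulr_suml; apply: eq_bigr => i _.
  by rewrite mulr_suml; apply: eq_bigr => j _; rewrite mulr_sumr.
have e3 : c3 (fun i j l => (P i l * (u i * u l)) * (b j * u j)) = quad P u * lin b u.
  rewrite -e2 /c3; apply: eq_bigr => i _; exact: exchange_big.
have e4 : c3 (fun i j l => (P j l * (u j * u l)) * (b i * u i)) = quad P u * lin b u.
  by rewrite -e3 /c3 exchange_big.
have e5 : c3 (fun i j l => G i j l * (u i * u j * u l)) = cubt G u by [].
transitivity (c3 (fun i j l => ((b i * u i) * (b j * u j) * (b l * u l) +
   (-1) * ((P i j * (u i * u j)) * (b l * u l) + ((P i l * (u i * u l)) * (b j * u j) +
     (P j l * (u j * u l)) * (b i * u i)))) + 2%:R * (G i j l * (u i * u j * u l)))).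
  by apply: cE => i j l; rewrite /tcub; ring.
rewrite cD cZ cD cZ cD cD e1 e2 e3 e4 e5; ring.
Qed.

Section Cubics.
Variables (k : closedFieldType) (n : nat).
Hypothesis two0 : (2%:R : k) != 0.
Hypothesis three0 : (3%:R : k) != 0.
Notation N0 := (cubic_dim k n).
Notation vec := 'rV[k]_n.+1.
Implicit Types (p : {mpoly k[n.+1]}) (u v w : vec).

Lemma six0 : (6%:R : k) != 0.
Proof. by rewrite (natrM k 2 3) mulf_neq0. Qed.

Lemma mnm_pick (m : 'X_{1..n.+1}) d : mdeg m = d.+1 ->
  exists i m', m = (U_(i) + m')%MM /\ mdeg m' = d.
Proof.
move=> hm; have [i hi] : exists i, (0 < m i)%N.
  apply: NNPP => no; have : mdeg m = 0%N.
    rewrite mdegE big1 // => i _; apply/eqP; rewrite -leqn0 leqNgt; apply/negP => h.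
    by apply: no; exists i.
  by rewrite hm.
exists i, (m - U_(i))%MM.
have e : m = (U_(i) + (m - U_(i)))%MM.
  apply/mnmP => j; rewrite mnmDE mnmBE mnm1E; case: eqP => [<-|_].
    by rewrite subnKC.
  by rewrite subn0.
split=> //; move: hm; rewrite {1}e mdegD mdeg1 add1n; by case.
Qed.

Lemma mnm_deg3 (m : 'X_{1..n.+1}) : mdeg m = 3%N ->
  exists i j l, 'X_[m] = 'X_i * 'X_j * 'X_l :> {mpoly k[n.+1]}.
Proof.
move=> /mnm_pick [i [m1 [-> /mnm_pick [j [m2 [-> /mnm_pick [l [m3 [-> h]]]]]]]]].
have -> : m3 = 0%MM by apply/eqP; rewrite -mdeg_eq0 h.
by exists i, j, l; rewrite !mpolyXD mpolyX0 mulr1 mulrA.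
Qed.

Lemma cubic_ind (R : {mpoly k[n.+1]} -> Prop) :
  (forall p q, R p -> R q -> R (p + q)) -> (forall c p, R p -> R (c *: p)) ->
  (forall i j l, R ('X_i * 'X_j * 'X_l)) ->
  forall p, p \is 3.-homog -> R p.
Proof.
move=> hD hZ hX p /dhomogP hp; rewrite [p]mpolyE big_seq.
elim/big_ind: _ => [| |m hm]; [|exact: hD|].
  by rewrite -(scale0r ('X_ord0 * 'X_ord0 * 'X_ord0)); apply: hZ; exact: hX.
by apply: hZ; have [i [j [l ->]]] := mnm_deg3 (hp m hm); exact: hX.
Qed.

(** The symmetric trilinear form with [pol p u u u = p(u)]. *)
Definition pol p u v w : k := 6%:R^-1 *
  (pev idfun (u + v + w) p - pev idfun (u + v) p - pev idfun (u + w) p - pev idfun (v + w) p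
   + pev idfun u p + pev idfun v p + pev idfun w p).

Lemma polD p q u v w : pol (p + q) u v w = pol p u v w + pol q u v w.
Proof. by rewrite /pol !rmorphD /=; ring. Qed.

Lemma polZ c p u v w : pol (c *: p) u v w = c * pol p u v w.
Proof. by rewrite /pol -!mul_mpolyC !rmorphM /= !pevC /=; ring. Qed.

Lemma pol_sum (I : Type) (r : seq I) (F : I -> {mpoly k[n.+1]}) u v w :
  pol (\sum_(i <- r) F i) u v w = \sum_(i <- r) pol (F i) u v w.
Proof.
elim/big_ind2: _ => [|x y a b <- <-|//]; last by rewrite polD.
by rewrite /pol !rmorph0; ring.
Qed.

Lemma linear_formD (l : {mpoly k[n.+1]}) u v : linear_form l ->
  pev idfun (u + v) l = pev idfun u l + pev idfun v l.
Proof.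
move=> /dhomogP hl; rewrite [l]mpolyE !rmorph_sum -big_split big_seq [RHS]big_seq.
apply: eq_bigr => m /hl hm /=; have [i [m' [-> /eqP]]] := mnm_pick hm.
rewrite mdeg_eq0 => /eqP ->; rewrite addm0 -!mul_mpolyC !rmorphM /= !pevX mxE mulrDr.
by rewrite !pevC.
Qed.

Lemma linear_formX i : linear_form ('X_i : {mpoly k[n.+1]}).
Proof. exact: dhomogX1. Qed.

Lemma pol_prod (l1 l2 l3 : {mpoly k[n.+1]}) u v w :
  linear_form l1 -> linear_form l2 -> linear_form l3 ->
  let e l x := pev idfun x l in
  pol (l1 * l2 * l3) u v w = 6%:R^-1 *
   (e l1 u * e l2 v * e l3 w + e l1 u * e l2 w * e l3 v + e l1 v * e l2 u * e l3 w +
    e l1 v * e l2 w * e l3 u + e l1 w * e l2 u * e l3 v + e l1 w * e l2 v * e l3 u).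
Proof.
by move=> h1 h2 h3 e; rewrite /pol !rmorphM /= !linear_formD //= -/(e _ _); ring.
Qed.

Lemma pol_symm p u v w : pol p u v w = pol p v u w.
Proof. by rewrite /pol [u + v]addrC; ring. Qed.

Lemma pol_symr p u v w : pol p u v w = pol p u w v.
Proof. by rewrite /pol [u + w + v]addrAC [w + v]addrC; ring. Qed.

Lemma pol_linear p c u u' v w : p \is 3.-homog ->
  pol p (c *: u + u') v w = c * pol p u v w + pol p u' v w.
Proof.
move: p; apply: cubic_ind => [p q e1 e2|a p e1|i j l].
- by rewrite !polD e1 e2; ring.
- by rewrite !polZ e1; ring.
rewrite !pol_prod; try exact: linear_formX.
by rewrite /= !pevX !mxE; ring.
Qed.

Lemma pol_diag p u : p \is 3.-homog -> pol p u u u = pev idfun u p.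
Proof.
move: p; apply: cubic_ind => [p q e1 e2|a p e1|i j l].
- by rewrite polD rmorphD /= e1 e2.
- by rewrite polZ -mul_mpolyC rmorphM /= pevC e1.
rewrite pol_prod; try exact: linear_formX.
by rewrite !rmorphM /= !pevX; field; rewrite six0.
Qed.

Definition ev (i : 'I_n.+1) : vec := delta_mx 0 i.

Lemma pol_expand1 p u v w : p \is 3.-homog -> pol p u v w = \sum_i u 0 i * pol p (ev i) v w.
Proof.
move=> hp; have p0 x y : pol p 0 x y = 0.
  by have := pol_linear (-1) 0 0 x y hp; rewrite scaler0 addr0 mulN1r addNr.
rewrite {1}[u]row_sum_delta.
elim/big_ind2: _ => [|a x b y <- <-|i _].
- exact: p0.
- by rewrite -{1}[x]scale1r pol_linear // mul1r.
by rewrite -[_ *: _]addr0 pol_linear // p0 addr0.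
Qed.

Lemma pol_expand p u v w : p \is 3.-homog -> pol p u v w =
  \sum_i \sum_j \sum_l pol p (ev i) (ev j) (ev l) * (u 0 i * v 0 j * w 0 l).
Proof.
move=> hp; rewrite pol_expand1 //; apply: eq_bigr => i _.
rewrite pol_symm pol_expand1 // mulr_sumr; apply: eq_bigr => j _.
rewrite [pol p (ev j) _ _]pol_symm pol_symr pol_symm pol_expand1 // !mulr_sumr.
apply: eq_bigr => l _; rewrite [pol p (ev l) _ _]pol_symm [pol p (ev i) _ _]pol_symr.
ring.
Qed.

Lemma cubic_of_homog (x : 'rV[k]_N0) : cubic_of x \is 3.-homog.
Proof.
apply: rpred_sum => i _; apply: rpredZ; exact: (valP ((vbasis {: dhomog n.+1 k 3})`_i)).
Qed.

Definition co p : 'rV[k]_N0 :=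
  \row_a coord (vbasis {: dhomog n.+1 k 3}) a (insubd (0 : dhomog n.+1 k 3) p).

Lemma cubic_ofE (x : 'rV[k]_N0) : cubic_of x =
  mpoly_of_dhomog (\sum_(a < N0) x 0 a *: (vbasis {: dhomog n.+1 k 3})`_a).
Proof.
by rewrite /cubic_of raddf_sum; apply: eq_bigr.
Qed.

Lemma coK p : p \is 3.-homog -> cubic_of (co p) = p.
Proof.
move=> hp; rewrite cubic_ofE.
transitivity (mpoly_of_dhomog (insubd (0 : dhomog n.+1 k 3) p)); last by rewrite insubdK.
congr mpoly_of_dhomog; rewrite [RHS](coord_vbasis (memvf _)).
by apply: eq_bigr => a _; rewrite mxE.
Qed.

Lemma cubic_ofK (x : 'rV[k]_N0) : co (cubic_of x) = x.
Proof.
apply/rowP => a; rewrite mxE cubic_ofE.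
have -> : insubd (0 : dhomog n.+1 k 3) (mpoly_of_dhomog (\sum_(a < N0) x 0 a *: (vbasis {: dhomog n.+1 k 3})`_a))
  = \sum_(a < N0) x 0 a *: (vbasis {: dhomog n.+1 k 3})`_a by apply: val_inj; rewrite insubdK //; exact: valP.
by rewrite coord_sum_free // (basis_free (vbasisP _)).
Qed.

Lemma cubic_of0 (x : 'rV[k]_N0) : (cubic_of x == 0) = (x == 0).
Proof.
apply/eqP/eqP => [h|->]; last by rewrite /cubic_of big1 // => i _; rewrite mxE scale0r.
rewrite -[x]cubic_ofK h; apply/rowP => a; rewrite !mxE.
have -> : insubd (0 : dhomog n.+1 k 3) 0 = 0 by apply: val_inj; rewrite insubdK // rpred0.
by rewrite raddf0.
Qed.

Lemma cubic_of_linear c (x x' : 'rV[k]_N0) : cubic_of (c *: x + x') = c *: cubic_of x + cubic_of x'.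
Proof.
rewrite /cubic_of scaler_sumr -big_split; apply: eq_bigr => a _ /=.
by rewrite !mxE scalerDl scalerA.
Qed.

Lemma cubic_ofZ c (x : 'rV[k]_N0) : cubic_of (c *: x) = c *: cubic_of x.
Proof.
have := cubic_of_linear c x 0; rewrite addr0 => ->.
have -> : cubic_of (0 : 'rV[k]_N0) = 0 by apply/eqP; rewrite cubic_of0.
by rewrite addr0.
Qed.

Lemma cubic_ofD (x x' : 'rV[k]_N0) : cubic_of (x + x') = cubic_of x + cubic_of x'.
Proof. by rewrite -[x]scale1r cubic_of_linear !scale1r. Qed.

Lemma cubic_of_sum (I : Type) (r : seq I) (F : I -> 'rV[k]_N0) :
  cubic_of (\sum_(i <- r) F i) = \sum_(i <- r) cubic_of (F i).
Proof.
elim/big_ind2: _ => [|x' a y' b <- <-|//]; first by apply/eqP; rewrite cubic_of0.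
by rewrite -[a]scale1r cubic_of_linear !scale1r.
Qed.

(** A coordinate of the universal symmetric tensor. *)
Definition tr u v w : {mpoly k[N0]} :=
  \sum_(a < N0) pol (mpoly_of_dhomog (vbasis {: dhomog n.+1 k 3})`_a) u v w *: 'X_a.

Lemma tr_homog u v w : tr u v w \is 1.-homog.
Proof. by apply: rpred_sum => a _; apply: rpredZ; exact: dhomogX1. Qed.

Lemma pev_tr (A : comNzRingType) (phi : {rmorphism k -> A}) (x : 'rV[A]_N0) u v w :
  pev phi x (tr u v w) = \sum_(a < N0) phi (pol (mpoly_of_dhomog (vbasis {: dhomog n.+1 k 3})`_a) u v w) * x 0 a.
Proof.
rewrite /tr rmorph_sum; apply: eq_bigr => a _ /=.
by rewrite -mul_mpolyC rmorphM /= pevC pevX.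
Qed.

Lemma trE (x : 'rV[k]_N0) u v w : pev idfun x (tr u v w) = pol (cubic_of x) u v w.
Proof. by rewrite pev_tr /cubic_of pol_sum; apply: eq_bigr => a _; rewrite polZ mulrC. Qed.

Lemma tr_symm u v w : tr u v w = tr v u w.
Proof. by apply: eq_bigr => a _; rewrite pol_symm. Qed.

Lemma tr_symr u v w : tr u v w = tr u w v.
Proof. by apply: eq_bigr => a _; rewrite pol_symr. Qed.

Lemma tr_linear c u u' v w : tr (c *: u + u') v w = c *: tr u v w + tr u' v w.
Proof.
rewrite /tr scaler_sumr -big_split; apply: eq_bigr => a _ /=.
by rewrite pol_linear ?scalerDl ?scalerA //; exact: (valP ((vbasis {: dhomog n.+1 k 3})`_a)).
Qed.

Definition mon3 i j l : 'rV[k]_N0 := co ('X_i * 'X_j * 'X_l).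

Lemma mon3_homog i j l : ('X_i * 'X_j * 'X_l : {mpoly k[n.+1]}) \is 3.-homog.
Proof. by rewrite -[3%N]/(1 + 1 + 1)%N; apply: dhomogM; first apply: dhomogM; exact: dhomogX1. Qed.

(** The point of the space of cubics with the coefficient tensor [T]. *)
Definition cub (A : comNzRingType) (phi : k -> A) (T : 'I_n.+1 -> 'I_n.+1 -> 'I_n.+1 -> A) : 'rV[A]_N0 :=
  \row_a \sum_i \sum_j \sum_l T i j l * phi (mon3 i j l 0 a).

Lemma pev_cubt T u :
  pev idfun u (cubt (fun i j l => (T i j l)%:MP) (fun i => 'X_i : {mpoly k[n.+1]})) =
  cubt T (u 0).
Proof.
rewrite /cubt rmorph_sum; apply: eq_bigr => i _ /=; rewrite rmorph_sum; apply: eq_bigr => j _ /=.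
by rewrite rmorph_sum; apply: eq_bigr => l _ /=; rewrite !rmorphM /= !pevX pevC.
Qed.

Lemma cubic_of_cub T : cubic_of (cub idfun T) =
  cubt (fun i j l => (T i j l)%:MP) (fun i => 'X_i : {mpoly k[n.+1]}).
Proof.
have -> : cub idfun T = \sum_i \sum_j \sum_l T i j l *: mon3 i j l.
  apply/rowP => a; rewrite mxE summxE; apply: eq_bigr => i _; rewrite summxE.
  by apply: eq_bigr => j _; rewrite summxE; apply: eq_bigr => l _; rewrite [in RHS]mxE.
rewrite cubic_of_sum; apply: eq_bigr => i _; rewrite cubic_of_sum; apply: eq_bigr => j _.
rewrite cubic_of_sum; apply: eq_bigr => l _.
by rewrite cubic_ofZ coK ?mon3_homog // mul_mpolyC.
Qed.

(** A cubic is determined by its polarisation on the basis; this holds over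
    every algebra since both sides are linear in the coordinates. *)
Lemma cub_tr (A : comNzRingType) (phi : {rmorphism k -> A}) (x : 'rV[A]_N0) :
  cub phi (fun i j l => pev phi x (tr (ev i) (ev j) (ev l))) = x.
Proof.
have key a : \sum_i \sum_j \sum_l tr (ev i) (ev j) (ev l) * (mon3 i j l 0 a)%:MP = 'X_a.
  apply/eqP; rewrite -subr_eq0; apply/eqP/mpoly_zero_test => x0.
  rewrite rmorphB /= pevX; apply/eqP; rewrite subr_eq0; apply/eqP.
  transitivity (cub idfun (fun i j l => pol (cubic_of x0) (ev i) (ev j) (ev l)) 0 a).
    rewrite mxE rmorph_sum; apply: eq_bigr => i _ /=; rewrite rmorph_sum; apply: eq_bigr => j _ /=.
    by rewrite rmorph_sum; apply: eq_bigr => l _ /=; rewrite rmorphM /= trE pevC.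
  suff -> : cub idfun (fun i j l => pol (cubic_of x0) (ev i) (ev j) (ev l)) = x0 by [].
  rewrite -[LHS]cubic_ofK -[RHS]cubic_ofK; congr co; rewrite cubic_of_cub; apply/eqP; rewrite -subr_eq0; apply/eqP/mpoly_zero_test => u.
  rewrite rmorphB /= pev_cubt; apply/eqP; rewrite subr_eq0; apply/eqP.
  by rewrite -pol_diag ?cubic_of_homog // [RHS]pol_expand ?cubic_of_homog.
apply/rowP => a; rewrite mxE -[RHS](pevX phi x a) -key.
rewrite rmorph_sum; apply: eq_bigr => i _ /=; rewrite rmorph_sum; apply: eq_bigr => j _ /=.
by rewrite rmorph_sum; apply: eq_bigr => l _ /=; rewrite rmorphM /= pevC.
Qed.

Lemma cubZ (A : comNzRingType) (phi : k -> A) T c :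
  cub phi (fun i j l => c * T i j l) = c *: cub phi T.
Proof.
apply/rowP => a; rewrite !mxE mulr_sumr; apply: eq_bigr => i _.
rewrite mulr_sumr; apply: eq_bigr => j _; rewrite mulr_sumr; apply: eq_bigr => l _.
by rewrite mulrA.
Qed.

Lemma cub_ext (A : comNzRingType) (phi : k -> A) T T' :
  (forall i j l, T i j l = T' i j l) -> cub phi T = cub phi T'.
Proof. by move=> h; apply/rowP => a; rewrite !mxE; do 3!(apply: eq_bigr => ? _); rewrite h. Qed.

End Cubics.

(** * Coordinates of the charts *)

Section Coordinates.
Variable n : nat.
Notation I := 'I_n.+1.

(** The variables of the charts: the coefficients of a linear form [b], a linear
    form [m], a quadratic form [q] and a cubic form [g], and three parameters
    [s0], [s1], [s2]. *)
Definition idx : finType := (I + I + (I * I) + (I * I * I) + option bool)%type.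
Definition vb (i : I) : 'I_#|idx| := enum_rank (inl (inl (inl (inl i))) : idx).
Definition vm (i : I) : 'I_#|idx| := enum_rank (inl (inl (inl (inr i))) : idx).
Definition vq (i j : I) : 'I_#|idx| := enum_rank (inl (inl (inr (i, j))) : idx).
Definition vg (i j l : I) : 'I_#|idx| := enum_rank (inl (inr (i, j, l)) : idx).
Definition vs0 : 'I_#|idx| := enum_rank (inr None : idx).
Definition vs1 : 'I_#|idx| := enum_rank (inr (Some false) : idx).
Definition vs2 : 'I_#|idx| := enum_rank (inr (Some true) : idx).

Lemma idx_ind (Q : 'I_#|idx| -> Prop) :
  (forall i, Q (vb i)) -> (forall i, Q (vm i)) -> (forall i j, Q (vq i j)) ->
  (forall i j l, Q (vg i j l)) -> Q vs0 -> Q vs1 -> Q vs2 -> forall t, Q t.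
Proof.
move=> hb hm hq hg h0 h1 h2 t; rewrite -(enum_valK t).
by case: (enum_val t) => [[[[i|i]|[i j]]|[[i j] l]]|[[]|]]; [exact: hb|exact: hm|exact: hq|exact: hg|exact: h2|exact: h1|exact: h0].
Qed.

Section Ring.
Variable A : comNzRingType.

Definition mkp (b m : I -> A) (q : I -> I -> A) (g : I -> I -> I -> A) (s0 s1 s2 : A) :
    'rV[A]_#|idx| :=
  \row_t match enum_val t with
    | inl (inl (inl (inl i))) => b i
    | inl (inl (inl (inr i))) => m i
    | inl (inl (inr p)) => q p.1 p.2
    | inl (inr p) => g p.1.1 p.1.2 p.2
    | inr None => s0
    | inr (Some false) => s1
    | inr (Some true) => s2
    end.

Section Mkp.
Variables (b m : I -> A) (q : I -> I -> A) (g : I -> I -> I -> A) (s0 s1 s2 : A).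
Notation c := (mkp b m q g s0 s1 s2).
Lemma mkp_b i : c 0 (vb i) = b i. Proof. by rewrite mxE enum_rankK. Qed.
Lemma mkp_m i : c 0 (vm i) = m i. Proof. by rewrite mxE enum_rankK. Qed.
Lemma mkp_q i j : c 0 (vq i j) = q i j. Proof. by rewrite mxE enum_rankK. Qed.
Lemma mkp_g i j l : c 0 (vg i j l) = g i j l. Proof. by rewrite mxE enum_rankK. Qed.
Lemma mkp_s0 : c 0 vs0 = s0. Proof. by rewrite mxE enum_rankK. Qed.
Lemma mkp_s1 : c 0 vs1 = s1. Proof. by rewrite mxE enum_rankK. Qed.
Lemma mkp_s2 : c 0 vs2 = s2. Proof. by rewrite mxE enum_rankK. Qed.
End Mkp.

Definition sym3 (m : I -> A) (q : I -> I -> A) i j l :=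
  m i * q j l + m j * q i l + m l * q i j.

Implicit Type c : 'rV[A]_#|idx|.

(** The substitutions through which the charts of the successive blow-ups are
    obtained: in the first chart [b], [q], [g] are the coefficients of [X], [P],
    [G]; the equation of the exceptional divisor is [s0] for the first three
    steps and [s2] for the last one. *)
Definition sub0 c := mkp (fun i => c 0 (vb i)) (fun i => c 0 (vm i))
  (fun i j => c 0 vs0 * c 0 (vq i j)) (fun i j l => c 0 vs0 * c 0 (vg i j l))
  (c 0 vs0) (c 0 vs1) (c 0 vs2).

Definition sub1 c := mkp (fun i => c 0 (vb i)) (fun i => c 0 (vm i))
  (fun i j => c 0 (vq i j)) (fun i j l => c 0 vs0 * c 0 (vg i j l))
  (c 0 vs0 * c 0 vs1) (c 0 vs1) (c 0 vs2).

(** Near the proper transform of [S_0] the invariants are, up to powers of [s0],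
    [P = (1 + s1)(m^2 + q)] and [G = (1 + s1)(m^3 + 3/2 m q + g)], and [S_0] is
    [s1 = q = g = 0]; the parameter [h] is the constant one half. *)
Definition sub2 (h : A) c := mkp (fun i => c 0 (vb i)) (fun i => c 0 (vm i))
  (fun i j => (1 + c 0 vs1) * (c 0 (vm i) * c 0 (vm j) + c 0 (vq i j)))
  (fun i j l => (1 + c 0 vs1) * (c 0 (vm i) * c 0 (vm j) * c 0 (vm l) +
     h * sym3 (fun i => c 0 (vm i)) (fun i j => c 0 (vq i j)) i j l + c 0 (vg i j l)))
  (c 0 vs0) (c 0 vs0) (c 0 vs2).

Definition sub3 c := mkp (fun i => c 0 (vb i)) (fun i => c 0 (vm i))
  (fun i j => c 0 vs2 * c 0 (vq i j)) (fun i j l => c 0 vs2 * c 0 (vg i j l))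
  (c 0 vs0) (c 0 vs2 * c 0 vs1) (c 0 vs2).

End Ring.
Definition mkpE := (mkp_b, mkp_m, mkp_q, mkp_g, mkp_s0, mkp_s1, mkp_s2).

Section Morphism.
Variables (A B : comNzRingType) (f : {rmorphism A -> B}).

Lemma map_sub0 c : map_mx f (sub0 c) = sub0 (map_mx f c).
Proof.
by apply/rowP; elim/idx_ind => *; rewrite [LHS]mxE !mkpE; rewrite !mxE ?rmorphM.
Qed.

Lemma map_sub1 c : map_mx f (sub1 c) = sub1 (map_mx f c).
Proof.
by apply/rowP; elim/idx_ind => *; rewrite [LHS]mxE !mkpE; rewrite !mxE ?rmorphM.
Qed.

Lemma map_sub2 h c : map_mx f (sub2 h c) = sub2 (f h) (map_mx f c).
Proof.
by apply/rowP; elim/idx_ind => *; rewrite [LHS]mxE !mkpE /sym3; rewrite !mxE;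
  rewrite ?(rmorphM, rmorphD, rmorph1).
Qed.

Lemma map_sub3 c : map_mx f (sub3 c) = sub3 (map_mx f c).
Proof.
by apply/rowP; elim/idx_ind => *; rewrite [LHS]mxE !mkpE; rewrite !mxE ?rmorphM.
Qed.

End Morphism.
End Coordinates.

(** * The first chart and the triple hyperplanes *)

Section ChainRule.
Variable k : closedFieldType.

Lemma deriv_pev N (xi : 'rV[{poly k}]_N) (F : {mpoly k[N]}) :
  (pev (@polyC k) xi F)^`() = \sum_i (xi 0 i)^`() * pev (@polyC k) xi (F^`M(i)).
Proof.
elim/mpolyind: F => [|c m F _ _ IH].
  rewrite rmorph0 linear0 big1 // => i _; by rewrite linear0 rmorph0 mulr0.
rewrite rmorphD derivD IH.
suff -> : (pev (@polyC k) xi (c *: 'X_[m]))^`() =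
   \sum_i (xi 0 i)^`() * pev (@polyC k) xi ((c *: 'X_[m])^`M(i)).
  rewrite -big_split; apply: eq_bigr => i _.
  by rewrite linearD rmorphD mulrDr.
rewrite -mul_mpolyC rmorphM /= pevC derivM derivC mul0r add0r.
have E i : pev (@polyC k) xi ((c%:MP * 'X_[m])^`M(i)) = c%:P * pev (@polyC k) xi ('X_[m]^`M(i)).
  by rewrite mderiv_mulC rmorphM /= pevC.
rewrite (eq_bigr _ (fun i _ => congr1 _ (E i))).
rewrite (eq_bigr (fun i => c%:P * ((xi 0 i)^`() * pev (@polyC k) xi ('X_[m]^`M(i))))); last first.
  by move=> i _; ring.
rewrite -mulr_sumr; congr (_ * _); move: {c F IH E} m.
have one : forall i : 'I_N, (pev (@polyC k) xi 'X_i)^`() =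
   \sum_j (xi 0 j)^`() * pev (@polyC k) xi ('X_i^`M(j)).
  move=> i; rewrite pevX (bigD1 i) //= big1 ?addr0 => [|j ne].
    rewrite mderivX mnm1E eqxx scale1r.
    have -> : (U_(i) - U_(i))%MM = 0%MM :> 'X_{1..N}.
      by apply/mnmP => l; rewrite mnmBE mnm0E subnn.
    by rewrite mpolyX0 rmorph1 mulr1.
  by rewrite mderivX mnm1E eq_sym (negbTE ne) scale0r rmorph0 mulr0.
have mulP : forall F G : {mpoly k[N]},
   (pev (@polyC k) xi F)^`() = \sum_j (xi 0 j)^`() * pev (@polyC k) xi (F^`M(j)) ->
   (pev (@polyC k) xi G)^`() = \sum_j (xi 0 j)^`() * pev (@polyC k) xi (G^`M(j)) ->
   (pev (@polyC k) xi (F * G))^`() = \sum_j (xi 0 j)^`() * pev (@polyC k) xi ((F * G)^`M(j)).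
  move=> F G hF hG; rewrite rmorphM derivM hF hG mulr_suml mulr_sumr -big_split.
  by apply: eq_bigr => j _; rewrite mderivM rmorphD !rmorphM /=; ring.
move=> m; rewrite mpolyXE_id.
have h1 : (pev (@polyC k) xi 1)^`() = \sum_j (xi 0 j)^`() * pev (@polyC k) xi (1^`M(j)).
  rewrite rmorph1 -polyC1 derivC big1 // => j _.
  by rewrite -(mpolyC1) mderivC rmorph0 mulr0.
elim/big_ind: _ => [//|F G|i _]; first exact: mulP.
by elim: (m i) => [|e IH]; rewrite ?expr0 // exprS; apply: mulP.
Qed.

Lemma diff_arc N M (f : 'I_M -> {mpoly k[N]}) (xi : 'rV[{poly k}]_N) (x v : 'rV[k]_N) j :
  map_mx (horner_eval 0) xi = x -> (forall i, (xi 0 i)^`().[0] = v 0 i) ->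
  (pev (@polyC k) xi (f j))^`().[0] = diff_forms f x v 0 j.
Proof.
move=> hx hv; rewrite deriv_pev horner_sum mxE; apply: eq_bigr => i _.
by rewrite hornerM hv horner_pev hx.
Qed.

End ChainRule.

Lemma evf_map (k A : comNzRingType) (phi : {rmorphism k -> A}) r N
  (psi : 'rV[{mpoly k[r]}]_N) (c : 'rV[A]_r) :
  evf phi (psi 0) c = map_mx (pev phi c) psi.
Proof. by apply/rowP => i; rewrite !mxE. Qed.

Lemma map_vars (k A : comNzRingType) (phi : {rmorphism k -> A}) r (c : 'rV[A]_r) :
  map_mx (pev phi c) (\row_i 'X_i) = c.
Proof. by apply/rowP => i; rewrite !mxE /= pevX. Qed.

Definition linp (k : comNzRingType) n (b : 'I_n -> k) : {mpoly k[n]} :=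
  lin (fun i => (b i)%:MP) (fun i => 'X_i).
Definition quadp (k : comNzRingType) n (q : 'I_n -> 'I_n -> k) : {mpoly k[n]} :=
  quad (fun i j => (q i j)%:MP) (fun i => 'X_i).
Definition cubtp (k : comNzRingType) n (g : 'I_n -> 'I_n -> 'I_n -> k) : {mpoly k[n]} :=
  cubt (fun i j l => (g i j l)%:MP) (fun i => 'X_i).

Section CubicChart.
Variables (k : closedFieldType) (n : nat).
Notation N0 := (cubic_dim k n).
Notation r := #|idx n|.

Lemma linp_linear (b : 'I_n.+1 -> k) : linear_form (linp b).
Proof. by apply: rpred_sum => i _; apply: dhomogMC; exact: dhomogX1. Qed.

Lemma quadp_homog (q : 'I_n.+1 -> 'I_n.+1 -> k) : quadp q \is 2.-homog.
Proof.
apply: rpred_sum => i _; apply: rpred_sum => j _; apply: dhomogMC.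
by rewrite -[2%N]/(1 + 1)%N; apply: dhomogM; exact: dhomogX1.
Qed.

Lemma pev_linp (b : 'I_n.+1 -> k) u : pev idfun u (linp b) = lin b (u 0).
Proof. by rewrite rmorph_sum; apply: eq_bigr => i _ /=; rewrite rmorphM /= pevC pevX. Qed.

Lemma pev_quadp (q : 'I_n.+1 -> 'I_n.+1 -> k) u : pev idfun u (quadp q) = quad q (u 0).
Proof.
rewrite rmorph_sum; apply: eq_bigr => i _ /=; rewrite rmorph_sum; apply: eq_bigr => j _ /=.
by rewrite !rmorphM /= pevC !pevX.
Qed.

Lemma cubic_of_tcub b P G : cubic_of (cub idfun (tcub b P G) : 'rV[k]_N0) =
  linp b ^+ 3 - 3%:R * quadp P * linp b + 2%:R * cubtp G.
Proof.
rewrite cubic_of_cub -cubt_tcub; do 3!(apply: eq_bigr => ? _); congr (_ * _).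
by rewrite /tcub !(rmorphD, rmorphN, rmorphM, rmorphMn).
Qed.

Definition cubc (A : comNzRingType) (phi : k -> A) (c : 'rV[A]_r) : 'rV[A]_N0 :=
  cub phi (tcub (fun i => c 0 (vb i)) (fun i j => c 0 (vq i j)) (fun i j l => c 0 (vg i j l))).

Lemma map_cubc (A B : comNzRingType) (phi : k -> A) (f : {rmorphism A -> B}) c :
  map_mx f (cubc phi c) = cubc (f \o phi) (map_mx f c).
Proof.
apply/rowP => a; rewrite !mxE rmorph_sum; apply: eq_bigr => i _; rewrite rmorph_sum.
apply: eq_bigr => j _; rewrite rmorph_sum; apply: eq_bigr => l _.
by rewrite rmorphM /tcub !(rmorphD, rmorphN, rmorphM, rmorphMn) !mxE.
Qed.

Definition psi0 : 'rV[{mpoly k[r]}]_N0 := cubc (@mpolyC r k) (\row_i 'X_i).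
Definition sg0 : 'rV[{mpoly k[r]}]_r := sub0 (\row_i 'X_i).
Definition sg1 : 'rV[{mpoly k[r]}]_r := sub1 (\row_i 'X_i).
Definition sg2 : 'rV[{mpoly k[r]}]_r := sub2 (2%:R^-1)%:MP (\row_i 'X_i).
Definition sg3 : 'rV[{mpoly k[r]}]_r := sub3 (\row_i 'X_i).

Section Eval.
Variables (A : comNzRingType) (phi : {rmorphism k -> A}) (c : 'rV[A]_r).

Lemma evf_psi0 : evf phi (psi0 0) c = cubc phi c.
Proof.
rewrite evf_map map_cubc /= map_vars; apply/rowP => a; rewrite !mxE.
by do 3!(apply: eq_bigr => ? _); rewrite /= pevC.
Qed.
Lemma evf_sg0 : evf phi (sg0 0) c = sub0 c.
Proof. by rewrite evf_map map_sub0 map_vars. Qed.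
Lemma evf_sg1 : evf phi (sg1 0) c = sub1 c.
Proof. by rewrite evf_map map_sub1 map_vars. Qed.
Lemma evf_sg2 : evf phi (sg2 0) c = sub2 (phi 2%:R^-1) c.
Proof. by rewrite evf_map map_sub2 map_vars /= pevC. Qed.
Lemma evf_sg3 : evf phi (sg3 0) c = sub3 c.
Proof. by rewrite evf_map map_sub3 map_vars. Qed.
End Eval.

Lemma quadp0 (q : 'I_n.+1 -> 'I_n.+1 -> k) : (forall i j, q i j = 0) -> quadp q = 0.
Proof.
by move=> h; rewrite /quadp /quad big1 // => i _; rewrite big1 // => j _; rewrite h mul0r.
Qed.

Lemma cubtp0 (g : 'I_n.+1 -> 'I_n.+1 -> 'I_n.+1 -> k) : (forall i j l, g i j l = 0) -> cubtp g = 0.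
Proof.
move=> h; rewrite /cubtp /cubt big1 // => i _; rewrite big1 // => j _; rewrite big1 // => l _.
by rewrite h mul0r.
Qed.

Definition center0 (x : 'rV[k]_r) := 
  (forall i j, x 0 (vq i j) = 0) /\ (forall i j l, x 0 (vg i j l) = 0).

Lemma cube_point (x : 'rV[k]_N0) (l : {mpoly k[n.+1]}) : linear_form l -> cubic_of x = l ^+ 3 ->
  point_of B0 x.
Proof.
move=> hl e; have [l0|l0] := eqVneq l 0.
  by left; apply/eqP; rewrite -cubic_of0 e l0 expr0n.
right; exists l; split=> //; exists 1; rewrite ?oner_eq0 // scale1r e; ring.
Qed.

Lemma cubc_cube x : center0 x -> cubic_of (cubc idfun x) = linp (fun i => x 0 (vb i)) ^+ 3.
Proof. by move=> [hq hg]; rewrite cubic_of_tcub quadp0 // cubtp0 // mulr0 mul0r subr0 mulr0 addr0. Qed.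

Lemma center0_point x : center0 x -> point_of B0 (pat psi0 x).
Proof.
by move=> hx; rewrite (evf_psi0 idfun); apply: cube_point (linp_linear _) (cubc_cube hx).
Qed.

End CubicChart.

(** * The center of the second blow-up *)

Section Centers.
Variables (k : closedFieldType) (n : nat).
Hypothesis two0 : (2%:R : k) != 0.
Hypothesis three0 : (3%:R : k) != 0.
Notation N0 := (cubic_dim k n).
Notation r := #|idx n|.
Notation psi0 := (psi0 k n).

Lemma quadpZ (c : k) (q : 'I_n.+1 -> 'I_n.+1 -> k) :
  quadp (fun i j => c * q i j) = c%:MP * quadp q.
Proof.
rewrite /quadp /quad mulr_sumr; apply: eq_bigr => i _; rewrite mulr_sumr.
by apply: eq_bigr => j _; rewrite rmorphM -mulrA.
Qed.

Lemma pat_psi0 (x : 'rV[k]_r) : pat (psubst (sg0 k n) psi0) x = cubc idfun (sub0 x).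
Proof. by rewrite (evf_psubst idfun) (evf_sg0 idfun) (evf_psi0 idfun). Qed.

Lemma affine_arc N (xi : 'rV[{poly k}]_N) (x v : 'rV[k]_N) :
  (forall t, map_mx (horner_eval t) xi = x + t *: v) ->
  map_mx (horner_eval 0) xi = x /\ forall i, (xi 0 i)^`().[0] = v 0 i.
Proof.
move=> h; split; first by rewrite h scale0r addr0.
move=> i; have -> : xi 0 i = (x 0 i)%:P + 'X * (v 0 i)%:P.
  apply/eqP; rewrite -subr_eq0; apply/eqP/closed_poly0 => t.
  have := congr1 (fun z : 'rV[k]_N => z 0 i) (h t); rewrite !mxE /horner_eval => e.
  by rewrite !hornerE e subrr.
by rewrite derivD derivC derivM derivX derivC !hornerE.
Qed.

Section Level1.
Variable b0 : blowup (@V0 k n) B0.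
Variable A0 : 'rV[{mpoly k[r]}]_(bl_size b0).
Hypothesis hA0 : factors b0 (psubst (sg0 k n) psi0) (vs0 n) A0.
Notation psi1 := (segreR (psubst (sg0 k n) psi0) A0).

Definition shift_s0 (x : 'rV[k]_r) : 'rV[{poly k}]_r :=
  \row_i ((x 0 i)%:P + (i == vs0 n)%:R *: 'X).

Lemma shift_s0E (x : 'rV[k]_r) t : map_mx (horner_eval t) (shift_s0 x) =
  \row_i (x 0 i + (i == vs0 n)%:R * t).
Proof. by apply/rowP => i; rewrite !mxE /horner_eval !hornerE. Qed.

(** Moving [s0] moves the cube [X^3] in the direction [-3 X q], so the forms of
    the blow-up divided by [s0] are their derivatives in that direction.  If
    [X q] is a multiple of [X^2] the direction is tangent to the cubes and the
    derivative is zero. *)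
Lemma center1_point (x : 'rV[k]_r) : x 0 (vs0 n) = 0 ->
  (forall i j l, x 0 (vg i j l) = 0) -> point_of (B1 b0) (pat psi1 x).
Proof.
move=> hs hg; rewrite (evf_segre idfun) pat_psi0; set p := cubc _ _.
pose X := linp (fun i => x 0 (vb i)); pose q := (- 3%:R)%:MP * quadp (fun i j => x 0 (vq i j)).
have hX : linear_form X by exact: linp_linear.
have hq : q \is 2.-homog by apply: dhomogMC; exact: quadp_homog.
have hp : cubic_of p = X ^+ 3.
  rewrite /p cubc_cube; first by congr (_ ^+ 3); apply: eq_bigr => i _; rewrite mkpE.
  by split=> *; rewrite mkpE hs mul0r.
have [X0|X0] := eqVneq X 0.
  left; have -> : p = 0 by apply/eqP; rewrite -cubic_of0 hp X0 expr0n.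
  exact: segreR0l.
have hXq : X * q \is 3.-homog by rewrite -[3%N]/(1 + 2)%N; apply: dhomogM.
pose v := co (X * q).
have hv : cubic_of v = X * q by rewrite coK.
have arc t : pat (psubst (sg0 k n) psi0) (map_mx (horner_eval t) (shift_s0 x)) = p + t *: v.
  rewrite pat_psi0 -[LHS](cubic_ofK) -[RHS]cubic_ofK; congr co.
  rewrite cubic_ofD cubic_ofZ hv hp cubic_of_tcub.
  rewrite cubtp0; last by move=> i j l; rewrite mkpE shift_s0E !mxE hg [vg _ _ _ == _](_ : _ = false) ?mul0r ?addr0 ?mulr0 //;
    apply/negbTE; rewrite (inj_eq enum_rank_inj).
  rewrite (_ : quadp _ = t%:MP * quadp (fun i j => x 0 (vq i j))); last first.
    rewrite -quadpZ; do 2!(apply: eq_bigr => ? _); congr (_%:MP * _).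
    rewrite mkpE shift_s0E !mxE hs eqxx add0r mul1r [vq _ _ == _](_ : _ = false) ?mul0r ?addr0 //.
    by apply/negbTE; rewrite (inj_eq enum_rank_inj).
  rewrite (_ : linp _ = X); last first.
    apply: eq_bigr => i _; congr (_%:MP * _); rewrite mkpE shift_s0E !mxE [vb _ == _](_ : _ = false) ?mul0r ?addr0 //.
    by apply/negbTE; rewrite (inj_eq enum_rank_inj).
  rewrite -mul_mpolyC /q mulr0 addr0 mpolyCN mpolyC_nat; ring.
pose xi := shift_s0 x; pose eta := evf (@polyC k) (psubst (sg0 k n) psi0 0) xi.
have etaE t : map_mx (horner_eval t) eta = p + t *: v.
  rewrite -arc; apply/rowP => a; rewrite !mxE.
  by rewrite -[LHS]/((pev (@polyC k) xi _).[t]) horner_pev.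
have [eta0 eta1] := affine_arc etaE.
have [T hT eT] := hA0.
have {hT} hT : T = 'X_(vs0 n).
  case: hT => [//|[_ no]]; exfalso; apply: (no (co ('X_ord0 ^+ 3))).
  have hom : ('X_ord0 ^+ 3 : {mpoly k[n.+1]}) \is 3.-homog.
    by rewrite -[X in X.-homog]/(1 * 3)%N; apply: dhomogMn; exact: dhomogX1.
  have e3 : cubic_of (co ('X_ord0 ^+ 3)) = 'X_ord0 ^+ 3 :> {mpoly k[n.+1]} by rewrite coK.
  have [e|//] := cube_point (@linear_formX k n ord0) e3; have := congr1 (fun z => cubic_of z == 0) e.
  rewrite coK // cubic_of0 eqxx expf_eq0 /= => /eqP/(congr1 (fun g : {mpoly k[n.+1]} => pev idfun (const_mx 1) g)).
  by rewrite pevX rmorph0 mxE => /eqP; rewrite oner_eq0.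
have hA : pat A0 x = diff_forms (bl_form b0) p v.
  apply/rowP => j; rewrite -(diff_arc (bl_form b0) j eta0 eta1) mxE.
  rewrite /eta (evf_comp (@polyC k)) eT hT rmorphM /= pevX derivM hornerD !hornerM.
  rewrite [xi _ _]mxE hs eqxx scale1r add0r derivX hornerX mul0r addr0 hornerC mul1r.
  by rewrite horner_pev shift_s0E; congr pev; apply/rowP => i; rewrite mxE mulr0 addr0.
rewrite hA; have [[m [hm em]]|no] := classic (exists m, linear_form m /\ X * q = X ^+ 2 * m).
  left; clearbody p v; suff -> : diff_forms (bl_form b0) p v = 0 by exact: segreR0r.
  pose m3 := (3%:R^-1)%:MP * m.
  have hm3 : linear_form m3 by exact: dhomogMC.
  have h2 : (3%:R * X * m3 ^+ 2) \is 3.-homog.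
    rewrite -[3%:R]mpolyC_nat -mulrA; apply: dhomogMC; rewrite -[X in X.-homog]/(1 + 1 * 2)%N.
    by apply: dhomogM => //; apply: dhomogMn.
  have h3 : (m3 ^+ 3) \is 3.-homog by rewrite -[X in X.-homog]/(1 * 3)%N; apply: dhomogMn.
  have [v2 hv2] : exists v2 : 'rV[k]_N0, cubic_of v2 = 3%:R * X * m3 ^+ 2.
    by exists (co (3%:R * X * m3 ^+ 2)); rewrite coK.
  have [v3 hv3] : exists v3 : 'rV[k]_N0, cubic_of v3 = m3 ^+ 3.
    by exists (co (m3 ^+ 3)); rewrite coK.
  pose ze : 'rV[{poly k}]_N0 := \row_a ((p 0 a)%:P + v 0 a *: 'X + v2 0 a *: 'X^2 + v3 0 a *: 'X^3).
  have zeE t : map_mx (horner_eval t) ze = p + t *: v + t ^+ 2 *: v2 + t ^+ 3 *: v3.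
    by apply/rowP => a; rewrite !mxE /horner_eval !(hornerD, hornerC, hornerZ, hornerX, hornerXn); ring.
  have ze0 : map_mx (horner_eval 0) ze = p.
    by rewrite zeE !expr0n /= !scale0r !addr0.
  have ze1 i : (ze 0 i)^`().[0] = v 0 i.
    rewrite mxE !(derivD, derivC, derivZ, derivX, derivXn).
    rewrite !(hornerD, hornerZ, hornerMn, hornerXn, hornerC, hornerX) /=.
    by rewrite ?expr0n /= !(add0r, addr0, mulr0, mulr1).
  apply/rowP => j; rewrite -(diff_arc (bl_form b0) j ze0 ze1) mxE.
  suff -> : pev (@polyC k) ze (bl_form b0 j) = 0 by rewrite linear0 horner0.
  apply: closed_poly0 => t; rewrite horner_pev zeE.
  have : point_of B0 (p + t *: v + t ^+ 2 *: v2 + t ^+ 3 *: v3).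
    apply: (@cube_point _ _ _ (X + t%:MP * m3)).
      by apply: rpredD => //; exact: dhomogMC.
    rewrite !cubic_ofD !cubic_ofZ hp hv hv2 hv3 em -!mul_mpolyC !rmorphXn /=.
    have -> : m = 3%:R * m3.
      by rewrite /m3 mulrA -mpolyC_nat -mpolyCM mulfV // mul1r.
    ring.
  case=> [->|Bx]; last by rewrite -pev_id; exact: bl_vanishes.
  have b0B : point_of B0 p by exact: cube_point hX hp.
  case: b0B => [p0|Bp].
    by move/eqP: p0; rewrite -cubic_of0 hp expf_eq0 (negbTE X0).
  rewrite -(scale0r p) (pev_homog _ _ _ (@bl_homog _ _ _ _ b0 j)).
  by rewrite -[pev _ _ _]pev_id bl_vanishes // mulr0.
right; exists X, q, p, v; split=> //.
- by move=> m hm em; apply: no; exists m.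
- by exists 1; rewrite ?oner_eq0 // scale1r.
Qed.

End Level1.
End Centers.

(** * Limits in charts, and forms with given coefficients *)

Section Moving.
Variables (k : closedFieldType) (r : nat).

Definition set_coord (l : 'I_r) (t : k) (x : 'rV[k]_r) : 'rV[k]_r :=
  \row_i (if i == l then t else x 0 i).

Lemma set_coordE l t (x : 'rV[k]_r) : set_coord l t x 0 l = t.
Proof. by rewrite mxE eqxx. Qed.

Lemma set_coordN l t (x : 'rV[k]_r) i : i != l -> set_coord l t x 0 i = x 0 i.
Proof. by rewrite mxE => /negbTE ->. Qed.

Lemma set_coord_id l (x : 'rV[k]_r) : set_coord l (x 0 l) x = x.
Proof. by apply/rowP => i; rewrite mxE; case: eqP => [->|]. Qed.

(** The coordinate is moved along a line; a closed condition is polynomial in its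
    value. *)
Lemma point_of_limit N (Z : pset k N) (psi : 'rV[{mpoly k[r]}]_N) l (x : 'rV[k]_r) :
  closed_set Z -> (forall t, t != 0 -> point_of Z (pat psi (set_coord l t x))) ->
  point_of Z (pat psi x).
Proof.
move=> cZ h; pose xi : 'rV[{poly k}]_r := \row_i (if i == l then 'X else (x 0 i)%:P).
have e t : map_mx (horner_eval t) xi = set_coord l t x.
  by apply/rowP => i; rewrite !mxE; case: ifP => _; rewrite /horner_eval ?hornerX ?hornerC.
rewrite -(set_coord_id l x) -e.
have X0 : 'X != 0 :> {poly k} by rewrite polyX_eq0.
apply: (point_of_density cZ X0 (xi := xi)) => t; rewrite hornerX e; exact: h.
Qed.

End Moving.

Section Forms.
Variables (k : closedFieldType) (n : nat).

Lemma linpZ (c : k) (m : 'I_n.+1 -> k) : linp (fun i => c * m i) = c%:MP * linp m.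
Proof. by rewrite /linp /lin mulr_sumr; apply: eq_bigr => i _; rewrite rmorphM -mulrA. Qed.

Lemma linpD (m m' : 'I_n.+1 -> k) : linp (fun i => m i + m' i) = linp m + linp m'.
Proof. by rewrite /linp /lin -big_split; apply: eq_bigr => i _; rewrite rmorphD mulrDl. Qed.

Lemma linp_ext (m m' : 'I_n.+1 -> k) : (forall i, m i = m' i) -> linp m = linp m'.
Proof. by move=> h; apply: eq_bigr => i _; rewrite h. Qed.

Lemma quadp_ext (q q' : 'I_n.+1 -> 'I_n.+1 -> k) : (forall i j, q i j = q' i j) -> quadp q = quadp q'.
Proof. by move=> h; apply: eq_bigr => i _; apply: eq_bigr => j _; rewrite h. Qed.

Lemma cubtp_ext (g g' : 'I_n.+1 -> 'I_n.+1 -> 'I_n.+1 -> k) :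
  (forall i j l, g i j l = g' i j l) -> cubtp g = cubtp g'.
Proof.
by move=> h; apply: eq_bigr => i _; apply: eq_bigr => j _; apply: eq_bigr => l _; rewrite h.
Qed.

Lemma quadpD (q q' : 'I_n.+1 -> 'I_n.+1 -> k) :
  quadp (fun i j => q i j + q' i j) = quadp q + quadp q'.
Proof.
rewrite /quadp /quad -big_split; apply: eq_bigr => i _; rewrite -big_split.
by apply: eq_bigr => j _; rewrite rmorphD mulrDl.
Qed.

Lemma cubtpD (g g' : 'I_n.+1 -> 'I_n.+1 -> 'I_n.+1 -> k) :
  cubtp (fun i j l => g i j l + g' i j l) = cubtp g + cubtp g'.
Proof.
rewrite /cubtp /cubt -big_split; apply: eq_bigr => i _; rewrite -big_split.
apply: eq_bigr => j _; rewrite -big_split; apply: eq_bigr => l _; by rewrite rmorphD mulrDl.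
Qed.

Lemma cubtpZ c (g : 'I_n.+1 -> 'I_n.+1 -> 'I_n.+1 -> k) :
  cubtp (fun i j l => c * g i j l) = c%:MP * cubtp g.
Proof.
rewrite /cubtp /cubt mulr_sumr; apply: eq_bigr => i _; rewrite mulr_sumr.
apply: eq_bigr => j _; rewrite mulr_sumr; apply: eq_bigr => l _; by rewrite rmorphM /=; ring.
Qed.

Lemma quadp_prod (m m' : 'I_n.+1 -> k) : quadp (fun i j => m i * m' j) = linp m * linp m'.
Proof.
rewrite /quadp /quad /linp /lin mulr_suml; apply: eq_bigr => i _; rewrite mulr_sumr.
by apply: eq_bigr => j _; rewrite rmorphM /= mulrACA.
Qed.

Lemma cubtp_prod (m m' m'' : 'I_n.+1 -> k) :
  cubtp (fun i j l => m i * m' j * m'' l) = linp m * linp m' * linp m''.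
Proof.
rewrite -quadp_prod /quadp /quad /cubtp /cubt mulr_suml; apply: eq_bigr => i _.
rewrite mulr_suml; apply: eq_bigr => j _; rewrite /linp /lin mulr_sumr.
by apply: eq_bigr => l _; rewrite !rmorphM /=; ring.
Qed.

Lemma cubtp_mixed (m : 'I_n.+1 -> k) (q : 'I_n.+1 -> 'I_n.+1 -> k) :
  cubtp (fun i j l => q i j * m l) = quadp q * linp m.
Proof.
rewrite /cubtp /cubt /quadp /quad mulr_suml; apply: eq_bigr => i _.
rewrite mulr_suml; apply: eq_bigr => j _; rewrite /linp /lin mulr_sumr.
by apply: eq_bigr => l _; rewrite !rmorphM /=; ring.
Qed.

Lemma cubtp_swap12 (g : 'I_n.+1 -> 'I_n.+1 -> 'I_n.+1 -> k) :
  cubtp g = cubtp (fun i j l => g j i l).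
Proof.
rewrite /cubtp /cubt exchange_big; apply: eq_bigr => i _; apply: eq_bigr => j _.
by apply: eq_bigr => l _; rewrite ['X_j * 'X_i]mulrC.
Qed.

Lemma cubtp_swap23 (g : 'I_n.+1 -> 'I_n.+1 -> 'I_n.+1 -> k) :
  cubtp g = cubtp (fun i j l => g i l j).
Proof.
rewrite /cubtp /cubt; apply: eq_bigr => i _; rewrite exchange_big; apply: eq_bigr => j _.
by apply: eq_bigr => l _; rewrite mulrAC.
Qed.

Lemma cubtp_sym3 (m : 'I_n.+1 -> k) (q : 'I_n.+1 -> 'I_n.+1 -> k) :
  cubtp (sym3 m q) = 3%:R * (linp m * quadp q).
Proof.
have e3 : cubtp (fun i j l => m l * q i j) = quadp q * linp m.
  by rewrite -cubtp_mixed; apply: cubtp_ext => i j l; rewrite mulrC.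
have e2 : cubtp (fun i j l => m j * q i l) = quadp q * linp m by rewrite cubtp_swap23.
have e1 : cubtp (fun i j l => m i * q j l) = quadp q * linp m by rewrite cubtp_swap12.
by rewrite /sym3 !cubtpD e1 e2 e3; ring.
Qed.

End Forms.

(** * The centers of the third and fourth blow-ups *)

Section HigherCenters.
Variables (k : closedFieldType) (n : nat).
Hypothesis two0 : (2%:R : k) != 0.
Hypothesis three0 : (3%:R : k) != 0.
Notation N0 := (cubic_dim k n).
Notation r := #|idx n|.
Notation psi0 := (psi0 k n).
Notation sg0 := (sg0 k n).
Notation sg1 := (sg1 k n).
Notation sg2 := (sg2 k n).
Notation sg3 := (sg3 k n).
Notation half := (2%:R^-1 : k).

Variable b0 : blowup (@V0 k n) B0.
Variable A0 : 'rV[{mpoly k[r]}]_(bl_size b0).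
Hypothesis hA0 : factors b0 (psubst sg0 psi0) (vs0 n) A0.
Notation psi1 := (segreR (psubst sg0 psi0) A0).
Variable b1 : blowup (blowup_variety b0) (B1 b0).
Variable A1 : 'rV[{mpoly k[r]}]_(bl_size b1).
Hypothesis hA1 : factors b1 (psubst sg1 psi1) (vs0 n) A1.
Notation psi2 := (segreR (psubst sg1 psi1) A1).

Section SetS0.
Variables (t : k) (x : 'rV[k]_r).
Notation xt := (set_coord (vs0 n) t x).
Lemma set_s0_s0 : xt 0 (vs0 n) = t. Proof. exact: set_coordE. Qed.
Lemma set_s0_s1 : xt 0 (vs1 n) = x 0 (vs1 n).
Proof. by rewrite set_coordN // (inj_eq enum_rank_inj). Qed.
Lemma set_s0_b i : xt 0 (vb i) = x 0 (vb i).
Proof. by rewrite set_coordN // (inj_eq enum_rank_inj). Qed.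
Lemma set_s0_m i : xt 0 (vm i) = x 0 (vm i).
Proof. by rewrite set_coordN // (inj_eq enum_rank_inj). Qed.
Lemma set_s0_q i j : xt 0 (vq i j) = x 0 (vq i j).
Proof. by rewrite set_coordN // (inj_eq enum_rank_inj). Qed.
Lemma set_s0_g i j l : xt 0 (vg i j l) = x 0 (vg i j l).
Proof. by rewrite set_coordN // (inj_eq enum_rank_inj). Qed.
End SetS0.
Definition set_s0E := (set_s0_s0, set_s0_s1, set_s0_b, set_s0_m, set_s0_q, set_s0_g).

Lemma pat_sub1 N (psi : 'rV[{mpoly k[r]}]_N) x : pat (psubst sg1 psi) x = pat psi (sub1 x).
Proof. by rewrite (evf_psubst idfun) (evf_sg1 idfun). Qed.
Lemma pat_sub2 N (psi : 'rV[{mpoly k[r]}]_N) x : pat (psubst sg2 psi) x = pat psi (sub2 half x).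
Proof. by rewrite (evf_psubst idfun) (evf_sg2 idfun). Qed.
Lemma pat_sub3 N (psi : 'rV[{mpoly k[r]}]_N) x : pat (psubst sg3 psi) x = pat psi (sub3 x).
Proof. by rewrite (evf_psubst idfun) (evf_sg3 idfun). Qed.

Lemma chart1_variety (x : 'rV[k]_r) : point_of (blowup_variety b0) (pat psi1 x).
Proof.
apply: (@point_of_limit _ _ _ _ _ (vs0 n)) => [|t t0]; first exact: closed_closure.
apply: (point_of_step hA0); first by rewrite set_coordE.
by have [->|?] := eqVneq (pat (psubst sg0 psi0) (set_coord (vs0 n) t x)) 0; [left|right].
Qed.

Lemma chart2_variety (x : 'rV[k]_r) : point_of (blowup_variety b1) (pat psi2 x).
Proof.
apply: (@point_of_limit _ _ _ _ _ (vs0 n)) => [|t t0]; first exact: closed_closure.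
apply: (point_of_step hA1); first by rewrite set_coordE.
rewrite pat_sub1; exact: chart1_variety.
Qed.

Lemma chart1_exceptional (x : 'rV[k]_r) : x 0 (vs0 n) = 0 -> point_of (exceptional b0) (pat psi1 x).
Proof.
move=> hs; have [->|h1] := chart1_variety x; first by left.
have := h1; rewrite (evf_segre idfun) pat_psi0; set p := cubc _ _ => h2.
have : point_of B0 p.
  apply: cube_point (linp_linear _) (cubc_cube _).
  by split=> *; rewrite mkpE hs mul0r.
case=> [p0|Bp]; first by left; rewrite p0 segreR0l.
by right; split=> //; exists p, (pat A0 x).
Qed.

(** The plane [s1 = 0] of the previous chart lies over the exceptional divisor;
    the plane [s0 = s1 = 0] is the limit of that set, and lies over [B_1]. *)
Lemma center2_point (x : 'rV[k]_r) : x 0 (vs0 n) = 0 -> x 0 (vs1 n) = 0 -> point_of (B2 b1) (pat psi2 x).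
Proof.
move=> h0 h1.
have : point_of (transform b1 (exceptional b0)) (pat psi2 x).
  apply: (@point_of_limit _ _ _ _ _ (vs0 n)) => [|t t0]; first exact: closed_closure.
  apply: (point_of_step hA1); first by rewrite set_coordE.
  rewrite pat_sub1; apply: chart1_exceptional.
  by rewrite mkpE !set_s0E h1 mulr0.
case=> [->|E1]; first by left.
have : point_of (exceptional b1) (pat psi2 x).
  have [->|V2] := chart2_variety x; first by left.
  have : point_of (B1 b0) (pat psi1 (sub1 x)).
    by apply: (center1_point three0 hA0) => *; rewrite mkpE h0 mul0r.
  have e : pat psi2 x = segreR (pat psi1 (sub1 x)) (pat A1 x).
    by rewrite (evf_segre idfun) pat_sub1.
  case=> [p0|Bp]; first by left; rewrite e p0 segreR0l.
  by right; split=> //; exists (pat psi1 (sub1 x)), (pat A1 x).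
by case=> [->|E2]; [left|right].
Qed.

Variable b2 : blowup (blowup_variety b1) (B2 b1).
Variable A2 : 'rV[{mpoly k[r]}]_(bl_size b2).
Hypothesis hA2 : factors b2 (psubst sg2 psi2) (vs0 n) A2.
Notation psi3 := (segreR (psubst sg2 psi2) A2).

(** Over [s0 <> 0] the chart of [V_3] meets no exceptional divisor. *)
Lemma chart3_transform (Z : pset k N0) (x : 'rV[k]_r) : x 0 (vs0 n) != 0 ->
  point_of Z (cubc idfun (sub0 (sub1 (sub2 half x)))) ->
  point_of (transform b2 (transform b1 (transform b0 Z))) (pat psi3 x).
Proof.
move=> hs hZ; apply: (point_of_step hA2) => //.
rewrite pat_sub2; apply: (point_of_step hA1); first by rewrite !mkpE.
rewrite pat_sub1; apply: (point_of_step hA0); first by rewrite !mkpE mulf_neq0.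
by rewrite pat_psi0.
Qed.

Lemma S0_point (y : 'rV[k]_N0) (X M : {mpoly k[n.+1]}) : linear_form X -> linear_form M ->
  cubic_of y = X * M ^+ 2 -> point_of S0 y.
Proof.
move=> hX hM e; have [y0|y0] := eqVneq y 0; [by left|right].
have : X * M ^+ 2 != 0 by rewrite -e cubic_of0.
rewrite mulf_eq0 negb_or expf_eq0 /= => /andP [X0 M0].
by exists X, M; split=> //; exists 1; rewrite ?oner_eq0 // scale1r.
Qed.

Lemma cubic_chart3 (x : 'rV[k]_r) : cubic_of (cubc idfun (sub0 (sub1 (sub2 half x)))) =
  let s := (x 0 (vs0 n))%:MP in let v := 1 + (x 0 (vs1 n))%:MP in
  let X := linp (fun i => x 0 (vb i)) in let M := s * linp (fun i => x 0 (vm i)) in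
  let Q := quadp (fun i j => x 0 (vq i j)) in let G := cubtp (fun i j l => x 0 (vg i j l)) in
  X ^+ 3 - 3%:R * (v * (M ^+ 2 + s ^+ 2 * Q)) * X
   + v * (2%:R * M ^+ 3 + 3%:R * s ^+ 2 * M * Q + 2%:R * s ^+ 3 * G).
Proof.
pose s' := x 0 (vs0 n); pose v' := 1 + x 0 (vs1 n).
pose L := linp (fun i => x 0 (vm i)); pose X := linp (fun i => x 0 (vb i)).
pose Q := quadp (fun i j => x 0 (vq i j)); pose G := cubtp (fun i j l => x 0 (vg i j l)).
rewrite [RHS]/=.
rewrite cubic_of_tcub (linp_ext (m' := fun i => x 0 (vb i))); last by move=> i; rewrite !mkpE.
rewrite (quadp_ext (q' := fun i j => (s' * s' * v') *
    (x 0 (vm i) * x 0 (vm j) + x 0 (vq i j)))); last first.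
  by move=> i j; rewrite !mkpE mulrA.
rewrite (cubtp_ext (g' := fun i j l => (s' * s' * s' * v') *
    (x 0 (vm i) * x 0 (vm j) * x 0 (vm l) +
     half * sym3 (fun i => x 0 (vm i)) (fun i j => x 0 (vq i j)) i j l + x 0 (vg i j l)))); last first.
  by move=> i j l; rewrite !mkpE !mulrA.
rewrite quadpZ quadpD quadp_prod cubtpZ !cubtpD cubtp_prod cubtpZ cubtp_sym3.
rewrite -/X -/Q -/G -/L -/s' !rmorphM /v' rmorphD rmorph1 /=.
have -> : half%:MP * (3%:R * (L * Q)) = half%:MP * 3%:R * L * Q by ring.
have h2 : 2%:R * half%:MP = 1 :> {mpoly k[n.+1]}.
  by rewrite -mpolyC_nat -mpolyCM mulfV.
move: (half%:MP) h2 (s'%:MP) ((x 0 (vs1 n))%:MP) => h h2 S V.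
have -> : 2%:R * (S * S * S * (1 + V) * (L * L * L + h * 3%:R * L * Q + G)) =
  2%:R * (S * S * S * (1 + V) * (L * L * L + G)) + (2%:R * h) * (S * S * S * (1 + V) * (3%:R * L * Q)) by ring.
by rewrite h2; ring.
Qed.

(** For [s0 <> 0] the cubic is [(X + 2 M)(X - M)^2] with [M] equal to [s0] times
    the linear form [m]. *)
Lemma center3_point (x : 'rV[k]_r) : x 0 (vs1 n) = 0 -> (forall i j, x 0 (vq i j) = 0) ->
  (forall i j l, x 0 (vg i j l) = 0) -> point_of (B3 b2) (pat psi3 x).
Proof.
move=> h1 hq hg.
apply: (@point_of_limit _ _ _ _ _ (vs0 n)) => [|t t0]; first exact: closed_closure.
apply: chart3_transform; first by rewrite set_coordE.
pose X := linp (fun i => x 0 (vb i)); pose M := t%:MP * linp (fun i => x 0 (vm i)).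
have hM : linear_form M by apply: dhomogMC; exact: linp_linear.
apply: (@S0_point _ (X + 2%:R * M) (X - M)).
- by apply: rpredD; [exact: linp_linear|rewrite -mpolyC_nat; apply: dhomogMC].
- by apply: rpredB; first exact: linp_linear.
rewrite cubic_chart3 /= !set_s0E h1.
rewrite quadp0; last by move=> i j; rewrite set_s0E.
rewrite cubtp0; last by move=> i j l; rewrite set_s0E.
rewrite (@linp_ext _ _ (fun i => set_coord (vs0 n) t x 0 (vb i)) (fun i => x 0 (vb i))); last first.
  by move=> i; rewrite set_s0E.
rewrite (@linp_ext _ _ (fun i => set_coord (vs0 n) t x 0 (vm i)) (fun i => x 0 (vm i))); last first.
  by move=> i; rewrite set_s0E.
rewrite -/X -/M mpolyC0; ring.
Qed.

End HigherCenters.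

(** * The center of the fifth blow-up *)

Lemma cubic_disc_double_root (k : comNzRingType) (a b c d : k) : 
  let p := (a *: 'X + b%:P) ^+ 2 * (c *: 'X + d%:P) in
  [/\ p`_3 = a ^+ 2 * c, p`_2 = a ^+ 2 * d + 2%:R * a * b * c,
      p`_1 = 2%:R * a * b * d + b ^+ 2 * c & p`_0 = b ^+ 2 * d].
Proof.
move=> p; have -> : p = (a ^+ 2 * c)%:P * 'X^3 + (a ^+ 2 * d + 2%:R * a * b * c)%:P * 'X^2
   + (2%:R * a * b * d + b ^+ 2 * c)%:P * 'X + (b ^+ 2 * d)%:P.
  by rewrite /p -!mul_polyC !(rmorphD, rmorphM, rmorphXn, rmorph_nat) /=; ring.
by rewrite !coefD !coefCM !coefXn !coefX !coefC /=; split; ring.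
Qed.

Section Lines.
Variables (k : closedFieldType) (n : nat).
Variable ell : 'M[k]_(2, n.+1).

Lemma restrictE (f : {mpoly k[n.+1]}) : restrict_to_line ell f =
  pev (@polyC k) (\row_i (ell 0 i *: 'X + (ell 1 i)%:P)) f.
Proof.
rewrite /restrict_to_line /pev /mmap; apply: eq_bigr => m _; congr (_ * _).
by apply: mmap1_eq => i; rewrite mxE.
Qed.

Lemma restrict_horner f t : (restrict_to_line ell f).[t] =
  pev idfun (t *: row 0 ell + row 1 ell) f.
Proof.
rewrite restrictE horner_pev; congr pev; apply/rowP => i.
by rewrite !mxE /horner_eval !hornerE mulrC.
Qed.

Lemma restrict_linp (b : 'I_n.+1 -> k) : restrict_to_line ell (linp b) =
  lin b (ell 0) *: 'X + (lin b (ell 1))%:P.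
Proof.
apply/eqP; rewrite -subr_eq0; apply/eqP/closed_poly0 => t.
rewrite hornerD hornerN restrict_horner pev_linp !hornerE.
rewrite /lin mulr_suml -big_split -sumrB big1 // => i _.
by rewrite !mxE /=; ring.
Qed.

Lemma restrictM f g : restrict_to_line ell (f * g) = restrict_to_line ell f * restrict_to_line ell g.
Proof. by rewrite !restrictE rmorphM. Qed.
Lemma restrictD f g : restrict_to_line ell (f + g) = restrict_to_line ell f + restrict_to_line ell g.
Proof. by rewrite !restrictE rmorphD. Qed.
Lemma restrictC c : restrict_to_line ell c%:MP = c%:P.
Proof. by rewrite restrictE pevC. Qed.

Definition wedge (b m : 'I_n.+1 -> k) := lin b (ell 0) * lin m (ell 1) - lin b (ell 1) * lin m (ell 0).

(** The points of the line are combinations of the basis dual to the two linear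
    forms. *)
Lemma restrict_quadp (l m : 'I_n.+1 -> k) (q : 'I_n.+1 -> 'I_n.+1 -> k) : wedge l m != 0 ->
  exists A B C, restrict_to_line ell (quadp q) =
    restrict_to_line ell (A%:MP * linp l ^+ 2 + B%:MP * linp l * linp m + C%:MP * linp m ^+ 2).
Proof.
move=> w0; pose de := (wedge l m)^-1.
pose ul i := de * (lin m (ell 1) * ell 0 i - lin m (ell 0) * ell 1 i).
pose um i := de * (lin l (ell 0) * ell 1 i - lin l (ell 1) * ell 0 i).
exists (quad q ul), (\sum_i \sum_j q i j * (ul i * um j + um i * ul j)), (quad q um).
apply/eqP; rewrite -subr_eq0; apply/eqP/closed_poly0 => t.
rewrite hornerD hornerN !restrict_horner pev_quadp !(rmorphD, rmorphM, rmorphXn) /= !pev_linp !pevC /=.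
pose w := t *: row 0 ell + row 1 ell; rewrite -/w; pose a := lin l (w 0); pose c := lin m (w 0).
have linw b : lin b (w 0) = t * lin b (ell 0) + lin b (ell 1).
  by rewrite /lin mulr_sumr -big_split; apply: eq_bigr => i _; rewrite !mxE /=; ring.
have ew i : w 0 i = a * ul i + c * um i.
  rewrite /a /c !linw /ul /um /de !mxE; move: w0; rewrite /wedge.
  move: (lin l (ell 0)) (lin l (ell 1)) (lin m (ell 0)) (lin m (ell 1)) => x1 x2 x3 x4 x0.
  by field.
apply/eqP; rewrite subr_eq0; apply/eqP.
transitivity (\sum_i \sum_j ((q i j * (ul i * ul j)) * a ^+ 2 +
   (q i j * (ul i * um j + um i * ul j)) * (a * c) + (q i j * (um i * um j)) * c ^+ 2)).
  by apply: eq_bigr => i _; apply: eq_bigr => j _; rewrite !ew; ring.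
rewrite -/a -/c; clearbody a c.
transitivity (quad q ul * a ^+ 2 + (\sum_i \sum_j q i j * (ul i * um j + um i * ul j)) * (a * c)
  + quad q um * c ^+ 2); last by ring.
rewrite /quad !mulr_suml -!big_split; apply: eq_bigr => i _ /=.
by rewrite !mulr_suml -!big_split.
Qed.

Lemma row_free_wedge : row_free ell -> exists b m, wedge b m != 0.
Proof.
move=> hf; apply: NNPP => no.
have minor i j : ell 0 i * ell 1 j - ell 1 i * ell 0 j = 0.
  apply/eqP/negPn/negP => h; apply: no.
  exists (fun l => (l == i)%:R), (fun l => (l == j)%:R).
  have e a c : lin (fun l => (l == c)%:R) (ell a) = ell a c.
    rewrite /lin (bigD1 c) //= eqxx mul1r big1 ?addr0 // => l /negbTE ->.
    by rewrite mul0r.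
  by rewrite /wedge !e.
have inj := row_free_inj hf.
have e0 : row 0 ell != 0.
  apply/eqP => h; have /eqP : (delta_mx 0 0 : 'rV[k]_2) = 0.
    by apply: inj; rewrite mul0mx -rowE.
  by move=> /eqP/rowP/(_ 0); rewrite !mxE !eqxx => /eqP; rewrite oner_eq0.
have /rV0Pn [i hi] := e0; rewrite mxE in hi.
have : (ell 0 i *: delta_mx 0 1 - ell 1 i *: delta_mx 0 0 : 'rV[k]_2) = 0.
  apply: inj; rewrite mul0mx mulmxBl -!scalemxAl -!rowE.
  by apply/rowP => j; rewrite !mxE minor.
move/rowP/(_ 1); rewrite !mxE !eqxx /= mulr1 mulr0 subr0 => h.
by rewrite h eqxx in hi.
Qed.

End Lines.

Section Center4.
Variables (k : closedFieldType) (n : nat).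
Hypothesis two0 : (2%:R : k) != 0.
Hypothesis three0 : (3%:R : k) != 0.
Notation N0 := (cubic_dim k n).
Notation r := #|idx n|.
Notation psi0 := (psi0 k n).
Notation sg0 := (sg0 k n).
Notation sg1 := (sg1 k n).
Notation sg2 := (sg2 k n).
Notation sg3 := (sg3 k n).
Notation half := (2%:R^-1 : k).

Variable b0 : blowup (@V0 k n) B0.
Variable A0 : 'rV[{mpoly k[r]}]_(bl_size b0).
Hypothesis hA0 : factors b0 (psubst sg0 psi0) (vs0 n) A0.
Notation psi1 := (segreR (psubst sg0 psi0) A0).
Variable b1 : blowup (blowup_variety b0) (B1 b0).
Variable A1 : 'rV[{mpoly k[r]}]_(bl_size b1).
Hypothesis hA1 : factors b1 (psubst sg1 psi1) (vs0 n) A1.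
Notation psi2 := (segreR (psubst sg1 psi1) A1).
Variable b2 : blowup (blowup_variety b1) (B2 b1).
Variable A2 : 'rV[{mpoly k[r]}]_(bl_size b2).
Hypothesis hA2 : factors b2 (psubst sg2 psi2) (vs0 n) A2.
Notation psi3 := (segreR (psubst sg2 psi2) A2).
Variable b3 : blowup (blowup_variety b2) (B3 b2).
Variable A3 : 'rV[{mpoly k[r]}]_(bl_size b3).
Hypothesis hA3 : factors b3 (psubst sg3 psi3) (vs2 n) A3.
Notation psi4 := (segreR (psubst sg3 psi3) A3).

Section OneLine.
Variable ell : 'M[k]_(2, n.+1).

Lemma line_point (y : 'rV[k]_N0) (m l : 'I_n.+1 -> k) :
  restrict_to_line ell (cubic_of y) = restrict_to_line ell (linp m ^+ 2 * linp l) ->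
  point_of (line_condition ell) y.
Proof.
move=> e; have [y0|y0] := eqVneq y 0; [by left|right; split=> //].
cbv zeta; rewrite e restrictM expr2 restrictM -expr2 !restrict_linp.
have [-> -> -> ->] := cubic_disc_double_root (lin m (ell 0)) (lin m (ell 1)) (lin l (ell 0)) (lin l (ell 1)).
by rewrite /cubic_disc; ring.
Qed.

(** An explicit arc of cubics tangent to the line whose lift to the chart
    of [V_4] tends to the given point of the center. *)
Lemma center4_good_line (x : 'rV[k]_r) : x 0 (vs2 n) = 0 -> x 0 (vs1 n) = 0 ->
  (forall i j l, x 0 (vg i j l) = 0) -> x 0 (vs0 n) != 0 ->
  wedge ell (fun i => x 0 (vb i)) (fun i => x 0 (vm i)) != 0 ->
  point_of (line_condition4 b3 ell) (pat psi4 x).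
Proof.
move=> h2 h1 hg hs hw.
pose s := x 0 (vs0 n).
pose la i := x 0 (vb i) + (2%:R * s) * x 0 (vm i).
pose mu i := x 0 (vb i) + (- s) * x 0 (vm i).
have linD (b m : 'I_n.+1 -> k) c u : lin (fun i => b i + c * m i) u = lin b u + c * lin m u.
  by rewrite /lin mulr_sumr -big_split; apply: eq_bigr => i _ /=; ring.
have w0 : wedge ell la mu != 0.
  have -> : wedge ell la mu = - 3%:R * s * wedge ell (fun i => x 0 (vb i)) (fun i => x 0 (vm i)).
    by rewrite /wedge !linD; ring.
  by rewrite !mulf_neq0 ?oppr_eq0.
have [A [B [C hQ]]] := restrict_quadp (fun i j => s ^+ 2 * x 0 (vq i j)) w0.
(* On the line the cubic with parameter e is to be
   (mu + e al la)^2 (la + e L); comparing with its expansion in the chart to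
   first order in e gives al and L from the restriction A la^2 + B la mu + C mu^2
   of the quadratic form, and the rest of the expansion gives the cubic g. *)
pose al := - (3%:R / 2%:R) * A.
pose L i := - 3%:R * B * la i + (- 3%:R * C) * mu i.
pose ka := (2%:R * s ^+ 3)^-1.
pose g i j l : {poly k} := 'X * (ka * (2%:R * al))%:P * (la i * mu j * L l)%:P +
   'X * (ka * al ^+ 2)%:P * (la i * la j * la l)%:P + 'X ^+ 2 * (ka * al ^+ 2)%:P * (la i * la j * L l)%:P.
pose xi : 'rV[{poly k}]_r := mkp (fun i => (x 0 (vb i))%:P) (fun i => (x 0 (vm i))%:P)
   (fun i j => (x 0 (vq i j))%:P) g s%:P 0 'X.
pose ge e i j l := e * (ka * (2%:R * al)) * (la i * mu j * L l) +
   e * (ka * al ^+ 2) * (la i * la j * la l) + e ^+ 2 * (ka * al ^+ 2) * (la i * la j * L l).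
have xiE e : map_mx (horner_eval e) xi = mkp (fun i => x 0 (vb i)) (fun i => x 0 (vm i))
   (fun i j => x 0 (vq i j)) (ge e) s 0 e.
  apply/rowP; elim/idx_ind => *; rewrite [LHS]mxE !mkpE /horner_eval ?hornerC ?hornerX //.
  by rewrite /g /ge !hornerE.
have xi0 : map_mx (horner_eval 0) xi = x.
  rewrite xiE; apply/rowP; elim/idx_ind => *; rewrite !mkpE ?h2 ?h1 ?hg //.
  by rewrite /ge expr0n /= !mul0r !addr0.
have X0 : 'X != 0 :> {poly k} by rewrite polyX_eq0.
rewrite -xi0.
apply: (point_of_density (@closed_closure _ _ _) X0 (xi := xi)) => e; rewrite hornerX => e0.
rewrite xiE; set c := mkp _ _ _ _ _ _ _.
apply: (point_of_step hA3); first by rewrite mkpE.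
rewrite pat_sub3; apply: (chart3_transform hA0 hA1 hA2); first by rewrite !mkpE.
pose Lp := linp la; pose Mp := linp mu; pose LL := linp L.
apply: (@line_point _ (fun i => mu i + (e * al) * la i) (fun i => la i + e * L i)).
rewrite (cubic_chart3 two0) /=.
have eb : linp (fun i => sub3 c 0 (vb i)) = linp (fun i => x 0 (vb i)).
  by apply: linp_ext => i; rewrite !mkpE.
have em : linp (fun i => sub3 c 0 (vm i)) = linp (fun i => x 0 (vm i)).
  by apply: linp_ext => i; rewrite !mkpE.
have eq : quadp (fun i j => sub3 c 0 (vq i j)) = e%:MP * quadp (fun i j => x 0 (vq i j)).
  by rewrite -quadpZ; apply: quadp_ext => i j; rewrite !mkpE.
have eg : (2%:R * s ^+ 3)%:MP * cubtp (fun i j l => sub3 c 0 (vg i j l)) =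
   (e ^+ 2)%:MP * (2%:R * al%:MP * Lp * Mp * LL + al%:MP ^+ 2 * Lp ^+ 3 + (e * al ^+ 2)%:MP * Lp ^+ 2 * LL).
  rewrite -cubtpZ (cubtp_ext (g' := fun i j l => (e ^+ 2 * (2%:R * al)) * (la i * mu j * L l) +
     (e ^+ 2 * al ^+ 2) * (la i * la j * la l) + (e ^+ 3 * al ^+ 2) * (la i * la j * L l))); last first.
    move=> i j l; rewrite !mkpE /ge /ka; field.
    by rewrite two0 hs.
  rewrite !cubtpD !cubtpZ !cubtp_prod -/Lp -/Mp -/LL !(rmorphM, rmorphXn) /= !mpolyC_nat; ring.
rewrite eb em eq !mkpE mulr0 mpolyC0 addr0.
set X := linp (fun i => x 0 (vb i)); set M := linp (fun i => x 0 (vm i)).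
set Q := quadp _.
have eL : Lp = X + (2%:R * s)%:MP * M.
  by rewrite /Lp (linp_ext (m' := fun i => x 0 (vb i) + (2%:R * s) * x 0 (vm i))) // linpD linpZ.
have eM : Mp = X - s%:MP * M.
  rewrite /Mp (linp_ext (m' := fun i => x 0 (vb i) + (- s) * x 0 (vm i))) // linpD linpZ.
  by rewrite mpolyCN mulNr.
have eLL : LL = - 3%:R * B%:MP * Lp - 3%:R * C%:MP * Mp.
  rewrite /LL (linp_ext (m' := fun i => (- 3%:R * B) * la i + (- 3%:R * C) * mu i)) // linpD !linpZ.
  rewrite -/Lp -/Mp !rmorphM !rmorphN /= !mpolyC_nat; ring.
have -> : linp (fun i => mu i + (e * al) * la i) = Mp + e%:MP * al%:MP * Lp.
  by rewrite linpD linpZ rmorphM.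
have -> : linp (fun i => la i + e * L i) = Lp + e%:MP * LL by rewrite linpD linpZ.
have hQ' : restrict_to_line ell (s%:MP ^+ 2 * Q) =
  restrict_to_line ell (A%:MP * Lp ^+ 2 + B%:MP * Lp * Mp + C%:MP * Mp ^+ 2).
  by rewrite -hQ quadpZ rmorphXn.
set G := cubtp _ in eg *.
have eX : X ^+ 3 - 3%:R * (1 * ((s%:MP * M) ^+ 2 + s%:MP ^+ 2 * (e%:MP * Q))) * X
   + 1 * (2%:R * (s%:MP * M) ^+ 3 + 3%:R * s%:MP ^+ 2 * (s%:MP * M) * (e%:MP * Q) + 2%:R * s%:MP ^+ 3 * G)
  = Mp ^+ 2 * Lp + (- (3%:R * e))%:MP * Mp * (s%:MP ^+ 2 * Q) + (2%:R * s ^+ 3)%:MP * G.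
  rewrite eM eL !(rmorphM, rmorphN, rmorphXn) /= !mpolyC_nat; ring.
rewrite eX eg !restrictD [restrict_to_line ell (_ * (s%:MP ^+ 2 * Q))]restrictM hQ' -restrictM -!restrictD.
congr restrict_to_line; rewrite eLL.
have hal : 2%:R * al%:MP = - 3%:R * A%:MP :> {mpoly k[n.+1]}.
  rewrite -mpolyC_nat -!mpolyCM -mpolyC_nat -mpolyCN -mpolyCM; congr mpolyC.
  by rewrite /al; field.
clearbody al; move: hal; rewrite !(rmorphM, rmorphN, rmorphXn) /= !mpolyC_nat.
move: (al%:MP) (A%:MP) (B%:MP) (C%:MP) (e%:MP) Lp Mp {hQ' eX eL eM eLL eg} => a A' B' C' E l m ha.
pose ll := - 3%:R * B' * l - 3%:R * C' * m.
transitivity (m ^+ 2 * l + E * (m ^+ 2 * ll + (- 3%:R * A') * l ^+ 2 * m) + E ^+ 2 *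
  (2%:R * a * l * m * ll + a ^+ 2 * l ^+ 3 + E * a ^+ 2 * l ^+ 2 * ll)).
  by rewrite /ll; ring.
by rewrite -ha /ll; ring.
Qed.

End OneLine.

(** By density it is enough to treat the points for which [b] and [m] restrict to
    coordinates on the given line and [s0] is not zero. *)
Lemma center4_point (x : 'rV[k]_r) : x 0 (vs2 n) = 0 -> x 0 (vs1 n) = 0 ->
  (forall i j l, x 0 (vg i j l) = 0) -> point_of (B4 b3) (pat psi4 x).
Proof.
move=> h2 h1 hg; have [->|p0] := eqVneq (pat psi4 x) 0; [by left|right] => ell hl.
suff : point_of (line_condition4 b3 ell) (pat psi4 x) by case=> // e; rewrite e eqxx in p0.
have [b [m w0]] := row_free_wedge hl.
pose bp i : {poly k} := (x 0 (vb i))%:P + 'X * (b i - x 0 (vb i))%:P.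
pose mp i : {poly k} := (x 0 (vm i))%:P + 'X * (m i - x 0 (vm i))%:P.
pose sp : {poly k} := (x 0 (vs0 n))%:P + 'X * (1 - x 0 (vs0 n))%:P.
pose xi : 'rV[{poly k}]_r := mkp bp mp (fun i j => (x 0 (vq i j))%:P) (fun i j l => 0) sp 0 0.
pose linq (c : 'I_n.+1 -> {poly k}) a := \sum_i c i * (ell a i)%:P.
pose N := sp * (linq bp 0 * linq mp 1 - linq bp 1 * linq mp 0).
have linqE c a t : (linq c a).[t] = lin (fun i => (c i).[t]) (ell a).
  by rewrite horner_sum; apply: eq_bigr => i _; rewrite hornerM hornerC.
have NE t : N.[t] = sp.[t] * wedge ell (fun i => (bp i).[t]) (fun i => (mp i).[t]).
  by rewrite /N hornerM; congr (_ * _); rewrite hornerD hornerN !hornerM !linqE.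
have N0 : N != 0.
  have at1 u v : (u%:P + 'X * (v - u)%:P : {poly k}).[1] = v.
    by rewrite hornerD hornerM hornerX !hornerC mul1r addrC subrK.
  apply/eqP => e; have := NE 1; rewrite e horner0 at1 mul1r => /esym/eqP.
  have lx c d a : (forall i, c i = d i) -> lin c (ell a) = lin d (ell a).
    by move=> h; apply: eq_bigr => i _; rewrite h.
  have e1 i : (bp i).[1] = b i by rewrite at1.
  have e2 i : (mp i).[1] = m i by rewrite at1.
  by rewrite /wedge !(lx _ _ _ e1) !(lx _ _ _ e2) (negbTE w0).
have xiE t : map_mx (horner_eval t) xi = mkp (fun i => (bp i).[t]) (fun i => (mp i).[t])
   (fun i j => x 0 (vq i j)) (fun i j l => 0) sp.[t] 0 0.
  by apply/rowP; elim/idx_ind => *; rewrite [LHS]mxE !mkpE /horner_eval ?hornerC.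
have xi0 : map_mx (horner_eval 0) xi = x.
  rewrite xiE; apply/rowP; elim/idx_ind => *; rewrite !mkpE ?h2 ?h1 ?hg //.
  - by rewrite !hornerE.
  - by rewrite !hornerE.
  - by rewrite !hornerE.
rewrite -xi0.
apply: (point_of_density (@closed_closure _ _ _) N0 (xi := xi)) => t; rewrite NE mulf_eq0 negb_or => /andP [s0 wt].
rewrite xiE; apply: center4_good_line; rewrite ?mkpE //.
  by move=> i j l; rewrite mkpE.
have lx c d a : (forall i, c i = d i) -> lin c (ell a) = lin d (ell a).
  by move=> h; apply: eq_bigr => i _; rewrite h.
move: wt; rewrite /wedge.
rewrite !(lx (fun i => mkp _ _ _ _ _ _ _ 0 (vb i)) (fun i => (bp i).[t])); try by move=> i; rewrite mkpE.
by rewrite !(lx (fun i => mkp _ _ _ _ _ _ _ 0 (vm i)) (fun i => (mp i).[t])) // => i; rewrite mkpE.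
Qed.

End Center4.

(** * Invariants of a cubic with respect to a point *)

Section Invariants.
Variables (k : closedFieldType) (n : nat).
Hypothesis two0 : (2%:R : k) != 0.
Hypothesis three0 : (3%:R : k) != 0.
Notation N0 := (cubic_dim k n).
Notation vec := 'rV[k]_n.+1.
Variable p0 : vec.

Definition Ah : {mpoly k[N0]} := tr p0 p0 p0.
Definition Bh u : {mpoly k[N0]} := tr p0 p0 u.
(** The coefficients of the cubic after completing the cube in the direction
    [p0], as in the tensor [tcub], multiplied by powers of the value [Ah] at
    [p0] that make them forms. *)
Definition Ph u v : {mpoly k[N0]} := Bh u * Bh v - Ah * tr p0 u v.
Definition Gh u v w : {mpoly k[N0]} := (2%:R^-1)%:MP *
  (Ah ^+ 2 * tr u v w - Bh u * Bh v * Bh w + Ph u v * Bh w + Ph u w * Bh v + Ph v w * Bh u).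

Lemma Ah_homog : Ah \is 1.-homog. Proof. exact: tr_homog. Qed.
Lemma Bh_homog u : Bh u \is 1.-homog. Proof. exact: tr_homog. Qed.
Lemma Ph_homog u v : Ph u v \is 2.-homog.
Proof. by apply: rpredB; rewrite -[2%N]/(1 + 1)%N; apply: dhomogM; exact: tr_homog. Qed.
Lemma Gh_homog u v w : Gh u v w \is 3.-homog.
Proof.
apply: dhomogMC; rewrite -[3%N]/(1 * 2 + 1)%N.
have hB := Bh_homog; have hP := Ph_homog.
have h2 : Ah ^+ 2 \is (1 * 2).-homog by apply: dhomogMn; exact: Ah_homog.
do 3!(apply: rpredD; last by apply: dhomogM).
apply: rpredB; first by apply: dhomogM => //; exact: tr_homog.
by apply: dhomogM => //; apply: (dhomogM (hB u) (hB v)).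
Qed.

Section Values.
Variables (A : comNzRingType) (phi : {rmorphism k -> A}) (x : 'rV[A]_N0).
Notation T u v w := (pev phi x (tr u v w)).
Lemma pev_Ph u v : pev phi x (Ph u v) = T p0 p0 u * T p0 p0 v - T p0 p0 p0 * T p0 u v.
Proof. by rewrite rmorphB !rmorphM. Qed.
Lemma pev_Gh u v w : pev phi x (Gh u v w) = phi 2%:R^-1 *
  (T p0 p0 p0 ^+ 2 * T u v w - T p0 p0 u * T p0 p0 v * T p0 p0 w
   + pev phi x (Ph u v) * T p0 p0 w + pev phi x (Ph u w) * T p0 p0 v + pev phi x (Ph v w) * T p0 p0 u).
Proof.
rewrite rmorphM /= pevC; congr (_ * _); rewrite 3!rmorphD rmorphB.
by congr (_ - _ + _ + _ + _); rewrite rmorphM // rmorphXn || rewrite rmorphM rmorphM.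
Qed.
End Values.

Lemma tr_square (y : 'rV[k]_N0) c (l m : {mpoly k[n.+1]}) u v w :
  linear_form l -> linear_form m -> cubic_of y = c *: (l * m ^+ 2) ->
  let e f x := pev idfun x f in
  pev idfun y (tr u v w) = c / 3%:R *
    (e l u * e m v * e m w + e m u * e l v * e m w + e m u * e m v * e l w).
Proof.
move=> hl hm e e'; rewrite trE e polZ expr2 mulrA pol_prod // /e'.
by field; rewrite (six0 two0 three0) three0.
Qed.

(** The polarisations of a product of linear forms are explicit, and the invariants
    factor. *)
Lemma invariants_square (y : 'rV[k]_N0) c (l m : {mpoly k[n.+1]}) :
  linear_form l -> linear_form m -> cubic_of y = c *: (l * m ^+ 2) ->
  exists M : vec -> k,
   (forall u v, pev idfun y (Ph u v) = M u * M v) /\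
   (forall u v w, pev idfun y (Gh u v w) = M u * M v * M w) /\
   (forall u, M u = c / 3%:R * (pev idfun p0 m * (pev idfun u l * pev idfun p0 m - pev idfun p0 l * pev idfun u m))).
Proof.
move=> hl hm e.
exists (fun u => c / 3%:R * (pev idfun p0 m * (pev idfun u l * pev idfun p0 m - pev idfun p0 l * pev idfun u m))).
have T u v w := tr_square u v w hl hm e.
split; [|split=> //].
  by move=> u v; rewrite pev_Ph !T /=; field; rewrite three0.
by move=> u v w; rewrite pev_Gh !pev_Ph !T /=; field; rewrite three0 two0.
Qed.

Lemma Ph_B0 u v : vanishes B0 (Ph u v).
Proof.
move=> y [l [[hl _] [c c0 e]]]; have [M [hP [_ hM]]] := invariants_square hl hl e.
by rewrite pev_id hP !hM; ring.
Qed.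

Lemma Gh_B0 u v w : vanishes B0 (Gh u v w).
Proof.
move=> y [l [[hl _] [c c0 e]]]; have [M [_ [hG hM]]] := invariants_square hl hl e.
by rewrite pev_id hG !hM; ring.
Qed.

Definition dform N (x v : 'rV[k]_N) (g : {mpoly k[N]}) := \sum_i v 0 i * pev idfun x g^`M(i).

Lemma dformM N (x v : 'rV[k]_N) f g :
  dform x v (f * g) = dform x v f * pev idfun x g + pev idfun x f * dform x v g.
Proof.
rewrite /dform mulr_suml mulr_sumr -big_split; apply: eq_bigr => i _ /=.
by rewrite mderivM rmorphD !rmorphM /=; ring.
Qed.
Lemma dformD N (x v : 'rV[k]_N) f g : dform x v (f + g) = dform x v f + dform x v g.
Proof. by rewrite /dform -big_split; apply: eq_bigr => i _; rewrite linearD rmorphD mulrDr. Qed.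
Lemma dformN N (x v : 'rV[k]_N) f : dform x v (- f) = - dform x v f.
Proof. by rewrite /dform -sumrN; apply: eq_bigr => i _; rewrite linearN rmorphN mulrN. Qed.
Lemma dformC N (x v : 'rV[k]_N) c : dform x v c%:MP = 0.
Proof. by rewrite /dform big1 // => i _; rewrite mderivC rmorph0 mulr0. Qed.
Lemma dform_sum N (x v : 'rV[k]_N) (I : Type) (r : seq I) (F : I -> {mpoly k[N]}) :
  dform x v (\sum_(i <- r) F i) = \sum_(i <- r) dform x v (F i).
Proof.
elim/big_ind2: _ => [|f a g b <- <-|//]; last by rewrite dformD.
by rewrite -(mpolyC0 N k) dformC.
Qed.

Lemma dform_tr (x v : 'rV[k]_N0) u1 u2 u3 : dform x v (tr u1 u2 u3) = pev idfun v (tr u1 u2 u3).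
Proof.
rewrite pev_tr /tr dform_sum; apply: eq_bigr => a _.
rewrite -mul_mpolyC dformM dformC mul0r add0r pevC; congr (_ * _).
rewrite /dform (bigD1 a) //= big1 ?addr0 => [|i ni].
  rewrite mderivX mnm1E eqxx scale1r.
  have -> : (U_(a) - U_(a))%MM = 0%MM :> 'X_{1..N0} by apply/mnmP => l; rewrite mnmBE mnm0E subnn.
  by rewrite mpolyX0 rmorph1 mulr1.
by rewrite mderivX mnm1E eq_sym (negbTE ni) scale0r rmorph0 mulr0.
Qed.

Lemma quadratic_polar (q : {mpoly k[n.+1]}) u v w : q \is 2.-homog ->
  pev idfun (u + v + w) q = pev idfun (u + v) q + pev idfun (u + w) q + pev idfun (v + w) q
   - pev idfun u q - pev idfun v q - pev idfun w q /\ pev idfun (u + u) q = 4%:R * pev idfun u q.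
Proof.
move=> hq; split; last first.
  by rewrite -mulr2n -scaler_nat (pev_homog _ _ _ hq) -natrX.
move: q hq; suff H : forall m : 'X_{1..n.+1}, mdeg m = 2%N -> exists i j, 'X_[m] = 'X_i * 'X_j :> {mpoly k[n.+1]}.
  move=> q /dhomogP hq; rewrite [q]mpolyE big_seq.
  elim/big_ind: _ => [|f g hf hg|m /hq hm].
  - by rewrite !rmorph0; ring.
  - by rewrite !rmorphD /= hf hg; ring.
  have [i [j ->]] := H _ hm.
  by rewrite -!mul_mpolyC !rmorphM /= !pevC !pevX !mxE /=; ring.
move=> m /mnm_pick [i [m1 [-> /mnm_pick [j [m2 [-> h]]]]]].
have -> : m2 = 0%MM by apply/eqP; rewrite -mdeg_eq0 h.
by exists i, j; rewrite !mpolyXD mpolyX0 mulr1.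
Qed.

Lemma tr_linear_quadratic (v : 'rV[k]_N0) (l q : {mpoly k[n.+1]}) u1 u2 u3 :
  linear_form l -> q \is 2.-homog -> cubic_of v = l * q ->
  let Q a b := pev idfun (a + b) q - pev idfun a q - pev idfun b q in
  let e x := pev idfun x l in
  pev idfun v (tr u1 u2 u3) = 6%:R^-1 * (e u1 * Q u2 u3 + e u2 * Q u1 u3 + e u3 * Q u1 u2).
Proof.
move=> hl hq ev Q e; rewrite trE ev /pol !rmorphM /= !(linear_formD _ _ hl) (quadratic_polar u1 u2 u3 hq).1.
by rewrite /Q /e; ring.
Qed.

(** Completing the cube in [l (l^2 + t q)] moves [l] by a term of order [t]; where
    the new linear form vanishes, [l] is of order [t] and the cubic of order
    [t^2]. *)
Lemma dform_Gh (x v : 'rV[k]_N0) (l q : {mpoly k[n.+1]}) u1 u2 u3 :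
  linear_form l -> q \is 2.-homog -> cubic_of x = l ^+ 3 -> cubic_of v = l * q ->
  dform x v (Gh u1 u2 u3) = 0.
Proof.
move=> hl hq ex ev.
have dP a b : dform x v (Ph a b) = pev idfun v (tr p0 p0 a) * pev idfun x (tr p0 p0 b)
   + pev idfun x (tr p0 p0 a) * pev idfun v (tr p0 p0 b)
   - (pev idfun v (tr p0 p0 p0) * pev idfun x (tr p0 a b) + pev idfun x (tr p0 p0 p0) * pev idfun v (tr p0 a b)).
  by rewrite /Ph dformD dformN !dformM !dform_tr.
rewrite /Gh dformM dformC mul0r add0r pevC; rewrite !dformD dformN !dformM !dP !dform_tr.
rewrite !pev_Ph.
have ex' : cubic_of x = 1 *: (l * l ^+ 2) by rewrite scale1r ex; ring.
have T a b c := tr_square a b c hl hl ex'.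
have V a b c := tr_linear_quadratic a b c hl hq ev.
rewrite !rmorphM /= !T !V /=.
by field; rewrite three0 two0 (six0 two0 three0).
Qed.

End Invariants.

(** * The invariants on lines and along the locus of cubics with a double hyperplane *)

Section Invariants2.
Variables (k : closedFieldType) (n : nat).
Hypothesis two0 : (2%:R : k) != 0.
Hypothesis three0 : (3%:R : k) != 0.
Notation N0 := (cubic_dim k n).
Notation vec := 'rV[k]_n.+1.
Variable p0 : vec.
Hypothesis p00 : p0 != 0.
Notation Ah := (Ah p0).
Notation Ph := (Ph p0).
Notation Gh := (Gh p0).

Definition line_to (p : vec) : 'M[k]_(2, n.+1) := \matrix_(i, j) (if i == 0 then p0 0 j else p 0 j).

Lemma line_to_free p : row_free (line_to p) \/ exists c, p = c *: p0.
Proof.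
case: (boolP (row_free (line_to p))) => h; [by left|right].
move: h; rewrite -kermx_eq0 => /rowV0Pn [v /sub_kermxP hv v0].
have e j : v 0 0 * p0 0 j + v 0 1 * p 0 j = 0.
  have := congr1 (fun z : 'rV[k]_n.+1 => z 0 j) hv; rewrite !mxE.
  by rewrite big_ord_recl big_ord1 !mxE /= (_ : lift 0 0 = 1) //; apply: val_inj.
have v10 : v 0 1 != 0.
  apply: contraNneq p00 => v1; apply/eqP/rowP => j; rewrite mxE.
  have := e j; rewrite v1 mul0r addr0 => /eqP; rewrite mulf_eq0 => /orP [/eqP v00|/eqP //].
  case/eqP: v0; apply/rowP => i; rewrite mxE.
  by have /orP[/eqP->|/eqP->] : (i == 0) || (i == 1) by case: i => [[|[|]]].
exists (- v 0 0 / v 0 1); apply/rowP => j; rewrite mxE.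
apply: (mulfI v10); rewrite mulrA [v 0 1 * (_ / _)]mulrC divfK // mulNr.
by apply/eqP; rewrite -addr_eq0 addrC e.
Qed.

Lemma restrict_cubic (y : 'rV[k]_N0) p : let T u v w := pol (cubic_of y) u v w in
  let f := restrict_to_line (line_to p) (cubic_of y) in
  [/\ f`_3 = T p0 p0 p0, f`_2 = 3%:R * T p0 p0 p, f`_1 = 3%:R * T p0 p p & f`_0 = T p p p].
Proof.
move=> T f; have -> : f = (T p0 p0 p0)%:P * 'X^3 + (3%:R * T p0 p0 p)%:P * 'X^2
   + (3%:R * T p0 p p)%:P * 'X + (T p p p)%:P.
  apply/eqP; rewrite -subr_eq0; apply/eqP/closed_poly0 => t.
  rewrite hornerD hornerN restrict_horner.
  have -> : t *: row 0 (line_to p) + row 1 (line_to p) = t *: p0 + p.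
    by apply/rowP => j; rewrite !mxE.
  have hc := cubic_of_homog y.
  rewrite -pol_diag // !(hornerD, hornerM, hornerC, hornerX, hornerXn) -/(T _ _ _).
  have L := fun u v w w' c => @pol_linear k n (cubic_of y) c u v w w' hc.
  rewrite /T L ![pol _ _ (t *: p0 + p) _]pol_symm !L ![pol _ _ _ (t *: p0 + p)]pol_symr
    ![pol _ _ (t *: p0 + p) _]pol_symm !L.
  rewrite [pol _ p p0 p0]pol_symm [pol _ p0 p p0]pol_symr [pol _ p p0 p]pol_symm [pol _ p p p0]pol_symr [pol _ p p0 p]pol_symm.
  ring.
by rewrite !coefD !coefCM !coefXn !coefX !coefC /=; split; ring.
Qed.

(** The discriminant of the restriction, multiplied by the square of the value at
    [p0], is [108 (P^3 - G^2)] in the unnormalised invariants. *)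
Lemma disc_line_condition p : 
  vanishes (line_condition (line_to p)) (Ph p p ^+ 3 - Gh p p p ^+ 2).
Proof.
move=> y [y0]; cbv zeta; have [-> -> -> ->] := restrict_cubic y p.
rewrite /cubic_disc pev_id rmorphB !rmorphXn /= pev_Gh !pev_Ph /= !trE.
move: (pol _ p0 p0 p0) (pol _ p0 p0 p) (pol _ p0 p p) (pol _ p p p) => a b c d e.
have h : (108%:R : k) != 0.
  by rewrite (natrM k 4 27) (natrM k 2 2) (natrM k 3 9) (natrM k 3 3) !mulf_neq0.
apply: (mulfI h); rewrite mulr0 -[RHS](mulr0 (a ^+ 2)) -[X in _ = _ * X]e.
by field.
Qed.

(** The square factor of the cubic stays one on the line. *)
Lemma S0_line_condition (ell : 'M[k]_(2, n.+1)) y : S0 y -> line_condition ell y.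
Proof.
move=> [l [m [[hl l0] [hm m0] [c c0 e]]]]; split.
  apply/eqP => y0; move/eqP: e; rewrite y0 (_ : cubic_of 0 = 0); last by apply/eqP; rewrite cubic_of0.
  rewrite eq_sym scaler_eq0 (negbTE c0) /= mulf_eq0 (negbTE l0) expf_eq0 (negbTE m0) //.
have lin1 (f : {mpoly k[n.+1]}) : linear_form f -> exists b, f = linp b.
  move=> /dhomogP hf; exists (fun i => f@_(U_(i))).
  apply/mpolyP => mm; rewrite /linp /lin raddf_sum /=.
  case: (boolP (mdeg mm == 1%N)) => [/eqP/mnm_pick [i [m' [-> /eqP]]]|hmm].
    rewrite mdeg_eq0 => /eqP ->; rewrite addm0 (bigD1 i) //= big1 ?addr0.
      by rewrite mcoeffCM mcoeffX eqxx mulr1.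
    by move=> j nj; rewrite mcoeffCM mcoeffX eq_mnm1 (negbTE nj) mulr0.
  rewrite memN_msupp_eq0; last by apply: contra hmm => /hf h; apply/eqP; exact: h.
  rewrite big1 // => j _; rewrite mcoeffCM mcoeffX; case: eqP => [ej|_]; last by rewrite mulr0.
  by rewrite -ej mdeg1 in hmm.
have [bl el] := lin1 _ hl; have [bm em] := lin1 _ hm.
cbv zeta; rewrite e -mul_mpolyC restrictM restrictC restrictM expr2 restrictM -expr2 el em !restrict_linp.
rewrite [_ * (_ ^+ 2)]mulrC mulrCA.
have -> : c%:P * (lin bl (ell 0) *: 'X + (lin bl (ell 1))%:P) =
  (c * lin bl (ell 0)) *: 'X + (c * lin bl (ell 1))%:P.
  by rewrite -!mul_polyC !rmorphM mulrDr mulrA.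
have [-> -> -> ->] := cubic_disc_double_root (lin bm (ell 0)) (lin bm (ell 1)) (c * lin bl (ell 0)) (c * lin bl (ell 1)).
by rewrite /cubic_disc; ring.
Qed.

Lemma separate p1 : (forall c, p1 <> c *: p0) -> exists l m : {mpoly k[n.+1]},
  [/\ linear_form l, linear_form m, pev idfun p0 l = 0, pev idfun p1 l != 0 & pev idfun p0 m != 0].
Proof.
move=> h; have /rV0Pn [i hi] := p00.
have [j hj] : exists j, p0 0 i * p1 0 j - p0 0 j * p1 0 i != 0.
  apply: NNPP => no; apply: (h (p1 0 i / p0 0 i)); apply/rowP => j; rewrite mxE.
  have : p0 0 i * p1 0 j - p0 0 j * p1 0 i = 0.
    by apply/eqP/negPn/negP => hj; apply: no; exists j.
  by move/eqP; rewrite subr_eq0 => /eqP e; apply: (mulfI hi); rewrite e; field.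
exists ((p0 0 i)%:MP * 'X_j - (p0 0 j)%:MP * 'X_i), 'X_i; split.
- by apply: rpredB; apply: dhomogMC; exact: dhomogX1.
- exact: dhomogX1.
- by rewrite rmorphB !rmorphM /= !pevC !pevX; apply/eqP; rewrite subr_eq0 mulrC.
- by rewrite rmorphB !rmorphM /= !pevC !pevX.
by rewrite pevX.
Qed.

(** [S0] is irreducible: the invariants at a point not proportional to [p0]
    are not zero divisors on it. *)
Lemma S0_cancel p1 e g i j : (forall c, p1 <> c *: p0) -> (0 < e)%N -> g \is e.-homog ->
  vanishes S0 (g * (Ph p1 p1 ^+ i * Gh p1 p1 p1 ^+ j)) -> vanishes S0 g.
Proof.
move=> hp e0 hg v y [l [m [[hl _] [hm _] [c c0 ey]]]].
have [L [M [hL hM L0 L1 M0]]] := separate hp.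
have h3 (f1 f2 f3 : {mpoly k[n.+1]}) : linear_form f1 -> linear_form f2 -> linear_form f3 ->
   f1 * f2 * f3 \is 3.-homog.
  by move=> *; rewrite -[3%N]/(1 + 1 + 1)%N; apply: dhomogM => //; apply: dhomogM.
have ex f : f \is 3.-homog -> exists z : 'rV[k]_N0, cubic_of z = f by move=> h; exists (co f); rewrite coK.
have [z0 ez0] := ex _ (h3 _ _ _ hl hm hm).
have [z1 ez1] : exists z : 'rV[k]_N0, cubic_of z = 2%:R * (l * m * M) + L * m * m.
  by apply: ex; rewrite -mpolyC_nat; apply: rpredD; [apply: dhomogMC|]; apply: h3.
have [z2 ez2] : exists z : 'rV[k]_N0, cubic_of z = l * M * M + 2%:R * (L * m * M).
  by apply: ex; rewrite -mpolyC_nat; apply: rpredD; [|apply: dhomogMC]; apply: h3.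
have [z3 ez3] := ex _ (h3 _ _ _ hL hM hM).
(* The arc (l + t L)(m + t M)^2 through the given point of S0.  It stays in S0,
   and the invariants do not vanish identically on it: their product is nonzero
   for general t because L separates p0 from p1 and M does not vanish at p0. *)
pose xi : 'rV[{poly k}]_N0 := \row_a ((z0 0 a)%:P + z1 0 a *: 'X + z2 0 a *: 'X^2 + z3 0 a *: 'X^3).
have xiE t : map_mx (horner_eval t) xi = z0 + t *: z1 + t ^+ 2 *: z2 + t ^+ 3 *: z3.
  by apply/rowP => a; rewrite !mxE /horner_eval !(hornerD, hornerC, hornerZ, hornerX, hornerXn); ring.
have cE t : cubic_of (map_mx (horner_eval t) xi) = (l + t%:MP * L) * (m + t%:MP * M) ^+ 2.
  rewrite xiE !cubic_ofD !cubic_ofZ ez0 ez1 ez2 ez3 -!mul_mpolyC !rmorphXn /=; ring.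
have lt t : linear_form (l + t%:MP * L) by apply: rpredD => //; exact: dhomogMC.
have mt t : linear_form (m + t%:MP * M) by apply: rpredD => //; exact: dhomogMC.
pose nn := Ph p1 p1 ^+ i * Gh p1 p1 p1 ^+ j.
have gn : pev (@polyC k) xi (g * nn) = 0.
  apply: closed_poly0 => t; rewrite horner_pev.
  have [y0|Sy] := S0_point (lt t) (mt t) (cE t).
    by rewrite y0 rmorphM /= (pev_homog0 _ e0 hg) mul0r.
  by rewrite -pev_id v.
have n0 : pev (@polyC k) xi nn != 0.
  pose lp q : {poly k} := (pev idfun q l)%:P + 'X * (pev idfun q L)%:P.
  pose mp q : {poly k} := (pev idfun q m)%:P + 'X * (pev idfun q M)%:P.
  pose Mt := mp p0 * (lp p1 * mp p0 - lp p0 * mp p1).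
  have lpE q t : (lp q).[t] = pev idfun q (l + t%:MP * L).
    by rewrite hornerD hornerM hornerX !hornerC rmorphD rmorphM /= pevC.
  have mpE q t : (mp q).[t] = pev idfun q (m + t%:MP * M).
    by rewrite hornerD hornerM hornerX !hornerC rmorphD rmorphM /= pevC.
  have Mt0 : Mt != 0.
    have c2 : (mp p0)`_1 = pev idfun p0 M.
      by rewrite coefD coefC coefXM coefC /= add0r.
    have d0 : lp p0 = (pev idfun p0 l)%:P by rewrite /lp L0 polyC0 mulr0 addr0.
    have m0' : mp p0 != 0 by apply: contraNneq M0 => e1; rewrite -c2 e1 coef0.
    rewrite mulf_neq0 //; apply: contraTneq L1 => e1.
    have : (lp p1 * mp p0 - lp p0 * mp p1)`_2 = 0 by rewrite e1 coef0.
    rewrite d0 coefB coefCM !coefM !big_ord_recr big_ord0 /= !subn0 !subnn.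
    rewrite /lp /mp !coefD !coefC !coefXM !coefC /= !(addr0, add0r, mulr0, mul0r, subr0) => /eqP.
    by rewrite mulf_eq0 (negbTE M0) orbF negbK.
  clearbody lp mp.
  have PM t : pev idfun (map_mx (horner_eval t) xi) (Ph p1 p1) = (3%:R^-1 * Mt.[t]) ^+ 2 /\
              pev idfun (map_mx (horner_eval t) xi) (Gh p1 p1 p1) = (3%:R^-1 * Mt.[t]) ^+ 3.
    have ce1 : cubic_of (map_mx (horner_eval t) xi) = 1 *: ((l + t%:MP * L) * (m + t%:MP * M) ^+ 2).
      by rewrite cE scale1r.
    have [Mf [hP [hG hMf]]] := invariants_square two0 three0 p0 (lt t) (mt t) ce1.
    have eM : 3%:R^-1 * Mt.[t] = Mf p1.
      rewrite hMf /Mt !(hornerM, hornerD, hornerN) !lpE !mpE mul1r; ring.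
    by rewrite eM hP hG; split; ring.
  have : (3%:R^-1 *: Mt) ^+ (2 * i + 3 * j) != 0.
    by rewrite expf_neq0 // scaler_eq0 negb_or invr_eq0 three0.
  apply: contraNneq => n0; apply/eqP/closed_poly0 => t; rewrite horner_exp hornerZ exprD !exprM.
  have [<- <-] := PM t; rewrite -!(rmorphXn (pev idfun _)) -rmorphM /= -/nn.
  by rewrite -horner_pev n0 horner0.
have /eqP : pev (@polyC k) xi g * pev (@polyC k) xi nn = 0 by rewrite -rmorphM.
rewrite mulf_eq0 (negbTE n0) orbF => /eqP g0.
have : pev idfun z0 g = 0.
  have := horner_pev xi g 0; rewrite g0 horner0 xiE !expr0n /= !scale0r !addr0 => <- //.
have -> : y = c *: z0.
  rewrite -[LHS]cubic_ofK -[RHS]cubic_ofK cubic_ofZ ez0 ey; congr (co (_ *: _)); ring.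
by rewrite pev_id (pev_homog _ _ _ hg) => ->; rewrite mulr0.
Qed.

(** The cubic [X^3 + 2 Y^3] in coordinates with [X = 1], [Y = 0] at [p0]. *)
Lemma generic_disc_neq0 : (0 < n)%N -> exists (p : vec) (y : 'rV[k]_N0),
  pev idfun y (Ph p p ^+ 3 - Gh p p p ^+ 2) != 0.
Proof.
move=> n0; have /rV0Pn [i hi] := p00.
have [j hj] : exists j : 'I_n.+1, j != i.
  have [e|e] := eqVneq i ord0; last by exists ord0; rewrite eq_sym.
  by exists ord_max; rewrite e -val_eqE /= -lt0n.
pose X : {mpoly k[n.+1]} := (p0 0 i)^-1%:MP * 'X_i.
pose Y : {mpoly k[n.+1]} := 'X_j - (p0 0 j)%:MP * X.
have hX : linear_form X by apply: dhomogMC; exact: dhomogX1.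
have hY : linear_form Y by apply: rpredB; [exact: dhomogX1|exact: dhomogMC].
pose p : vec := delta_mx 0 j.
have X0 : pev idfun p0 X = 1 by rewrite rmorphM /= pevC pevX mulVf.
have Xp : pev idfun p X = 0 by rewrite rmorphM /= pevX mxE eq_sym (negbTE hj) andbF mulr0.
have Y0 : pev idfun p0 Y = 0 by rewrite rmorphB rmorphM /= pevC pevX X0 mulr1 subrr.
have Yp : pev idfun p Y = 1 by rewrite rmorphB rmorphM /= pevX Xp mulr0 subr0 mxE !eqxx.
clearbody X Y; exists p, (co (X ^+ 3 + 2%:R * Y ^+ 3)).
have hc : X ^+ 3 + 2%:R * Y ^+ 3 \is 3.-homog.
  by rewrite -mpolyC_nat; apply: rpredD; last apply: dhomogMC; rewrite -[3%N]/(1 * 3)%N; exact: dhomogMn.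
have T u v w : pev idfun (co (X ^+ 3 + 2%:R * Y ^+ 3)) (tr u v w) =
   pev idfun u X * pev idfun v X * pev idfun w X + 2%:R * (pev idfun u Y * pev idfun v Y * pev idfun w Y).
  rewrite trE coK // polD -mpolyC_nat mul_mpolyC polZ !exprSr !expr0 !mul1r.
  rewrite (pol_prod u v w hX hX hX) (pol_prod u v w hY hY hY) /=. by field; rewrite (six0 two0 three0).
rewrite rmorphB !rmorphXn /= pev_Gh !pev_Ph !T X0 Xp Y0 Yp /=.
set u := _ - _; have -> : u = - 1 by rewrite /u; field.
by rewrite oppr_eq0 oner_eq0.
Qed.

End Invariants2.

(** * Vanishing on the second and fourth centers, and the place at a point *)

Arguments exc_eq {k K} io {N V B} b s i0 j0.

Section Normal.
Variables (k : closedFieldType) (K : fieldType) (io : {rmorphism k -> K}).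
Variable W : K -> k -> Prop.
Hypothesis plW : place io W.
Variables (N : nat) (V B : pset k N) (b : blowup V B).
Notation f := (bl_form b).
Notation d := (bl_deg b).
Variables (s : 'rV[K]_N) (y : 'rV[k]_N) (z : 'rV[k]_(bl_size b)).
Hypothesis gs : generic_point io V s.
Hypothesis cV : cone V.
Hypothesis Vy : V y.
Hypothesis sy : specialises W s y.
Hypothesis sz : specialises W (evf io f s) z.
Notation s' := (next_point io b s).
Notation y' := (segreR y z).
Variables (i0 : 'I_N) (j0 : 'I_(bl_size b)).
Hypothesis yi0 : y 0 i0 != 0.
Hypothesis zj0 : z 0 j0 != 0.
Hypothesis denseV : forall F : {mpoly k[N]}, vanishes V F -> F = 0.

(** Differentiate the relation between [h g] and the forms of the blow-up in the
    direction [v]: it shows that the numerator of the quotient vanishes at the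
    point of the exceptional divisor given by [v]. *)
Lemma regular_div_normal (Z' : pset k (N * bl_size b)) e (g h0 : {mpoly k[N]}) :
  g \is e.-homog -> h0 \is e.-homog -> pev idfun y h0 != 0 -> vanishes B g ->
  (forall t, Z' t -> exists x v, [/\ B x, dform x v g = 0 & same_point (normal_direction b x v) t]) ->
  regular io s' y' Z' (pev io s g / pev io s h0 / exc_eq io b s i0 j0).
Proof.
move=> hg hh0 h00 vg hZ.
have [m [h [D [a [hh hne ha eD hv]]]]] := generates_homog b cV Vy yi0 hg vg.
have rel := generic_relation plW gs sy yi0 hg hh ha eD hv.
have si0 : s 0 i0 != 0 by exact (spec_neq0 plW sy yi0).
have fj0 : pev io s (f j0) != 0 by have := spec_neq0 plW sz zj0; rewrite mxE.
have hs0 := spec_pev_neq0 plW sy hh hne; have h0s0 := spec_pev_neq0 plW sy hh0 h00.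
have hX : ('X_i0 ^+ d : {mpoly k[N]}) \is d.-homog.
  by rewrite -[X in X.-homog]mul1n; apply: dhomogMn; exact: dhomogX1.
pose num := \sum_j lift_form j0 (a j * 'X_i0 ^+ d) * 'X_(mxvec_index i0 j).
pose den := lift_form j0 (h * h0) * 'X_(mxvec_index i0 j0).
have hlift j : lift_form j0 (a j * 'X_i0 ^+ d) \is (D + d).-homog.
  by apply: lift_form_homog; apply: dhomogM.
have hden : lift_form j0 (h * h0) \is (D + d).-homog.
  by rewrite eD; apply: lift_form_homog; apply: dhomogM.
exists (D + d + 1)%N, num, den; split.
- by apply: rpred_sum => j _; apply: dhomogM => //; exact: dhomogX1.
- by apply: dhomogM => //; exact: dhomogX1.
- rewrite rmorphM /= pevX segreRE (@pev_lift_form _ _ idfun _ _ _ _ _ (D + d)); last by rewrite eD; apply: dhomogM.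
  by rewrite rmorphM !mulf_neq0 ?expf_neq0.
- move=> t /hZ [x [v [Bx dg [c _ ->]]]]; rewrite pev_id (pev_homog idfun c _ (e := D + d + 1)); last first.
    by apply: rpred_sum => j _; apply: dhomogM => //; exact: dhomogX1.
  suff -> : pev idfun (normal_direction b x v) num = 0 by rewrite mulr0.
  have rel0 := denseV hv; move/eqP: rel0; rewrite subr_eq0 => /eqP rel0.
  have key : \sum_j pev idfun x (a j) * diff_forms f x v 0 j = 0.
    have := congr1 (dform x v) rel0; rewrite dformM dg mulr0 addr0 -[pev idfun x g]pev_id vg // mulr0.
    rewrite dform_sum => e1; rewrite [RHS]e1; apply: eq_bigr => j _.
    by rewrite dformM -[pev idfun x (f j)]pev_id (bl_vanishes (b := b)) // mulr0 add0r mxE.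
  rewrite rmorph_sum /= (eq_bigr (fun j => (diff_forms f x v 0 j0 ^+ (D + d) * x 0 i0 ^+ d.+1) *
     (pev idfun x (a j) * diff_forms f x v 0 j))); first by rewrite -mulr_sumr key mulr0.
  move=> j _; rewrite rmorphM /= pevX segreRE (@pev_lift_form _ _ idfun _ _ _ _ _ (D + d)); last exact: dhomogM.
  by rewrite rmorphM rmorphXn /= pevX exprS; move: (_ ^+ d) (_ ^+ (D + d)) => X Y; ring.
have es : pev io s' den = pev io s (f j0) ^+ (D + d) * (pev io s h * pev io s h0) * (s 0 i0 * pev io s (f j0)).
  rewrite rmorphM /= pevX segreRE (@pev_lift_form _ _ io _ _ _ _ _ (D + d)); last by rewrite eD; apply: dhomogM.
  by rewrite rmorphM mxE.
have en : pev io s' num = pev io s (f j0) ^+ (D + d) * s 0 i0 ^+ d.+1 * (pev io s h * pev io s g).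
  rewrite rel rmorph_sum mulr_sumr; apply: eq_bigr => j _.
  rewrite rmorphM /= pevX segreRE (@pev_lift_form _ _ io _ _ _ _ _ (D + d)); last exact: dhomogM.
  by rewrite rmorphM rmorphXn /= pevX !mxE exprS; move: (_ ^+ d) (_ ^+ (D + d)) => X Y; ring.
rewrite es en /exc_eq exprS.
have := expf_neq0 (D + d) fj0; have := expf_neq0 d si0.
move: (pev io s (f j0) ^+ (D + d)) (s 0 i0 ^+ d) => X Y Y0 X0.
by field; rewrite X0 Y0 hs0 h0s0 fj0 si0.
Qed.

End Normal.

Section GenericPlace.
Variables (k : closedFieldType) (K : fieldType) (io : {rmorphism k -> K}).

(** The local ring of [V] at [y], with evaluation at [y], is dominated by a place. *)
Lemma generic_place N (V : pset k N) (s : 'rV[K]_N) y : generic_point io V s -> V y -> y != 0 ->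
  exists2 W, place io W & specialises W s y.
Proof.
move=> gs Vy y0; have /rV0Pn [i yi] := y0.
have nz e h : h \is e.-homog -> pev idfun y h != 0 -> pev io s h != 0.
  move=> hh h0; have h1 : h * 'X_i \is (e + 1).-homog by apply: dhomogM => //; exact: dhomogX1.
  apply/eqP => e0; have := (gs _ _ _ h1).2; rewrite rmorphM /= e0 mul0r addn1 => /(_ isT erefl y Vy).
  by rewrite pev_id rmorphM /= pevX => /eqP; rewrite mulf_eq0 (negbTE h0) (negbTE yi).
have z e g : g \is e.-homog -> pev io s g = 0 -> pev idfun y g = 0.
  by move=> hg e0; apply/eqP/negPn/negP => h0; have := nz _ _ hg h0; rewrite e0 eqxx.
pose W0 u a := exists e g h, [/\ g \is e.-homog, h \is e.-homog, pev idfun y h != 0,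
  u = pev io s g / pev io s h & a = pev idfun y g / pev idfun y h].
have [|W pW sW] := @exists_place k K io W0.
  split.
  - move=> c; exists 0%N, c%:MP, 1; rewrite dhomogC dhomog1 !pevC !rmorph1 !divr1 oner_eq0.
    by split.
  - move=> _ _ _ _ [e [g [h [hg hh h0 -> ->]]]] [e' [g' [h' [hg' hh' h0' -> ->]]]].
    exists (e + e')%N, (g * h' - g' * h), (h * h'); split.
    + by apply: rpredB; [|rewrite addnC]; apply: dhomogM.
    + exact: dhomogM.
    + by rewrite rmorphM mulf_neq0.
    + rewrite rmorphB !rmorphM /=; have := nz _ _ hh h0; have := nz _ _ hh' h0'.
      by move: (pev io s h) (pev io s h') => u v v0 u0; field; rewrite u0 v0.
    rewrite rmorphB !rmorphM /=; move: h0 h0'.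
    by move: (pev idfun y h) (pev idfun y h') => u v v0 u0; field; rewrite u0 v0.
  - move=> _ _ _ _ [e [g [h [hg hh h0 -> ->]]]] [e' [g' [h' [hg' hh' h0' -> ->]]]].
    exists (e + e')%N, (g * g'), (h * h'); split; try exact: dhomogM.
    + by rewrite rmorphM mulf_neq0.
    + by rewrite !rmorphM /= invfM mulrACA.
    by rewrite !rmorphM /= invfM mulrACA.
  move=> a [e [g [h [hg hh h0 e1 ->]]]]; move/esym/eqP: e1.
  rewrite mulf_eq0 invr_eq0 (negbTE (nz _ _ hh h0)) orbF => /eqP /(z _ _ hg) ->.
  by rewrite mul0r.
exists W => //; split=> //; exists (io (y 0 i) / s 0 i) => j; apply: sW.
exists 1%N, ((y 0 i)%:MP * 'X_j), 'X_i; rewrite !rmorphM /= !pevC !pevX; split=> //.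
- by apply: dhomogMC; exact: dhomogX1.
- exact: dhomogX1.
- by rewrite mulrAC.
by rewrite mulrC mulKf.
Qed.

End GenericPlace.

Section Invariants3.
Variables (k : closedFieldType) (n : nat).
Hypothesis two0 : (2%:R : k) != 0.
Hypothesis three0 : (3%:R : k) != 0.
Variable p0 : 'rV[k]_n.+1.
Hypothesis p00 : p0 != 0.
Variables (K : fieldType) (io : {rmorphism k -> K}) (W : K -> k -> Prop).
Hypothesis plW : place io W.
Variables (b0 : blowup (@V0 k n) B0) (b1 : blowup (blowup_variety b0) (B1 b0))
  (b2 : blowup (blowup_variety b1) (B2 b1)).
Variable s : 'rV[K]_(cubic_dim k n).
Notation s3 := (next_point io b2 (next_point io b1 (next_point io b0 s))).
Hypothesis gs : generic_point io (@V0 k n) s.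

Lemma S0_V0 (y : 'rV[k]_(cubic_dim k n)) : S0 y -> V0 y.
Proof. by move=> Sy; case: (S0_line_condition 0 Sy). Qed.

(** Three pull-backs turn the numerator of [u] into a form on the space of cubics,
    where the invariants can be cancelled along [S0]. *)
Lemma regular_S3 y3 p1 u e i j (v : {mpoly k[cubic_dim k n]}) : 
  let nn := Ph p0 p1 p1 ^+ i * Gh p0 p1 p1 p1 ^+ j in
  (forall c, p1 <> c *: p0) -> specialises W s3 y3 ->
  regular0 io s3 y3 u -> v \is e.-homog -> nn \is e.-homog ->
  vanishes S0 v -> u * pev io s nn = pev io s v -> regular io s3 y3 (B3 b2) u.
Proof.
move=> nn hp sy [e1 [g [h [hg hh h0 _ ->]]]] hv hnn vv eu.
have [/rV0Pn [i0 yi0] _] := sy.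
have hs := spec_pev_neq0 plW sy hh h0.
have si0 : pev io s3 'X_i0 != 0 by rewrite pevX; exact: (spec_neq0 plW sy yi0).
have hgX : g * 'X_i0 \is e1.+1.-homog by rewrite -addn1; apply: dhomogM => //; exact: dhomogX1.
have hhX : h * 'X_i0 \is e1.+1.-homog by rewrite -addn1; apply: dhomogM => //; exact: dhomogX1.
exists e1.+1, (g * 'X_i0), (h * 'X_i0); split=> //.
- by rewrite rmorphM /= pevX mulf_neq0.
- have tv N (V B : pset k N) (b : blowup V B) Z E G := @transform_vanishes k N V B b Z E G.
  have hp0 E G := pullback_homog (e := E) (g := G) (@bl_homog _ _ _ _ b0).
  have hp1 E G := pullback_homog (e := E) (g := G) (@bl_homog _ _ _ _ b1).
  have hp2 E G := pullback_homog (e := E) (g := G) (@bl_homog _ _ _ _ b2).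
  have h2 := hp2 _ _ hgX; have h1 := hp1 _ _ h2; have h0' := hp0 _ _ h1.
  have pos2 : (0 < (bl_deg b2).+1 * e1.+1)%N by [].
  have pos1 : (0 < (bl_deg b1).+1 * ((bl_deg b2).+1 * e1.+1))%N by rewrite muln_gt0.
  have pos0 : (0 < (bl_deg b0).+1 * ((bl_deg b1).+1 * ((bl_deg b2).+1 * e1.+1)))%N by rewrite muln_gt0.
  apply/(tv _ _ _ _ _ e1.+1) => //; apply/(tv _ _ _ _ _ _ _ pos2) => //; apply/(tv _ _ _ _ _ _ _ pos1) => //.
  apply: (S0_cancel two0 three0 p00 (i := i) (j := j) hp pos0 h0').
  rewrite -/nn; have k2 := hp2 _ _ hhX; have k1 := hp1 _ _ k2; have k0' := hp0 _ _ k1.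
  set Pg := pullback _ _ in h0' *; set Ph := pullback _ _ in k0'.
  have ePg : pev io s Pg = pev io s3 (g * 'X_i0) by rewrite /Pg !pev_pullback.
  have ePh : pev io s Ph = pev io s3 (h * 'X_i0) by rewrite /Ph !pev_pullback.
  clearbody Pg Ph nn.
  have /gs : (0 < (bl_deg b0).+1 * ((bl_deg b1).+1 * ((bl_deg b2).+1 * e1.+1)) + e)%N by rewrite addn_gt0 pos0.
  move=> /(_ (Pg * nn - Ph * v)) [].
    exact: rpredB (dhomogM h0' hnn) (dhomogM k0' hv).
  move=> _ gz x Sx; have : pev idfun x (Pg * nn - Ph * v) = 0.
    rewrite -pev_id; apply: gz; last exact: S0_V0.
    rewrite rmorphB !rmorphM /= ePg ePh -eu (rmorphM _ g) (rmorphM _ h) /=.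
    by move: (pev io s3 g) (pev io s3 'X_i0) (pev io s3 h) (pev io s nn) hs => A C E F E0; field.
  by rewrite rmorphB (rmorphM _ Ph v) /= -[pev idfun x v]pev_id vv // mulr0 subr0 pev_id.
by rewrite !rmorphM /= invfM mulrACA divff ?mulr1.
Qed.

End Invariants3.

(** * Multilinear forms, their restrictions to lines, and their residues *)

Section Multilinear.
Variables (k : closedFieldType) (n : nat) (A : comNzRingType) (phi : {rmorphism k -> A}).
Notation vec := 'rV[k]_n.+1.
Notation e := (@ev k n).

Definition linear1 (F : vec -> A) := forall c u u', F (c *: u + u') = phi c * F u + F u'.
Definition bilin (F : vec -> vec -> A) :=
  (forall v, linear1 (fun u => F u v)) /\ forall u v, F u v = F v u.
Definition trilin (F : vec -> vec -> vec -> A) :=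
  [/\ forall v w, linear1 (fun u => F u v w), forall u v w, F u v w = F v u w &
      forall u v w, F u v w = F u w v].

Lemma linear1_0 F : linear1 F -> F 0 = 0.
Proof.
move=> h; have := h 1 0 0; rewrite scaler0 addr0 rmorph1 mul1r.
by move/eqP; rewrite -[X in X == _]addr0 (inj_eq (addrI _)) => /eqP.
Qed.

Lemma linear1D F u v : linear1 F -> F (u + v) = F u + F v.
Proof. by move=> h; rewrite -{1}[u]scale1r h rmorph1 mul1r. Qed.

Lemma linear1_expand F u : linear1 F -> F u = \sum_i phi (u 0 i) * F (e i).
Proof.
move=> h; rewrite {1}[u]row_sum_delta; elim/big_ind2: _ => [|x a y b <- <-|i _].
- exact: linear1_0.
- exact: linear1D.
by rewrite -[_ *: _]addr0 h linear1_0 // addr0.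
Qed.

Lemma linear1Z F c u : linear1 F -> F (c *: u) = phi c * F u.
Proof. by move=> h; rewrite -[_ *: _]addr0 h linear1_0 // addr0. Qed.

(** For the ring of a place or the zero ideal: [S] need not be closed under
    products. *)
Section Closed.
Variable S : A -> Prop.
Hypotheses (S0 : S 0) (SD : forall x y, S x -> S y -> S (x + y)) (SC : forall c x, S x -> S (phi c * x)).

Lemma linear1_closed F : linear1 F -> (forall i, S (F (e i))) -> forall u, S (F u).
Proof.
by move=> h hF u; rewrite (linear1_expand _ h); elim/big_ind: _ => // i _; exact: SC.
Qed.

Lemma bilin_closed F : bilin F -> (forall i j, S (F (e i) (e j))) -> forall u v, S (F u v).
Proof.
move=> [h s] hF u v; apply: (@linear1_closed (fun u => F u v)) => // i.
by rewrite s; apply: (@linear1_closed (fun v => F v (e i))).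
Qed.

Lemma trilin_closed F : trilin F -> (forall i j l, S (F (e i) (e j) (e l))) -> forall u v w, S (F u v w).
Proof.
move=> [h s s'] hF u v w; apply: (@linear1_closed (fun u => F u v w)) => // i.
rewrite s s'; apply: (@bilin_closed (fun v w => F v w (e i))).
  by split=> // a b; rewrite s.
by move=> j l; rewrite s' s.
Qed.
End Closed.
End Multilinear.

Section Scalar.
Variables (k : closedFieldType) (n : nat).
Notation vec := 'rV[k]_n.+1.
Hypothesis two0 : (2%:R : k) != 0.
Hypothesis three0 : (3%:R : k) != 0.

Lemma bilin_polar F : bilin (n := n) (idfun : {rmorphism k -> k}) F -> (forall u, F u u = 0) -> forall u v, F u v = 0.
Proof.
move=> [h s] d u v; have := d (u + v).
rewrite (linear1D _ _ (h _)) s (linear1D _ _ (h _)) [F v (_ + _)]s (linear1D _ _ (h _)) !d [F v u]s add0r addr0.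
by move/eqP; rewrite -mulr2n -mulr_natl mulf_eq0 (negbTE two0) => /eqP.
Qed.

Lemma trilin_polar F : trilin (n := n) (idfun : {rmorphism k -> k}) F -> (forall u, F u u u = 0) -> forall u v w, F u v w = 0.
Proof.
move=> [h s s'] d.
have L u u' v w : F (u + u') v w = F u v w + F u' v w := linear1D u u' (h v w).
have L2 u v v' w : F u (v + v') w = F u v w + F u v' w by rewrite s L s [F v' u w]s.
have L3 u v w w' : F u v (w + w') = F u v w + F u v w' by rewrite s' L2 s' [F u w' v]s'.
have half (x : k) : 2%:R * x = 0 -> x = 0 by move/eqP; rewrite mulf_eq0 (negbTE two0) => /eqP.
have E1 u v : F u u v + F u v v = 0.
  have := d (u + v); rewrite !(L, L2, L3) !d [F v u u]s [F u v u]s' [F v u v]s [F v v u]s' [F v u v]s => e0.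
  have e3 : 3%:R * (F u u v + F u v v) = 0 by rewrite -e0; ring.
  by move/eqP: e3; rewrite mulf_eq0 (negbTE three0) => /eqP.
have E u v : F u u v = 0.
  have e1 := E1 u v; have := E1 u (- v).
  have N x y : F x y (- v) = - F x y v.
    by apply/eqP; rewrite -addr_eq0 -L3 addNr s' s (linear1_0 (h _ _)).
  rewrite !N [F u (- v) v]s' N opprK => e2.
  by apply: half; rewrite -(subrr (0 : k)) -{1}e1 -e2; ring.
move=> u v w; have := E (u + v) w; rewrite !(L, L2) !E [F v u w]s add0r addr0 => e.
by apply: half; rewrite -e; ring.
Qed.

(** The polynomial ring is a domain. *)
Lemma common_nonzero F G : bilin (n := n) (idfun : {rmorphism k -> k}) F -> trilin (n := n) (idfun : {rmorphism k -> k}) G ->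
  (exists u v, F u v != 0) -> (exists u v w, G u v w != 0) ->
  exists p, F p p != 0 /\ G p p p != 0.
Proof.
move=> hF hG [u [v Fuv]] [u' [v' [w' Guv]]]; apply: NNPP => no.
pose f := quadp (fun i j => F (ev k i) (ev k j)); pose g := cubtp (fun i j l => G (ev k i) (ev k j) (ev k l)).
have fE p : pev idfun p f = F p p.
  case: hF => h s; rewrite pev_quadp (linear1_expand (F := fun u => F u p) p (h _)).
  apply: eq_bigr => i _; rewrite s (linear1_expand (F := fun u => F u _) p (h _)) mulr_sumr.
  by apply: eq_bigr => j _; rewrite s /=; ring.
have gE p : pev idfun p g = G p p p.
  case: hG => h s s'; rewrite /g /cubtp pev_cubt (linear1_expand (F := fun u => G u p p) p (h _ _)).
  apply: eq_bigr => i _; rewrite s (linear1_expand (F := fun u => G u _ _) p (h _ _)) mulr_sumr.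
  apply: eq_bigr => j _; rewrite s' s (linear1_expand (F := fun u => G u _ _) p (h _ _)) !mulr_sumr.
  apply: eq_bigr => l _; have -> : G (ev k l) (ev k j) (ev k i) = G (ev k i) (ev k j) (ev k l) by rewrite s s' s.
  by rewrite /=; ring.
have : f * g = 0.
  apply: mpoly_zero_test => p; rewrite rmorphM /= fE gE; apply/eqP.
  rewrite mulf_eq0; apply/negPn; rewrite negb_or; apply/negP => /andP [h1 h2]; apply: no; by exists p.
move/eqP; rewrite mulf_eq0 => /orP [/eqP f0|/eqP g0].
  by move/eqP: Fuv; apply; apply: bilin_polar => // p; rewrite -fE f0 rmorph0.
by move/eqP: Guv; apply; apply: trilin_polar => // p; rewrite -gE g0 rmorph0.
Qed.

Lemma poly6_zero (c0 c1 c2 c3 c4 c5 c6 : k) :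
  (forall x, c0 + c1 * x + c2 * x ^+ 2 + c3 * x ^+ 3 + c4 * x ^+ 4 + c5 * x ^+ 5 + c6 * x ^+ 6 = 0) ->
  [/\ c0 = 0, c1 = 0, c2 = 0 & c3 = 0] /\ [/\ c4 = 0, c5 = 0 & c6 = 0].
Proof.
move=> h; pose p := Poly [:: c0; c1; c2; c3; c4; c5; c6].
have p0 : p = 0.
  apply: closed_poly0 => x; rewrite horner_Poly /= -[RHS](h x); ring.
have ce i : [:: c0; c1; c2; c3; c4; c5; c6]`_i = 0 by rewrite -coef_Poly -/p p0 coef0.
by split; split; [exact: (ce 0%N)|exact: (ce 1%N)|exact: (ce 2%N)|exact: (ce 3%N)|exact: (ce 4%N)|exact: (ce 5%N)|exact: (ce 6%N)].
Qed.

(** Compare the coefficients of [x^5], [x^4], [x^3] and [x^2], in this order. *)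
Lemma square_along_line (c a b d : k) :
  (forall x, (x ^+ 2 + c) ^+ 3 = (x ^+ 3 + 3%:R / 2%:R * x * c + (3%:R * a * x ^+ 2 + 3%:R * b * x + d)) ^+ 2) ->
  [/\ c = 0, a = 0, b = 0 & d = 0].
Proof.
move=> h; pose s := 3%:R / 2%:R * c + 3%:R * b.
have [|[h0 h1 h2 h3] [h4 h5 h6]] := @poly6_zero (c ^+ 3 - d ^+ 2) (- (2%:R * s * d)) (3%:R * c ^+ 2 - s ^+ 2 - 6%:R * a * d)
   (- (2%:R * d + 6%:R * a * s)) (3%:R * c - 2%:R * s - 9%:R * a ^+ 2) (- (6%:R * a)) 0.
  move=> x.
  apply: etrans (subrr ((x ^+ 2 + c) ^+ 3)); rewrite {2}h /s; ring.
have a0 : a = 0.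
  by move/eqP: h5; rewrite oppr_eq0 mulf_eq0 (negbTE (six0 two0 three0)) => /eqP.
move: h4 h3 h2; rewrite a0 !(mulr0, mul0r, expr0n, subr0, addr0) /= => h4 h3 h2.
have b0 : b = 0.
  have : 6%:R * b = 0 by rewrite -[RHS]oppr0 -h4 /s; field.
  by move/eqP; rewrite mulf_eq0 (negbTE (six0 two0 three0)) => /eqP.
have d0 : d = 0.
  by move/eqP: h3; rewrite oppr_eq0 mulf_eq0 (negbTE two0) => /eqP.
have c0 : c = 0.
  have : 3%:R * c ^+ 2 = 0.
    rewrite -[RHS](mulr0 4%:R) -h2 /s b0; field; exact: two0.
  by move/eqP; rewrite mulf_eq0 (negbTE three0) expf_eq0 => /eqP.
by split.
Qed.

(** The terms have distinct degrees in [x]. *)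
Lemma vanish_along_line (e w a b d : k) :
  (forall x, e * x ^+ 6 + w * x ^+ 2 - 2%:R * x ^+ 3 * (3%:R * a * x ^+ 2 + 3%:R * b * x + d) = 0) ->
  [/\ e = 0, w = 0, a = 0, b = 0 & d = 0].
Proof.
move=> h; have [|[h0 h1 h2 h3] [h4 h5 h6]] := @poly6_zero 0 0 w (- (2%:R * d)) (- (6%:R * b)) (- (6%:R * a)) e.
  by move=> x; rewrite -[RHS](h x); ring.
have six := six0 two0 three0.
split=> //; [move/eqP: h5|move/eqP: h4|move/eqP: h3];
 by rewrite oppr_eq0 mulf_eq0 ?(negbTE six) ?(negbTE two0) => /eqP.
Qed.
End Scalar.

Section Residues.
Variables (k : closedFieldType) (K : fieldType) (io : {rmorphism k -> K}).
Variable W : K -> k -> Prop.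
Hypothesis plW : place io W.
Let pW : partial_place io W. Proof. by case: plW. Qed.

(** The value of an element of the valuation ring, by choice. *)
Definition res (u : K) : k := epsilon (inhabits 0) (W u).

Lemma resP u : integral W u -> W u (res u).
Proof. exact: (epsilon_spec (inhabits 0)). Qed.

Lemma res_eq u a : W u a -> res u = a.
Proof. by move=> h; apply: (pl_inj pW (resP _) h); exists a. Qed.

Lemma res_linear n F : linear1 (n := n) io F -> (forall u, integral W (F u)) ->
  linear1 (idfun : {rmorphism k -> k}) (fun u => res (F u)).
Proof.
move=> h hi c u u'; apply: res_eq; rewrite h.
by apply: (plD pW); [apply: (plM pW); [exact: (plC pW)|]|]; exact: resP.
Qed.

Lemma res_bilin n F : bilin (n := n) io F -> (forall u v, integral W (F u v)) ->
  bilin (idfun : {rmorphism k -> k}) (fun u v => res (F u v)).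
Proof.
by move=> [h s] hi; split=> [v|u v]; [exact: (res_linear (h v))|rewrite s].
Qed.

Lemma res_trilin n F : trilin (n := n) io F -> (forall u v w, integral W (F u v w)) ->
  trilin (idfun : {rmorphism k -> k}) (fun u v w => res (F u v w)).
Proof.
move=> [h s s'] hi; split=> [v w|u v w|u v w]; [exact: (res_linear (h v w))|by rewrite s|by rewrite s'].
Qed.

Lemma divides_refl u : divides W u u.
Proof. by exists 1; rewrite ?mulr1 //; exact: (integral1 plW). Qed.

Lemma divides_trans u v w : divides W u v -> divides W v w -> divides W u w.
Proof. by move=> [a ha ->] [b hb ->]; exists (a * b); [exact: (integralM plW)|rewrite mulrA]. Qed.

Lemma divides_integral u v : u != 0 -> divides W u v -> integral W (v / u).
Proof. by move=> u0 [a ha ->]; rewrite mulrAC divff ?mul1r. Qed.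

Lemma integral_divides u v : u != 0 -> integral W (v / u) -> divides W u v.
Proof. by move=> u0 h; exists (v / u) => //; rewrite mulrCA divff ?mulr1. Qed.

(** The ideals of the ring of a place are totally ordered. *)
Lemma divides_total u v : divides W u v \/ divides W v u.
Proof.
have [->|u0] := eqVneq u 0; first by right; exists 0; [exact: (integral0 plW)|rewrite mulr0].
have [->|v0] := eqVneq v 0; first by left; exists 0; [exact: (integral0 plW)|rewrite mulr0].
case: (int_or_inv plW (v / u)) => [h|[_ h]]; [left|right]; apply: integral_divides => //.
by exists 0; rewrite -invf_div.
Qed.

Lemma exists_min (s : seq K) u0 : exists2 al, al \in u0 :: s & forall u, u \in u0 :: s -> divides W al u.
Proof.
elim: s u0 => [|v s IH] u0.
  by exists u0; rewrite ?mem_head // => u; rewrite inE => /eqP ->; exact: divides_refl.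
have [al hal h] := IH v; have [h1|h1] := divides_total u0 al.
  exists u0; rewrite ?mem_head // => u; rewrite inE => /orP [/eqP ->|/h h2]; first exact: divides_refl.
  exact: divides_trans h1 h2.
exists al; first by rewrite inE hal orbT.
by move=> u; rewrite inE => /orP [/eqP ->|/h].
Qed.

End Residues.

(** * The normalised invariants of the generic cubic *)

Section NormalisedInvariants.
Variables (k : closedFieldType) (n : nat).
Hypothesis two0 : (2%:R : k) != 0.
Variables (K : fieldType) (io : {rmorphism k -> K}).
Notation vec := 'rV[k]_n.+1.
Variables (p0 : vec) (s : 'rV[K]_(cubic_dim k n)).
Notation T u v w := (pev io s (tr u v w)).
Notation a := (pev io s (Ah p0)).

Definition nB u := pev io s (Bh p0 u) / a.
Definition nP u v := pev io s (Ph p0 u v) / a ^+ 2.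
Definition nG u v w := pev io s (Gh p0 u v w) / a ^+ 3.

Lemma T_linear c u u' v w : T (c *: u + u') v w = io c * T u v w + T u' v w.
Proof. by rewrite tr_linear -mul_mpolyC rmorphD rmorphM /= pevC. Qed.

Lemma T_linear2 c u u' v w : T v (c *: u + u') w = io c * T v u w + T v u' w.
Proof. by rewrite !(tr_symm v) T_linear. Qed.

Lemma T_linear3 c u u' v w : T v w (c *: u + u') = io c * T v w u + T v w u'.
Proof. by rewrite !(tr_symr v w) T_linear2. Qed.

Lemma Ph_linear c u u' v : pev io s (Ph p0 (c *: u + u') v) = io c * pev io s (Ph p0 u v) + pev io s (Ph p0 u' v).
Proof. by rewrite !pev_Ph (T_linear3 c u u' p0 p0) (T_linear2 c u u' p0 v); ring. Qed.

Lemma nP_bilin : bilin io nP.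
Proof.
split=> [v c u u'|u v]; last by rewrite /nP !pev_Ph [tr p0 u v]tr_symr [_ * T p0 p0 v]mulrC.
by rewrite /nP Ph_linear mulrDl mulrA.
Qed.

Lemma nG_trilin : trilin io nG.
Proof.
have Psym u v : pev io s (Ph p0 u v) = pev io s (Ph p0 v u).
  by rewrite !pev_Ph [tr p0 u v]tr_symr [_ * T p0 p0 v]mulrC.
split=> [v w c u u'|u v w|u v w]; rewrite /nG !pev_Gh.
- by rewrite (T_linear c u u' v w) !(Ph_linear c u u') (T_linear3 c u u' p0 p0); ring.
- by rewrite [tr u v w]tr_symm (Psym v u); ring.
- by rewrite [tr u v w]tr_symr (Psym w v); ring.
Qed.

(** Completing the cube makes the invariants independent of the coordinate along
    [p0]. *)
Lemma nP_base u : nP p0 u = 0.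
Proof. by rewrite /nP pev_Ph subrr mul0r. Qed.

Lemma nG_base u v : nG p0 u v = 0.
Proof.
have e x : pev io s (Ph p0 p0 x) = 0 by rewrite pev_Ph subrr.
by rewrite /nG pev_Gh !e pev_Ph; ring.
Qed.

Lemma nP_multiple c : nP (c *: p0) (c *: p0) = 0.
Proof. by case: nP_bilin => h _; rewrite (linear1Z _ _ (h _)) nP_base mulr0. Qed.

Lemma nG_multiple c : nG (c *: p0) (c *: p0) (c *: p0) = 0.
Proof. by case: nG_trilin => h _ _; rewrite (linear1Z _ _ (h _ _)) nG_base mulr0. Qed.

(** The generic cubic is [X^3 - 3 P X + 2 G] with its normalised invariants. *)
Lemma T_tcub i j l : a != 0 -> T (ev k i) (ev k j) (ev k l) =
  a * tcub (fun i : 'I_n.+1 => nB (ev k i)) (fun i j => nP (ev k i) (ev k j)) (fun i j l => nG (ev k i) (ev k j) (ev k l)) i j l.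
Proof.
move=> a0; rewrite /tcub /nB /nG /nP !pev_Gh !pev_Ph fmorphV rmorph_nat /Bh /Ah in a0 *.
have t0 : (2%:R : K) != 0 by rewrite -(rmorph_nat io) fmorph_eq0.
by field; rewrite t0 a0.
Qed.

End NormalisedInvariants.

(** * The five blow-ups *)

Section Tower.
Variables (k : closedFieldType) (n : nat).
Variables (K : fieldType) (io : {rmorphism k -> K}) (W : K -> k -> Prop).

(** The hypotheses of one blow-up step: the generic point and the center of
    the place on the base and in the fibre, with a nonzero coordinate of each. *)
Record centered N (V B : pset k N) (b : blowup V B) (s : 'rV[K]_N) (y : 'rV[k]_N)
    (z : 'rV[k]_(bl_size b)) (i : 'I_N) (j : 'I_(bl_size b)) : Prop := Centered {
  c_gen : generic_point io V s;
  c_cone : cone V;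
  c_point : V y;
  c_base : specialises W s y;
  c_fibre : specialises W (evf io (bl_form b) s) z;
  c_i : y 0 i != 0;
  c_j : z 0 j != 0 }.

Section OneStep.
Hypothesis plW : place io W.
Variables (N : nat) (V B : pset k N) (b : blowup V B) (s : 'rV[K]_N) (y : 'rV[k]_N)
    (z : 'rV[k]_(bl_size b)) (i : 'I_N) (j : 'I_(bl_size b)).
Hypothesis c : centered s y z i j.
Notation pi := (exc_eq io b s i j).

Lemma c_div u : regular io s y B u -> regular0 io (next_point io b s) (segreR y z) (u / pi).
Proof. by case: c => *; apply: (@regular_div _ _ _ _ plW _ V B b). Qed.

Lemma c_transform Z u m : (forall x, Z x -> V x) -> regular0 io (next_point io b s) (segreR y z) u ->
  regular io s y Z (pi ^+ m * u) -> regular io (next_point io b s) (segreR y z) (transform b Z) u.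
Proof. by case: c => *; apply: (@regular_transform _ _ _ _ plW _ V B b _ _ _ _ _ _ i j _ _ _ _ m). Qed.

Lemma c_over (Z : pset k N) Z' u : (forall t, Z' t -> exists x w, Z x /\ t = segre x w) ->
  regular io s y Z u -> regular io (next_point io b s) (segreR y z) Z' u.
Proof. by case: c => *; apply: (@regular_proj _ _ _ _ plW _ V B b _ _ _ _ j _ Z). Qed.

Lemma c_up u : regular0 io s y u -> regular0 io (next_point io b s) (segreR y z) u.
Proof. exact: c_over. Qed.

Lemma c_pi : regular io s y B pi.
Proof. by case: c => *; exact: exc_eq_regular. Qed.

Lemma c_pi0 : pi != 0.
Proof. by case: c => _ _ _ sy sz yi zj; exact: (exc_eq_neq0 plW sy sz yi zj). Qed.

Lemma c_next : specialises W (next_point io b s) (segreR y z).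
Proof. by case: c => _ _ _ sy sz yi zj; exact: (spec_step plW sy sz yi zj). Qed.

(** If the center is empty then [1] vanishes on it, and [1 / pi] is regular. *)
Lemma c_chart r (psi : 'rV[{mpoly k[r]}]_N) l A (x : 'rV[K]_r) : factors b psi l A ->
  (forall i, integral W (x 0 i)) -> chart io W s y psi x -> integral W (x 0 l / pi) ->
  chart io W (next_point io b s) (segreR y z) (segreR psi A) x.
Proof.
case: c => gs cV Vy sy sz yi zj [T hT eT] hx ch hl.
apply: (chart_step plW sy sz yi zj hx ch eT).
case: hT => [->|[-> no]]; first by rewrite pevX.
rewrite rmorph1; apply: (regular_integral plW c_next (Z := @pempty _ _)); apply: c_div.
exists 0%N, 1, 1; rewrite !dhomog1 !rmorph1 divr1 oner_eq0; split=> //.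
by move=> t /no.
Qed.
End OneStep.

Variables (b0 : blowup (@V0 k n) B0) (b1 : blowup (blowup_variety b0) (B1 b0))
  (b2 : blowup (blowup_variety b1) (B2 b1)) (b3 : blowup (blowup_variety b2) (B3 b2))
  (b4 : blowup (blowup_variety b3) (B4 b3)).
Variables (s0 : 'rV[K]_(cubic_dim k n)) (y0 : 'rV[k]_(cubic_dim k n)).
Variables (z0 : 'rV[k]_(bl_size b0)) (z1 : 'rV[k]_(bl_size b1)) (z2 : 'rV[k]_(bl_size b2))
  (z3 : 'rV[k]_(bl_size b3)) (z4 : 'rV[k]_(bl_size b4)).
Variables (i0 : 'I_(cubic_dim k n)) (j0 : 'I_(bl_size b0)) (j1 : 'I_(bl_size b1)) (j2 : 'I_(bl_size b2))
  (j3 : 'I_(bl_size b3)) (j4 : 'I_(bl_size b4)).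
Notation s1 := (next_point io b0 s0).
Notation s2 := (next_point io b1 s1).
Notation s3 := (next_point io b2 s2).
Notation s4 := (next_point io b3 s3).
Notation s5 := (next_point io b4 s4).
Notation y1 := (segreR y0 z0).
Notation y2 := (segreR y1 z1).
Notation y3 := (segreR y2 z2).
Notation y4 := (segreR y3 z3).
Notation y5 := (segreR y4 z4).
Notation i1 := (mxvec_index i0 j0).
Notation i2 := (mxvec_index i1 j1).
Notation i3 := (mxvec_index i2 j2).
Notation i4 := (mxvec_index i3 j3).
Notation pi0 := (exc_eq io b0 s0 i0 j0).
Notation pi1 := (exc_eq io b1 s1 i1 j1).
Notation pi2 := (exc_eq io b2 s2 i2 j2).
Notation pi3 := (exc_eq io b3 s3 i3 j3).
Notation pi4 := (exc_eq io b4 s4 i4 j4).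
Notation vec := 'rV[k]_n.+1.

Hypothesis plW : place io W.
Hypothesis two0 : (2%:R : k) != 0.
Hypothesis three0 : (3%:R : k) != 0.
Hypothesis c0 : centered s0 y0 z0 i0 j0.
Hypothesis c1 : centered s1 y1 z1 i1 j1.
Hypothesis c2 : centered s2 y2 z2 i2 j2.
Hypothesis c3 : centered s3 y3 z3 i3 j3.
Hypothesis c4 : centered s4 y4 z4 i4 j4.
Variable p0 : vec.
Hypothesis hp0 : pev idfun y0 (Ah p0) != 0.
Notation P := (nP io p0 s0).
Notation G := (nG io p0 s0).

Lemma p0_neq0 : p0 != 0.
Proof.
apply: contraNneq hp0 => ->; have hc := cubic_of_homog y0.
by rewrite /Ah trE pol_diag // (pev_homog0 _ _ hc).
Qed.

Lemma AhX_homog d : Ah p0 ^+ d \is d.-homog.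
Proof. by rewrite -[X in X.-homog]mul1n; apply: dhomogMn; exact: Ah_homog. Qed.

Lemma B1_over t : B1 b0 t -> exists x w, B0 x /\ t = segre x w.
Proof.
move=> [l [q [x [v [[hl l0] _ _ [ex _] [c cn0 ->]]]]]].
exists x, (c *: diff_forms (bl_form b0) x v); split; last first.
  by have := segreRZ 1 c x (diff_forms (bl_form b0) x v); rewrite scale1r mul1r => /esym.
by exists l; split=> //; exists 1; rewrite ?oner_eq0 // scale1r ex; ring.
Qed.

Lemma B1_derivative t u v w : B1 b0 t -> exists x t', [/\ B0 x, dform x t' (Gh p0 u v w) = 0 &
  same_point (normal_direction b0 x t') t].
Proof.
move=> [l [q [x [v' [[hl l0] hq _ [ex ev'] hc]]]]]; exists x, v'; split=> //.
  by exists l; split=> //; exists 1; rewrite ?oner_eq0 // scale1r ex; ring.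
exact: dform_Gh hl hq ex ev'.
Qed.

Lemma P_B0 u v : regular io s0 y0 B0 (P u v).
Proof.
rewrite /nP -(rmorphXn (pev io s0)); apply: (@regular_form _ _ _ _ _ _ 2).
- exact: Ph_homog.
- exact: AhX_homog.
- by rewrite rmorphXn expf_neq0.
exact: Ph_B0.
Qed.

Lemma G_B0 u v w : regular io s0 y0 B0 (G u v w).
Proof.
rewrite /nG -(rmorphXn (pev io s0)); apply: (@regular_form _ _ _ _ _ _ 3).
- exact: Gh_homog.
- exact: AhX_homog.
- by rewrite rmorphXn expf_neq0.
exact: Gh_B0.
Qed.

Lemma dense_V0 (F : {mpoly k[cubic_dim k n]}) : vanishes (@V0 k n) F -> F = 0.
Proof.
move=> h; have /rV0Pn [i yi] : y0 != 0 by case: c0 => _ _ h0.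
have : F * 'X_i = 0.
  apply: mpoly_zero_test => x; rewrite rmorphM /= pevX; have [->|x0] := eqVneq x 0.
    by rewrite mxE mulr0.
  by rewrite -pev_id h // mul0r.
move/eqP; rewrite mulf_eq0 => /orP [/eqP //|/eqP/(congr1 (pev idfun (const_mx 1)))].
by rewrite pevX rmorph0 mxE => /eqP; rewrite oner_eq0.
Qed.

(** The derivative of [G] in the normal directions of [B_1] vanishes. *)
Lemma G_B1 u v w : regular io s1 y1 (B1 b0) (G u v w / pi0).
Proof.
rewrite /nG -(rmorphXn (pev io s0)); case: c0 => gs cV Vy sy sz yi zj.
apply: (regular_div_normal plW gs cV Vy sy sz yi zj dense_V0 (e := 3)).
- exact: Gh_homog.
- exact: AhX_homog.
- by rewrite rmorphXn expf_neq0.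
- exact: Gh_B0.
by move=> t /(B1_derivative u v w).
Qed.

Lemma P_1 u v : regular0 io s1 y1 (P u v / pi0).
Proof. exact: (c_div plW c0 (P_B0 u v)). Qed.

Lemma G_2 u v w : regular0 io s2 y2 (G u v w / pi0 / pi1).
Proof. exact: (c_div plW c1 (G_B1 u v w)). Qed.

Lemma pi0_B1 : regular io s1 y1 (B1 b0) pi0.
Proof. exact: (c_over plW c0 B1_over (c_pi c0)). Qed.

Lemma pi0_2 : regular0 io s2 y2 (pi0 / pi1).
Proof. exact: (c_div plW c1 pi0_B1). Qed.

(** [pi_0] vanishes on the first exceptional divisor and [pi_0 / pi_1] therefore on
    its proper transform. *)
Lemma pi0_B2 : regular io s2 y2 (B2 b1) (pi0 / pi1).
Proof.
apply: (@regular_mono _ _ _ _ _ _ (transform b1 (exceptional b0))); first by move=> x [].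
apply: (c_transform plW c1 (m := 1)) => //; first by move=> x [].
  exact: pi0_2.
rewrite expr1 mulrC divfK ?(c_pi0 plW c1) //; apply: (c_over plW c0 _ (c_pi c0)).
by move=> t [_ [x [w [Bx ->]]]]; exists x, w.
Qed.

Lemma pi1_B2 : regular io s2 y2 (B2 b1) pi1.
Proof.
apply: (@regular_mono _ _ _ _ _ _ (exceptional b1)); first by move=> x [].
apply: (c_over plW c1 _ (c_pi c1)).
by move=> t [_ [x [w [Bx ->]]]]; exists x, w.
Qed.

Lemma B3_lines ell t : B3 b2 t -> transform b2 (transform b1 (transform b0 (line_condition ell))) t.
Proof. by do 3!apply: transform_mono => ?; exact: S0_line_condition. Qed.

Notation D p := (P p p ^+ 3 - G p p p ^+ 2).

Lemma D_form p : D p = pev io s0 (Ph p0 p p ^+ 3 - Gh p0 p p p ^+ 2) / pev io s0 (Ah p0) ^+ 6.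
Proof.
have a0 : pev io s0 (Ah p0) != 0.
  by apply: (spec_pev_neq0 plW (c_base c0) (Ah_homog p0)).
rewrite /nP /nG (rmorphB (pev io s0) (Ph p0 p p ^+ 3)) !(rmorphXn (pev io s0)) /=; move: a0.
by move: (pev io s0 (Ph p0 p p)) (pev io s0 (Gh p0 p p p)) (pev io s0 (Ah p0)) => X Y a a0; field.
Qed.

Lemma D_homog p : Ph p0 p p ^+ 3 - Gh p0 p p p ^+ 2 \is 6.-homog.
Proof.
apply: rpredB; [rewrite -[6%N]/(2 * 3)%N|rewrite -[6%N]/(3 * 2)%N]; apply: dhomogMn.
  exact: Ph_homog.
exact: Gh_homog.
Qed.

Lemma D_line p : regular io s0 y0 (line_condition (line_to p0 p)) (D p).
Proof.
rewrite D_form -(rmorphXn (pev io s0)); apply: (@regular_form _ _ _ _ _ _ 6).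
- exact: D_homog.
- exact: AhX_homog.
- by rewrite rmorphXn expf_neq0.
exact: disc_line_condition.
Qed.

Lemma line0 ell (x : 'rV[k]_(cubic_dim k n)) : line_condition ell x -> V0 x. Proof. by case. Qed.

(** The quotients remain regular: for the first three divisions by the explicit
    expression in [P / pi_0], [G / (pi_0 pi_1)], [pi_0 / pi_1] and [pi_1], for the
    last two because the center lies on the line condition. *)
Lemma disc_regular p : row_free (line_to p0 p) -> regular io s5 y5
  (transform b4 (transform b3 (transform b2 (transform b1 (transform b0 (line_condition (line_to p0 p)))))))
  (D p / (pi0 ^+ 2 * pi1 * pi2 * pi3 * pi4)).
Proof.
move=> hl; set L := line_condition _; have h0 : regular io s0 y0 L (D p) := D_line p.
have [n0 [n1 [n2 [n3 n4]]]] : pi0 != 0 /\ pi1 != 0 /\ pi2 != 0 /\ pi3 != 0 /\ pi4 != 0.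
  by rewrite (c_pi0 plW c0) (c_pi0 plW c1) (c_pi0 plW c2) (c_pi0 plW c3) (c_pi0 plW c4).
have sp1 := c_next plW c0; have sp2 := c_next plW c1; have sp3 := c_next plW c2.
have up1 := c_up plW c1; have up2 := c_up plW c2.
have L1 : regular io s1 y1 (transform b0 L) (D p / pi0 ^+ 2).
  apply: (c_transform plW c0 (m := 2)); [exact: line0| |by rewrite mulrC divfK // expf_neq0].
  have -> : D p / pi0 ^+ 2 = (P p p / pi0) ^+ 3 * pi0 - (G p p p / pi0) ^+ 2 by field.
  apply: (regularB plW sp1).
    by apply: (regularM); [apply: (regularX); exact: P_1|apply: (c_up plW c0); exact: regular_regular0 (c_pi c0)].
  by apply: (regularX); exact: regular_regular0 (G_B1 _ _ _).
have e2 : D p / pi0 ^+ 2 / pi1 = (P p p / pi0) ^+ 3 * (pi0 / pi1) - (G p p p / pi0 / pi1) ^+ 2 * pi1.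
  by field; rewrite n0 n1.
have L2B : regular io s2 y2 (B2 b1) (D p / pi0 ^+ 2 / pi1).
  rewrite e2; apply: (regularB plW sp2); rewrite mulrC; apply: (regularM); [exact: pi0_B2| |exact: pi1_B2|].
    by apply: (regularX); apply: up1; exact: P_1.
  by apply: (regularX); exact: G_2.
have L2 : regular io s2 y2 (transform b1 (transform b0 L)) (D p / pi0 ^+ 2 / pi1).
  apply: (c_transform plW c1 (m := 1)); [|exact: regular_regular0 L2B|by rewrite expr1 mulrC divfK].
  by apply: transform_mono; exact: line0.
have L3 : regular io s3 y3 (transform b2 (transform b1 (transform b0 L))) (D p / pi0 ^+ 2 / pi1 / pi2).
  apply: (c_transform plW c2 (m := 1)); [|exact: (c_div plW c2)|by rewrite expr1 mulrC divfK].
  by do 2!apply: transform_mono => ?; exact: line0.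
have L4 : regular io s4 y4 (transform b3 (transform b2 (transform b1 (transform b0 L)))) (D p / pi0 ^+ 2 / pi1 / pi2 / pi3).
  apply: (c_transform plW c3 (m := 1)); [| |by rewrite expr1 mulrC divfK].
    by do 3!apply: transform_mono => ?; exact: line0.
  by apply: (c_div plW c3); apply: regular_mono L3; exact: B3_lines.
have -> : D p / (pi0 ^+ 2 * pi1 * pi2 * pi3 * pi4) = D p / pi0 ^+ 2 / pi1 / pi2 / pi3 / pi4.
  by move: (D p) (pi0) (pi1) (pi2) (pi3) (pi4) n0 n1 n2 n3 n4 => d q0 q1 q2 q3 q4 *; field; do 5!(apply/andP; split=> //).
apply: (c_transform plW c4 (m := 1)); [| |by rewrite expr1 mulrC divfK].
  by do 4!apply: transform_mono => ?; exact: line0.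
by apply: (c_div plW c4); apply: regular_mono L4 => x; apply.
Qed.

Hypothesis all_lines : forall ell : 'M[k]_(2, n.+1), row_free ell ->
  transform b4 (transform b3 (transform b2 (transform b1 (transform b0 (line_condition ell))))) y5.

Lemma disc_value p : W (D p / (pi0 ^+ 2 * pi1 * pi2 * pi3 * pi4)) 0.
Proof.
case: (line_to_free p0_neq0 p) => [hl|[c ->]]; last first.
  rewrite nP_multiple nG_multiple !expr0n /= subrr mul0r.
  by case: plW => pW _; exact: pl0 pW.
exact: (regular_value0 plW (c_next plW c4) (all_lines hl) (disc_regular hl)).
Qed.


(** ** Charts along the place *)

Variables (A0 : 'rV[{mpoly k[#|idx n|]}]_(bl_size b0)) (A1 : 'rV[{mpoly k[#|idx n|]}]_(bl_size b1))
  (A2 : 'rV[{mpoly k[#|idx n|]}]_(bl_size b2)) (A3 : 'rV[{mpoly k[#|idx n|]}]_(bl_size b3)).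
Notation psi0 := (psi0 k n).
Notation psi1 := (segreR (psubst (sg0 k n) psi0) A0).
Notation psi2 := (segreR (psubst (sg1 k n) psi1) A1).
Notation psi3 := (segreR (psubst (sg2 k n) psi2) A2).
Notation psi4 := (segreR (psubst (sg3 k n) psi3) A3).
Hypothesis hA0 : factors b0 (psubst (sg0 k n) psi0) (vs0 n) A0.
Hypothesis hA1 : factors b1 (psubst (sg1 k n) psi1) (vs0 n) A1.
Hypothesis hA2 : factors b2 (psubst (sg2 k n) psi2) (vs0 n) A2.
Hypothesis hA3 : factors b3 (psubst (sg3 k n) psi3) (vs2 n) A3.
Notation e := (@ev k n).
Implicit Type x : 'rV[K]_#|idx n|.
Let pW : partial_place io W. Proof. by case: plW. Qed.

Definition coords_integral x := forall i, integral W (x 0 i).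

Lemma sub0_integral x : coords_integral x -> coords_integral (sub0 x).
Proof.
by move=> h; elim/idx_ind => *; rewrite !mkpE //; apply: (integralM plW).
Qed.

Lemma sub1_integral x : coords_integral x -> coords_integral (sub1 x).
Proof.
by move=> h; elim/idx_ind => *; rewrite !mkpE //; apply: (integralM plW).
Qed.

Lemma sub2_integral x : coords_integral x -> coords_integral (sub2 (io 2%:R^-1) x).
Proof.
move=> h; have i1 : integral W (1 + x 0 (vs1 n)) by apply: (integralD plW) => //; exact: (integral1 plW).
elim/idx_ind => *; rewrite !mkpE //; apply: (integralM plW) => //; apply: (integralD plW) => //.
  exact: (integralM plW).
apply: (integralD plW); first by do 2!apply: (integralM plW) => //.
apply: (integralM plW); first exact: (integralC plW).
by do 2![apply: (integralD plW); last exact: (integralM plW)]; exact: (integralM plW).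
Qed.

Lemma sub3_integral x : coords_integral x -> coords_integral (sub3 x).
Proof.
by move=> h; elim/idx_ind => *; rewrite !mkpE //; apply: (integralM plW).
Qed.

Lemma a_neq0 : pev io s0 (Ah p0) != 0.
Proof. exact: (spec_pev_neq0 plW (c_base c0) (Ah_homog p0)). Qed.

(** The first chart is [X^3 - 3 P X + 2 G] itself. *)
Lemma chart0 x : (forall i, x 0 (vb i) = nB io p0 s0 (e i)) ->
  (forall i j, x 0 (vq i j) = P (e i) (e j)) ->
  (forall i j l, x 0 (vg i j l) = G (e i) (e j) (e l)) -> chart io W s0 y0 psi0 x.
Proof.
move=> hb hq hg; set a := pev io s0 (Ah p0); have a0 := a_neq0; rewrite -/a in a0.
have es : s0 = a *: evf io (psi0 0) x.
  rewrite (evf_psi0 io) /cubc -cubZ -[LHS](cub_tr two0 three0 io); apply: cub_ext => i j l.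
  by rewrite (@T_tcub _ _ two0 _ io p0 s0 i j l a_neq0) -/a; congr (_ * _); rewrite /tcub hb !hb !hq hg.
split; first by exists a.
exists (pev idfun y0 (Ah p0))^-1; rewrite ?invr_eq0 // => j.
have -> : pev io x (psi0 0 j) = pev io s0 'X_j / pev io s0 (Ah p0).
  have -> : pev io x (psi0 0 j) = evf io (psi0 0) x 0 j by rewrite [RHS]mxE.
  rewrite pevX -/a; have -> : s0 0 j = a * evf io (psi0 0) x 0 j by rewrite {1}es [LHS]mxE.
  by rewrite mulrAC divff // mul1r.
rewrite [X in W _ X]mulrC; have := spec_ratio plW (c_base c0) (dhomogX1 k j) (Ah_homog p0) hp0.
by rewrite [pev idfun y0 'X_j]pevX.
Qed.

Lemma chart_up0 x : coords_integral x -> chart io W s0 y0 psi0 (sub0 x) ->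
  integral W (x 0 (vs0 n) / pi0) -> chart io W s1 y1 psi1 x.
Proof.
by move=> hx ch hi; apply: (c_chart plW c0 hA0 hx _ hi); apply: chart_subst; rewrite (evf_sg0 io).
Qed.

Lemma chart_up1 x : coords_integral x -> chart io W s1 y1 psi1 (sub1 x) ->
  integral W (x 0 (vs0 n) / pi1) -> chart io W s2 y2 psi2 x.
Proof.
by move=> hx ch hi; apply: (c_chart plW c1 hA1 hx _ hi); apply: chart_subst; rewrite (evf_sg1 io).
Qed.

Lemma chart_up2 x : coords_integral x -> chart io W s2 y2 psi2 (sub2 (io 2%:R^-1) x) ->
  integral W (x 0 (vs0 n) / pi2) -> chart io W s3 y3 psi3 x.
Proof.
by move=> hx ch hi; apply: (c_chart plW c2 hA2 hx _ hi); apply: chart_subst; rewrite (evf_sg2 io).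
Qed.

Lemma chart_up3 x : coords_integral x -> chart io W s3 y3 psi3 (sub3 x) ->
  integral W (x 0 (vs2 n) / pi3) -> chart io W s4 y4 psi4 x.
Proof.
by move=> hx ch hi; apply: (c_chart plW c3 hA3 hx _ hi); apply: chart_subst; rewrite (evf_sg3 io).
Qed.

Definition is_q (t : 'I_#|idx n|) := [exists i, exists j, t == vq i j].
Definition is_g (t : 'I_#|idx n|) := [exists i, exists j, exists l, t == vg i j l].

Lemma is_qP (Q : 'I_#|idx n| -> Prop) : (forall i j, Q (vq i j)) -> forall t, is_q t -> Q t.
Proof. by move=> h t /existsP [i /existsP [j /eqP ->]]. Qed.
Lemma is_gP (Q : 'I_#|idx n| -> Prop) : (forall i j l, Q (vg i j l)) -> forall t, is_g t -> Q t.
Proof. by move=> h t /existsP [i /existsP [j /existsP [l /eqP ->]]]. Qed.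
Lemma is_q_vq i j : is_q (vq i j). Proof. by apply/existsP; exists i; apply/existsP; exists j. Qed.
Lemma is_g_vg i j l : is_g (vg i j l).
Proof. by apply/existsP; exists i; apply/existsP; exists j; apply/existsP; exists l. Qed.

(** The center contains the image of a coordinate plane, so the equation of the
    exceptional divisor lies in the ideal of the coordinates of the plane. *)
Section Lower.
Variable al : K.
Let dv := divides W al.

Lemma lower0 x : coords_integral x -> chart io W s0 y0 psi0 x ->
  (forall i j, dv (x 0 (vq i j))) -> (forall i j l, dv (x 0 (vg i j l))) -> dv pi0.
Proof.
move=> hx ch hq hg; apply: (@chart_regular _ _ _ _ plW _ _ _ _ _ _ _ [pred t | is_q t || is_g t] _ _ (c_base c0) ch hx _ _ (c_pi c0)).
  move=> t ht; apply: center0_point; split=> [i j|i j l]; apply: ht => /=; first by rewrite is_q_vq.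
  by rewrite is_g_vg orbT.
by move=> t /= /orP [/(is_qP (Q := fun t => dv (x 0 t)))|/(is_gP (Q := fun t => dv (x 0 t)))]; apply.
Qed.

Lemma lower1 x : coords_integral x -> chart io W s1 y1 psi1 x ->
  dv (x 0 (vs0 n)) -> (forall i j l, dv (x 0 (vg i j l))) -> dv pi1.
Proof.
move=> hx ch hs hg; apply: (@chart_regular _ _ _ _ plW _ _ _ _ _ _ _ [pred t | (t == vs0 n) || is_g t] _ _ (c_base c1) ch hx _ _ (c_pi c1)).
  move=> t ht; apply: (center1_point three0 hA0) => [|i j l]; apply: ht => /=; first by rewrite eqxx.
  by rewrite is_g_vg orbT.
by move=> t /= /orP [/eqP ->|/(is_gP (Q := fun t => dv (x 0 t)))] //; apply.
Qed.

Lemma lower2 x : coords_integral x -> chart io W s2 y2 psi2 x ->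
  dv (x 0 (vs0 n)) -> dv (x 0 (vs1 n)) -> dv pi2.
Proof.
move=> hx ch hs hs'; apply: (@chart_regular _ _ _ _ plW _ _ _ _ _ _ _ (pred2 (vs0 n) (vs1 n)) _ _ (c_base c2) ch hx _ _ (c_pi c2)).
  by move=> t ht; apply: (center2_point three0 hA0 hA1); apply: ht; rewrite /= eqxx ?orbT.
by move=> t /= /orP [/eqP ->|/eqP ->].
Qed.

Lemma lower3 x : coords_integral x -> chart io W s3 y3 psi3 x ->
  dv (x 0 (vs1 n)) -> (forall i j, dv (x 0 (vq i j))) -> (forall i j l, dv (x 0 (vg i j l))) -> dv pi3.
Proof.
move=> hx ch hs hq hg; apply: (@chart_regular _ _ _ _ plW _ _ _ _ _ _ _ [pred t | [|| t == vs1 n, is_q t | is_g t]] _ _ (c_base c3) ch hx _ _ (c_pi c3)).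
  move=> t ht; apply: (center3_point two0 hA0 hA1 hA2) => [|i j|i j l]; apply: ht => /=; first by rewrite eqxx.
    by rewrite is_q_vq orbT.
  by rewrite is_g_vg !orbT.
by move=> t /= /or3P [/eqP ->|/(is_qP (Q := fun t => dv (x 0 t)))|/(is_gP (Q := fun t => dv (x 0 t)))] //; apply.
Qed.

Lemma lower4 x : coords_integral x -> chart io W s4 y4 psi4 x ->
  dv (x 0 (vs2 n)) -> dv (x 0 (vs1 n)) -> (forall i j l, dv (x 0 (vg i j l))) -> dv pi4.
Proof.
move=> hx ch hs hs' hg; apply: (@chart_regular _ _ _ _ plW _ _ _ _ _ _ _ [pred t | [|| t == vs2 n, t == vs1 n | is_g t]] _ _ (c_base c4) ch hx _ _ (c_pi c4)).
  move=> t ht; apply: (center4_point two0 three0 hA0 hA1 hA2 hA3) => [||i j l]; apply: ht => /=; first by rewrite eqxx.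
    by rewrite eqxx orbT.
  by rewrite is_g_vg !orbT.
by move=> t /= /or3P [/eqP ->|/eqP ->|/(is_gP (Q := fun t => dv (x 0 t)))] //; apply.
Qed.
End Lower.

Definition unitary u := exists2 a, W u a & a != 0.

Lemma unitary_integral u : unitary u -> integral W u.
Proof. by case=> a h _; exists a. Qed.

Lemma unitaryV u : unitary u -> unitary u^-1.
Proof. by case=> a h a0; exists a^-1; [exact: (plV plW h)|rewrite invr_eq0]. Qed.

Lemma unitaryM u v : unitary u -> unitary v -> unitary (u * v).
Proof. by case=> a h a0 [b hb nb0]; exists (a * b); [exact: (plM pW)|rewrite mulf_neq0]. Qed.

Lemma unitary_ratio u v : u != 0 -> v != 0 -> integral W (u / v) -> integral W (v / u) -> unitary (u / v).
Proof.
move=> u0 v0 [a ha] [b hb]; exists a => //; apply/eqP => a0.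
have /(pl_inj pW (pl1 pW)) e1 : W 1 (a * b).
  by have := plM pW ha hb; rewrite mulrA divfK // divff.
by move/eqP: e1; rewrite a0 mul0r oner_eq0.
Qed.

Lemma unitary_neq0 u : unitary u -> u != 0.
Proof. by case=> a h a0; apply: contraNneq a0 => e0; apply/eqP/(pl0_inv pW); rewrite -e0. Qed.

(** A common divisor chosen among the given elements; that it is one of them
    makes the quotients primitive. *)
Lemma tensor_min (u0 : K) (F : 'I_n.+1 -> 'I_n.+1 -> K) (H : 'I_n.+1 -> 'I_n.+1 -> 'I_n.+1 -> K) : exists al,
  [/\ al = u0 \/ (exists i j, al = F i j) \/ (exists i j l, al = H i j l),
      divides W al u0, forall i j, divides W al (F i j) & forall i j l, divides W al (H i j l)].
Proof.
pose sF := [seq F t.1 t.2 | t <- enum {: 'I_n.+1 * 'I_n.+1}].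
pose sH := [seq H t.1.1 t.1.2 t.2 | t <- enum {: 'I_n.+1 * 'I_n.+1 * 'I_n.+1}].
have [al hal h] := exists_min plW (sF ++ sH) u0; exists al; split.
- move: hal; rewrite inE mem_cat => /or3P [/eqP ->|/mapP [t _ ->]|/mapP [t _ ->]]; first by left.
    by right; left; exists t.1, t.2.
  by right; right; exists t.1.1, t.1.2, t.2.
- by apply: h; rewrite mem_head.
- move=> i j; apply: h; rewrite inE mem_cat; apply/orP; right; apply/orP; left.
  by apply/mapP; exists (i, j); rewrite ?mem_enum.
move=> i j l; apply: h; rewrite inE mem_cat; apply/orP; right; apply/orP; right.
by apply/mapP; exists (i, j, l); rewrite ?mem_enum.
Qed.

Lemma divides0 u : divides W 0 u -> u = 0.
Proof. by case=> v _ ->; rewrite mul0r. Qed.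

Lemma bilinZ c F : bilin (n := n) io F -> bilin (n := n) io (fun u v => F u v / c).
Proof.
by move=> [h s]; split=> [v c' u u'|u v]; [rewrite (h v) mulrDl mulrA|rewrite s].
Qed.

Lemma trilinZ c F : trilin (n := n) io F -> trilin (n := n) io (fun u v w => F u v w / c).
Proof.
by move=> [h s s']; split=> [v w c' u u'|u v w|u v w]; [rewrite (h v w) mulrDl mulrA|rewrite s|rewrite s'].
Qed.

Lemma bilin_integral F : bilin (n := n) io F -> (forall i j, integral W (F (e i) (e j))) -> forall u v, integral W (F u v).
Proof.
by move=> h; apply: (bilin_closed (S := integral W) _ _ _ h) => [|x y|c x];
  [exact: (integral0 plW)|exact: (integralD plW)|move=> hx; apply: (integralM plW) => //; exact: (integralC plW)].
Qed.

Lemma trilin_integral F : trilin (n := n) io F -> (forall i j l, integral W (F (e i) (e j) (e l))) ->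
  forall u v w, integral W (F u v w).
Proof.
by move=> h; apply: (trilin_closed (S := integral W) _ _ _ h) => [|x y|c x];
  [exact: (integral0 plW)|exact: (integralD plW)|move=> hx; apply: (integralM plW) => //; exact: (integralC plW)].
Qed.

Lemma bilin_eq0 F : bilin (n := n) io F -> (forall i j, F (e i) (e j) = 0) -> forall u v, F u v = 0.
Proof.
move=> h hF; apply: (@bilin_closed _ _ _ io (fun t => t = 0)) => // [t t' -> ->|c t ->].
  by rewrite addr0.
by rewrite mulr0.
Qed.

Lemma trilin_eq0 F : trilin (n := n) io F -> (forall i j l, F (e i) (e j) (e l) = 0) -> forall u v w, F u v w = 0.
Proof.
move=> h hF; apply: (@trilin_closed _ _ _ io (fun t => t = 0)) => // [t t' -> ->|c t ->].
  by rewrite addr0.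
by rewrite mulr0.
Qed.

Hypothesis n_gt0 : (0 < n)%N.

Lemma D_nonzero : exists p, D p != 0.
Proof.
have [p [y hy]] := generic_disc_neq0 two0 three0 p0_neq0 n_gt0; exists p.
rewrite D_form mulf_neq0 ?invr_eq0 ?expf_neq0 ?a_neq0 //; apply: contraNneq hy => e0; apply/eqP.
have [->|yz] := eqVneq y 0; first exact: pev_homog0 (D_homog p).
by rewrite -pev_id; apply: (c_gen c0 (e := 6) isT (D_homog p)).2.
Qed.

(** With [al0], [al1], [al2] minimal among the terms that occur, the discriminant
    is [al0^2 al1 al2 (w3 P1^3 - v3 G2^2)].  The lower bounds show that the
    bracket has the value [0] for all [p]; if all of [P1], all of [G2], [w3] or
    [v3] had the value [0], the identity would propagate this to a term that is
    [1] by minimality. *)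
Lemma first_pass : exists p1, [/\ unitary (P p1 p1 / pi0), unitary (G p1 p1 p1 / pi0 / pi1),
  W (P p1 p1 ^+ 3 / G p1 p1 p1 ^+ 2) 1 & unitary (pi1 / pi2)].
Proof.
have q0 : pi0 != 0 := c_pi0 plW c0; have q1 : pi1 != 0 := c_pi0 plW c1; have q2 : pi2 != 0 := c_pi0 plW c2.
have [al0 [m0 _ dP dG]] := tensor_min (P (e ord0) (e ord0)) (fun i j => P (e i) (e j)) (fun i j l => G (e i) (e j) (e l)).
have bP := nP_bilin io p0 s0; have tG := nG_trilin io p0 s0.
have al00 : al0 != 0.
  apply/eqP => a0; rewrite a0 in dP dG; have [p /eqP] := D_nonzero; apply.
  have -> : P p p = 0 by apply: (bilin_eq0 bP) => i j; exact: divides0.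
  have -> : G p p p = 0 by apply: (trilin_eq0 tG) => i j l; exact: divides0.
  by rewrite !expr0n subrr.
have {m0} m0 : (exists i j, al0 = P (e i) (e j)) \/ (exists i j l, al0 = G (e i) (e j) (e l)).
  by case: m0 => [->|//]; left; exists ord0, ord0.
have al0B : regular io s0 y0 B0 al0.
  by case: m0 => [[i [j ->]]|[i [j [l ->]]]]; [exact: P_B0|exact: G_B0].
have [al1 [m1 d10 _ dG1]] := tensor_min al0 (fun _ _ => al0) (fun i j l => G (e i) (e j) (e l) / al0).
have al10 : al1 != 0 by apply: contraNneq al00 => a0; rewrite a0 in d10; rewrite (divides0 d10).
pose w := al0 / al1.
have [al2 [m2 d2w d21]] : exists al2, [/\ al2 = w \/ al2 = al1, divides W al2 w & divides W al2 al1].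
  case: (divides_total plW w al1) => h; [exists w|exists al1]; split=> //; try exact: (divides_refl plW).
    by left.
  by right.
have w0 : w != 0 by rewrite mulf_neq0 ?invr_eq0.
have al20 : al2 != 0 by apply: contraNneq w0 => a0; rewrite a0 in d2w; rewrite (divides0 d2w).
pose P1 u v := P u v / al0; pose G2 u v t := G u v t / al0 / al1.
have bP1 : bilin io P1 by exact: bilinZ.
have tG2 : trilin io G2 by do 2!apply: trilinZ.
have iP1 : forall u v, integral W (P1 u v) by apply: (bilin_integral bP1) => i j; apply: divides_integral.
have iG2 : forall u v t, integral W (G2 u v t) by apply: (trilin_integral tG2) => i j l; apply: divides_integral.
have iw : integral W w by exact: divides_integral.
have i1 : integral W al1.
  have h0 : integral W al0 := regular_integral plW (c_base c0) al0B.
  case: m1 => [->|[[_ [_ ->]]|[i [j [l ->]]]]] //; apply: divides_integral => //; exact: dG.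
have ib i : integral W (nB io p0 s0 (e i)).
  apply: (regular_integral plW (c_base c0) (Z := @pempty _ _)).
  by apply: (@regular_form _ _ _ _ _ _ 1) => //; [exact: Bh_homog|exact: Ah_homog].
(* The coordinates of the generic point in the chart of V_2, in which neither
   the linear form m nor s2 occurs. *)
pose x2 := mkp (fun i => nB io p0 s0 (e i)) (fun=> 0) (fun i j => P1 (e i) (e j)) (fun i j l => G2 (e i) (e j) (e l)) al1 w 0.
have ix2 : coords_integral x2.
  by elim/idx_ind => *; rewrite !mkpE //; exact: (integral0 plW).
have ix1 := sub1_integral ix2; have ix0 := sub0_integral ix1.
have aw : al1 * w = al0 by rewrite /w mulrCA divff ?mulr1.
have ch0 : chart io W s0 y0 psi0 (sub0 (sub1 x2)).
  apply: chart0 => *; rewrite !mkpE // aw /P1 /G2.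
    by field.
  by field; rewrite al00 al10.
have u0 : integral W (al0 / pi0) := regular_integral plW (c_next plW c0) (c_div plW c0 al0B).
have l0 : divides W al0 pi0.
  apply: (lower0 ix0 ch0) => [i j|i j l]; rewrite !mkpE aw; first by exists (P1 (e i) (e j)).
  by exists (al1 * G2 (e i) (e j) (e l)) => //; exact: (integralM plW).
have r0 := divides_integral al00 l0.
have ch1 : chart io W s1 y1 psi1 (sub1 x2).
  by apply: (chart_up0 ix1 ch0); rewrite !mkpE aw.
have u1 : integral W (al1 / pi1).
  have h0 : integral W (al0 / pi1).
    by apply: (regular_integral plW (c_next plW c1)); apply: (c_div plW c1); exact: (c_over plW c0 B1_over al0B).
  case: m1 => [->|[[_ [_ ->]]|[i [j [l ->]]]]] //.
  have -> : G (e i) (e j) (e l) / al0 / pi1 = G (e i) (e j) (e l) / pi0 / pi1 * (pi0 / al0).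
    move: (G _ _ _) (pi0) (pi1) q0 q1 => g a b na nb; field.
    by rewrite na nb al00.
  by apply: (integralM plW) => //; exact: (regular_integral plW (c_next plW c1) (G_2 _ _ _)).
have l1 : divides W al1 pi1.
  apply: (lower1 ix1 ch1) => [|i j l]; rewrite !mkpE; first by exists w.
  by exists (G2 (e i) (e j) (e l)).
have r1 := divides_integral al10 l1.
have ch2 : chart io W s2 y2 psi2 x2.
  by apply: (chart_up1 ix2 ch1); rewrite mkpE.
have l2 : divides W al2 pi2 by apply: (lower2 ix2 ch2); rewrite !mkpE.
have r2 := divides_integral al20 l2.
pose w3 := w / al2; pose v3 := al1 / al2.
have iw3 : integral W w3 by exact: divides_integral.
have iv3 : integral W v3 by exact: divides_integral.
pose rP u v := res W (P1 u v); pose rG u v t := res W (G2 u v t).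
have brP := res_bilin plW bP1 iP1; have trG := res_trilin plW tG2 iG2; rewrite -/rP -/rG in brP trG.
have W0 : W 0 0 := pl0 pW.
have rel p : res W w3 * rP p p ^+ 3 = res W v3 * rG p p p ^+ 2.
  apply/eqP; rewrite -subr_eq0; apply/eqP.
  have h1 : W (w3 * P1 p p ^+ 3 - v3 * G2 p p p ^+ 2) (res W w3 * rP p p ^+ 3 - res W v3 * rG p p p ^+ 2).
    by apply: (plB pW); apply: (plM pW); try apply: (plX pW); apply: resP.
  apply: (pl_inj pW h1).
  have i3 : integral W pi3 := regular_integral plW (c_base c3) (c_pi c3).
  have i4 : integral W pi4 := regular_integral plW (c_base c4) (c_pi c4).
  have q3 := c_pi0 plW c3; have q4 := c_pi0 plW c4.
  have [b hb] : integral W ((pi0 / al0) ^+ 2 * (pi1 / al1) * (pi2 / al2) * pi3 * pi4).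
    by do 4?[apply: (integralM plW) => //]; exact: (integralX plW).
  have := plM pW (disc_value p) hb; rewrite mul0r; congr W.
  rewrite /w3 /v3 /P1 /G2 /w; move: (P p p) (G p p p) pi0 pi1 pi2 pi3 pi4 q0 q1 q2 q3 q4.
  by move=> X Y a0 a1 a2 a3 a4 *; field; do ?[apply/andP; split].
have one u : u != 0 -> res W (u / u) = 1 by move=> h; rewrite divff //; exact: (res_eq plW (pl1 pW)).
have nt u v : W 1 (res W u * res W v) -> res W u * res W v = 1 by move=> h; exact: (pl_inj pW h (pl1 pW)).
have hP : exists u v, rP u v != 0.
  apply: NNPP => no; have rP0 u v : rP u v = 0 by apply/eqP/negPn/negP => h; apply: no; exists u, v.
  case: m0 => [[i [j ea]]|[i [j [l ea]]]].
    by have := one _ al00; rewrite {1}ea -/(P1 _ _) => h; have := rP0 (e i) (e j); rewrite /rP h => /eqP; rewrite oner_eq0.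
  have h1 : res W al1 * rG (e i) (e j) (e l) = 1.
    apply: nt; have -> : 1 = al1 * G2 (e i) (e j) (e l) by rewrite /G2 -ea divff // mulrC divfK.
    by apply: (plM pW); exact: resP.
  have rv0 : res W v3 = 0.
    apply/eqP/negPn/negP => h; have : rG (e i) (e j) (e l) = 0.
      apply: (trilin_polar two0 three0 trG) => p; have := rel p; rewrite rP0 expr0n mulr0 => /esym/eqP.
      by rewrite mulf_eq0 (negbTE h) expf_eq0 => /eqP.
    by move=> h2; move/eqP: h1; rewrite h2 mulr0 eq_sym oner_eq0.
  case: m2 => ea2; last by have := one _ al10; rewrite -{2}ea2 -/v3 rv0 => /eqP; rewrite eq_sym oner_eq0.
  have : W al1 (res W w * res W v3).
    have -> : al1 = w * v3 by rewrite /v3 ea2 mulrC divfK.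
    by apply: (plM pW); exact: resP.
  by rewrite rv0 mulr0 => /(res_eq plW) h; move/eqP: h1; rewrite h mul0r eq_sym oner_eq0.
have hG : exists u v t, rG u v t != 0.
  apply: NNPP => no; have rG0 u v t : rG u v t = 0 by apply/eqP/negPn/negP => h; apply: no; exists u, v, t.
  have ew : w = 1.
    case: m1 => [ea|[[_ [_ ea]]|[i [j [l ea]]]]]; try by rewrite /w -ea divff.
    by have := rG0 (e i) (e j) (e l); rewrite /rG /G2 -ea one // => /eqP; rewrite oner_eq0.
  have rw0 : res W w3 = 0.
    apply/eqP/negPn/negP => h; have [u [v /eqP]] := hP; apply.
    apply: (bilin_polar two0 brP) => p; have := rel p; rewrite rG0 expr0n mulr0 => /eqP.
    by rewrite mulf_eq0 (negbTE h) expf_eq0 => /eqP.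
  case: m2 => ea2; first by have := one _ w0; rewrite -{2}ea2 -/w3 rw0 => /eqP; rewrite eq_sym oner_eq0.
  have : res W al1 * res W w3 = 1.
    apply: nt; have -> : 1 = al1 * w3 by rewrite /w3 ew ea2 mul1r divff.
    by apply: (plM pW); exact: resP.
  by rewrite rw0 mulr0 => /eqP; rewrite eq_sym oner_eq0.
have [p1 [Pp Gp]] := common_nonzero two0 three0 brP trG hP hG.
have [rw0 rv0] : res W w3 != 0 /\ res W v3 != 0.
  have := rel p1; case: m2 => ea2.
    have -> : res W w3 = 1 by rewrite /w3 ea2 one.
    rewrite mul1r oner_eq0 => H; split=> //; apply: contraNneq (expf_neq0 3 Pp) => h; by rewrite H h mul0r.
  have -> : res W v3 = 1 by rewrite /v3 ea2 one.
  rewrite mul1r oner_eq0 => H; split=> //; apply: contraNneq (expf_neq0 2 Gp) => h; by rewrite -H h mul0r.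
have ua0 : unitary (al0 / pi0) by exact: unitary_ratio.
have ua1 : unitary (al1 / pi1) by exact: unitary_ratio.
have uP : unitary (P1 p1 p1) by exists (rP p1 p1) => //; exact: resP.
have uG : unitary (G2 p1 p1 p1) by exists (rG p1 p1 p1) => //; exact: resP.
have uv : unitary v3 by exists (res W v3) => //; exact: resP.
have nP0 : P p1 p1 != 0.
  by apply: contraNneq (unitary_neq0 uP) => h; rewrite /P1 h mul0r.
have nG0 : G p1 p1 p1 != 0.
  by apply: contraNneq (unitary_neq0 uG) => h; rewrite /G2 h !mul0r.
exists p1; split.
- have -> : P p1 p1 / pi0 = P1 p1 p1 * (al0 / pi0) by rewrite /P1 mulrA divfK.
  exact: unitaryM.
- have -> : G p1 p1 p1 / pi0 / pi1 = G2 p1 p1 p1 * ((al0 / pi0) * (al1 / pi1)).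
    rewrite /G2; move: (G _ _ _) pi0 pi1 q0 q1 => g a b na nb; field.
    by rewrite na nb al00 al10.
  by apply: unitaryM => //; exact: unitaryM.
- have -> : P p1 p1 ^+ 3 / G p1 p1 p1 ^+ 2 = w3 * P1 p1 p1 ^+ 3 * (v3 * G2 p1 p1 p1 ^+ 2)^-1.
    rewrite /w3 /v3 /w /P1 /G2; move: (P _ _) (G _ _ _) nG0 => X Y Y0; field.
    by rewrite Y0 al00 al10 al20.
  rewrite -(divff (mulf_neq0 rv0 (expf_neq0 2 Gp))) -{1}rel; apply: (plM pW).
    by apply: (plM pW); [|apply: (plX pW)]; exact: resP.
  apply: (plV plW); last by rewrite mulf_neq0 // expf_neq0.
  by apply: (plM pW); [|apply: (plX pW)]; exact: resP.
apply: unitary_ratio => //.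
  by apply: (regular_integral plW (c_next plW c2)); apply: (c_div plW c2); exact: pi1_B2.
have -> : pi2 / pi1 = (pi2 / al2) * v3^-1 * (al1 / pi1).
  by rewrite /v3; move: pi1 pi2 q1 => a b na; field; rewrite na al10 al20.
apply: (integralM plW) => //; apply: (integralM plW) => //; exact: unitary_integral (unitaryV uv).
Qed.

Lemma bilin_along F p1 p' c : bilin (n := n) (idfun : {rmorphism k -> k}) F -> (forall u, F p1 u = 0) ->
  F (c *: p1 + p') (c *: p1 + p') = F p' p'.
Proof. by move=> [h s] F0; rewrite (h _) F0 mulr0 add0r s (h _) F0 mulr0 add0r. Qed.

Lemma trilin_along F p1 p' c : trilin (n := n) (idfun : {rmorphism k -> k}) F -> F p1 p1 p1 = 0 ->
  F (c *: p1 + p') (c *: p1 + p') (c *: p1 + p') =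
  3%:R * F p1 p1 p' * c ^+ 2 + 3%:R * F p1 p' p' * c + F p' p' p'.
Proof.
move=> [h s s'] F0.
have L1 u v w w' : F (c *: u + w) v w' = c * F u v w' + F w v w' := h v w' c u w.
have L2 u v w w' : F v (c *: u + w) w' = c * F v u w' + F v w w' by rewrite s L1 s [F w v w']s.
have L3 u v w w' : F v w' (c *: u + w) = c * F v w' u + F v w' w by rewrite s' L2 s' [F v w w']s'.
rewrite !(L1, L2, L3) F0 [F p' p1 p1]s [F p1 p' p1]s' [F p' p1 p']s [F p' p' p1]s' [F p' p1 p']s.
by move: (F p1 p1 p') (F p1 p' p') (F p' p' p') => *; ring.
Qed.

(** ** Deviation of the invariants from a square and a cube *)

Section SecondPass.
Variable p1 : vec.
Hypothesis uP : unitary (P p1 p1 / pi0).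
Hypothesis uG : unitary (G p1 p1 p1 / pi0 / pi1).
Hypothesis hW : W (P p1 p1 ^+ 3 / G p1 p1 p1 ^+ 2) 1.
Hypothesis uS : unitary (pi1 / pi2).
Notation Pp := (P p1 p1).
Notation Gp := (G p1 p1 p1).

(** The deviation of the invariants from [M^2], [M^3]: on [S_0] the linear form
    [M] is proportional to [mm], and [qq], [gg], [eps] are zero. *)
Definition mm u := P p1 u / Pp.
Definition qq u v := P u v / Pp - mm u * mm v.
Definition gg u v w := G u v w / Gp - mm u * mm v * mm w -
  2%:R^-1 * (mm u * qq v w + mm v * qq u w + mm w * qq u v).
Definition eps := Pp ^+ 3 / Gp ^+ 2 - 1.

Let q0 : pi0 != 0. Proof. exact: (c_pi0 plW c0). Qed.
Let q1 : pi1 != 0. Proof. exact: (c_pi0 plW c1). Qed.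
Let q2 : pi2 != 0. Proof. exact: (c_pi0 plW c2). Qed.
Let q3 : pi3 != 0. Proof. exact: (c_pi0 plW c3). Qed.
Let q4 : pi4 != 0. Proof. exact: (c_pi0 plW c4). Qed.
Let Pp0 : Pp != 0.
Proof. by apply: contraNneq (unitary_neq0 uP) => h; rewrite h mul0r. Qed.
Let Gp0 : Gp != 0.
Proof. by apply: contraNneq (unitary_neq0 uG) => h; rewrite h !mul0r. Qed.
Let t0 : (2%:R : K) != 0.
Proof. by rewrite -(rmorph_nat io) fmorph_eq0. Qed.

Lemma p1_free c : p1 <> c *: p0.
Proof. by move=> h; move/eqP: Pp0; rewrite {1}h {1}h; apply; exact: nP_multiple. Qed.

Lemma mm_linear : linear1 io mm.
Proof. by move=> c u u'; case: (nP_bilin io p0 s0) => h s; rewrite /mm (s p1 (c *: u + u')) (h p1) (s p1 u) (s p1 u') mulrDl mulrA. Qed.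

Lemma qq_bilin : bilin io qq.
Proof.
case: (nP_bilin io p0 s0) => h s; split=> [v c u u'|u v]; rewrite /qq; last by rewrite s [mm u * _]mulrC.
by rewrite (h v) mm_linear; ring.
Qed.

Lemma gg_trilin : trilin io gg.
Proof.
case: (nG_trilin io p0 s0) => h s s'; case: qq_bilin => hq sq.
split=> [v w c u u'|u v w|u v w]; rewrite /gg.
- rewrite (h v w) mm_linear (hq v) (hq w).
  move: (G u v w) (G u' v w) (mm u) (mm u') (mm v) (mm w) (qq v w) (qq u w) (qq u v) (qq u' w) (qq u' v) (io c) => *; ring.
- rewrite s [qq u v]sq.
  move: (G _ _ _) (mm u) (mm v) (mm w) (qq v w) (qq u w) (qq v u) => *; ring.
rewrite s' [qq v w]sq.
move: (G _ _ _) (mm u) (mm v) (mm w) (qq w v) (qq u w) (qq u v) => *; ring.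
Qed.

Lemma mm_p1 : mm p1 = 1. Proof. by rewrite /mm divff. Qed.
Lemma qq_p1 u : qq p1 u = 0.
Proof. by rewrite /qq mm_p1 mul1r subrr. Qed.
Lemma gg_p1 : gg p1 p1 p1 = 0.
Proof. by rewrite /gg qq_p1 mm_p1 divff // !mulr1 !mulr0 !addr0 mulr0 !subrr. Qed.

Lemma P_mm u v : P u v = Pp * (mm u * mm v + qq u v).
Proof. by rewrite /qq addrCA subrr addr0 mulrC divfK. Qed.

Lemma G_mm u v w : G u v w = Gp * (mm u * mm v * mm w +
  2%:R^-1 * (mm u * qq v w + mm v * qq u w + mm w * qq u v) + gg u v w).
Proof.
rewrite /gg; set X := _ * _ * _; set Y := 2%:R^-1 * _.
have -> : X + Y + (G u v w / Gp - X - Y) = G u v w / Gp by move: X Y (_ / _) => *; ring.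
by rewrite mulrC divfK.
Qed.

(** The quotient of [D] by the square of [G(p1)], where the normalised invariants
    are [mm^2 + qq] and [mm^3 + 3/2 mm qq + gg]. *)
Definition Ep p := Pp ^+ 3 / Gp ^+ 2 * (mm p ^+ 2 + qq p p) ^+ 3 -
  (mm p ^+ 3 + 3%:R / 2%:R * mm p * qq p p + gg p p p) ^+ 2.

Lemma D_Ep p : D p = Gp ^+ 2 * Ep p.
Proof.
rewrite P_mm G_mm /Ep; move: (mm p) (qq p p) (gg p p p) Pp Gp Pp0 Gp0 => x q g a b *; field.
by apply/andP.
Qed.

Lemma Pratio_3 u v : regular0 io s3 y3 (P u v / Pp).
Proof.
have [a ha a0] := uP; apply: (c_up plW c2); apply: (c_up plW c1).
have -> : P u v / Pp = P u v / pi0 * (Pp / pi0)^-1.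
  by move: (P u v) Pp pi0 Pp0 q0 => *; field; apply/andP.
apply: regularM; first exact: P_1.
exact: (regularV plW (c_next plW c0) (P_1 _ _) ha a0).
Qed.

Lemma Gratio_3 u v w : regular0 io s3 y3 (G u v w / Gp).
Proof.
have [a ha a0] := uG; apply: (c_up plW c2).
have -> : G u v w / Gp = G u v w / pi0 / pi1 * (Gp / pi0 / pi1)^-1.
  by move: (G u v w) Gp pi0 pi1 Gp0 q0 q1 => *; field; do ?[apply/andP; split].
apply: regularM; first exact: G_2.
exact: (regularV plW (c_next plW c1) (G_2 _ _ _) ha a0).
Qed.

Let sp3 : specialises W s3 y3. Proof. exact: (c_next plW c2). Qed.

Lemma mm_3 u : regular0 io s3 y3 (mm u). Proof. exact: Pratio_3. Qed.

Lemma qq_3 u v : regular0 io s3 y3 (qq u v).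
Proof. by apply: (regularB plW sp3); [exact: Pratio_3|apply: regularM; exact: mm_3]. Qed.

Lemma gg_3 u v w : regular0 io s3 y3 (gg u v w).
Proof.
apply: (regularB plW sp3).
  apply: (regularB plW sp3); first exact: Gratio_3.
  by apply: regularM; [apply: regularM|]; exact: mm_3.
rewrite mulrC -(rmorph_nat io) -fmorphV; apply: regularM; last exact: regularC.
by apply: (regularD plW sp3); [apply: (regularD plW sp3)|]; apply: regularM; (exact: mm_3 || exact: qq_3).
Qed.

(** Up to functions regular on [V_2], the quotient is [pi_0 / pi_1^2], the product
    of [pi_0 / (pi_1 pi_2)] and [pi_2 / pi_1], both of them regular on [V_3]. *)
Lemma eps_3 : regular0 io s3 y3 eps.
Proof.
apply: (regularB plW sp3); last exact: regular1.
have -> : Pp ^+ 3 / Gp ^+ 2 = (Pp / pi0) ^+ 3 * ((Gp / pi0 / pi1)^-1) ^+ 2 * (pi0 / pi1 / pi2) * (pi1 / pi2)^-1.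
  by move: Pp Gp pi0 pi1 pi2 Gp0 q0 q1 q2 => *; field; do ?[apply/andP; split].
have [a ha a0] := uG; have [b hb nb0] := uS.
apply: regularM; [apply: regularM; [apply: regularM|]|].
- by apply: regularX; apply: (c_up plW c2); apply: (c_up plW c1); exact: P_1.
- apply: regularX; apply: (c_up plW c2).
  exact: (regularV plW (c_next plW c1) (G_2 _ _ _) ha a0).
- by apply: (c_div plW c2); exact: pi0_B2.
by apply: (regularV plW sp3 _ hb nb0); apply: (c_div plW c2); exact: pi1_B2.
Qed.

(** The numerators of [qq] and [gg] as forms in the coefficients of the cubic;
    the denominators are products of [Ph] and [Gh] at [p1], which are not zero
    divisors along [S_0]. *)
Definition qform u v := Ph p0 u v * Ph p0 p1 p1 - Ph p0 p1 u * Ph p0 p1 v.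
Definition gform u v w := Gh p0 u v w * Ph p0 p1 p1 ^+ 3 - Ph p0 p1 u * Ph p0 p1 v * Ph p0 p1 w * Gh p0 p1 p1 p1
  - (2%:R^-1)%:MP * (Gh p0 p1 p1 p1 * (Ph p0 p1 u * qform v w + Ph p0 p1 v * qform u w + Ph p0 p1 w * qform u v)).

Lemma qform_homog u v : qform u v \is 4.-homog.
Proof. by apply: rpredB; rewrite -[4%N]/(2 + 2)%N; apply: dhomogM; exact: Ph_homog. Qed.

Lemma gform_homog u v w : gform u v w \is 9.-homog.
Proof.
have hP := Ph_homog p0; have hG := Gh_homog p0; have hq := qform_homog.
apply: rpredB; first apply: rpredB.
- by rewrite -[9%N]/(3 + 2 * 3)%N; apply: dhomogM => //; apply: dhomogMn.
- by rewrite -[9%N]/(2 + 2 + 2 + 3)%N; do 3!apply: dhomogM => //.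
apply: dhomogMC; rewrite -[9%N]/(3 + (2 + 4))%N; apply: dhomogM => //.
by do 2?apply: rpredD; apply: dhomogM.
Qed.

Lemma S0_square y : S0 y -> exists M, (forall u v, pev idfun y (Ph p0 u v) = M u * M v) /\
   (forall u v w, pev idfun y (Gh p0 u v w) = M u * M v * M w).
Proof.
move=> [l [m [[hl _] [hm _] [c _ ey]]]].
by have [M [h1 [h2 _]]] := invariants_square two0 three0 p0 hl hm ey; exists M.
Qed.

Lemma pev_qform (A : comNzRingType) (phi : {rmorphism k -> A}) t u v : let f := pev phi t in
  f (qform u v) = f (Ph p0 u v) * f (Ph p0 p1 p1) - f (Ph p0 p1 u) * f (Ph p0 p1 v).
Proof.
rewrite /qform; move: (Ph p0 u v) (Ph p0 p1 p1) (Ph p0 p1 u) (Ph p0 p1 v) => a b c d /=.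
by rewrite rmorphB !rmorphM.
Qed.

Lemma pev_gform (A : comNzRingType) (phi : {rmorphism k -> A}) t u v w : let f := pev phi t in
  f (gform u v w) = f (Gh p0 u v w) * f (Ph p0 p1 p1) ^+ 3
    - f (Ph p0 p1 u) * f (Ph p0 p1 v) * f (Ph p0 p1 w) * f (Gh p0 p1 p1 p1)
    - phi 2%:R^-1 * (f (Gh p0 p1 p1 p1) * (f (Ph p0 p1 u) * f (qform v w)
       + f (Ph p0 p1 v) * f (qform u w) + f (Ph p0 p1 w) * f (qform u v))).
Proof.
rewrite /gform; move: (Gh p0 u v w) (Ph p0 p1 p1) (Ph p0 p1 u) (Ph p0 p1 v) (Ph p0 p1 w) (Gh p0 p1 p1 p1)
  (qform v w) (qform u w) (qform u v) => a b c d e' g h i j /=.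
by rewrite !(rmorphB, rmorphM, rmorphD, rmorphXn) /= pevC.
Qed.

Lemma qform_S0 u v : vanishes S0 (qform u v).
Proof.
move=> y /S0_square [M [hP hG]]; rewrite pev_id (pev_qform idfun) !hP.
by move: (M _) (M _) (M _) => *; ring.
Qed.

Lemma gform_S0 u v w : vanishes S0 (gform u v w).
Proof.
move=> y Sy; have [M [hP hG]] := S0_square Sy.
have hq a b : pev idfun y (qform a b) = 0 by rewrite -pev_id; exact: qform_S0.
rewrite pev_id (pev_gform idfun) !hq !hP !hG.
by rewrite /=; move: (M _) (M _) (M _) (M _) => *; ring.
Qed.

Let a0 := a_neq0.
Let Php0 : pev io s0 (Ph p0 p1 p1) != 0.
Proof. by apply: contraNneq Pp0 => h; rewrite /nP h mul0r. Qed.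
Let Ghp0 : pev io s0 (Gh p0 p1 p1 p1) != 0.
Proof. by apply: contraNneq Gp0 => h; rewrite /nG h mul0r. Qed.

Lemma qq_form u v : qq u v * pev io s0 (Ph p0 p1 p1) ^+ 2 = pev io s0 (qform u v).
Proof.
rewrite (pev_qform io) /qq /mm /nP.
move: a0 Php0; move: (pev io s0 (Ah p0)) (pev io s0 (Ph p0 p1 p1)) (pev io s0 (Ph p0 u v))
 (pev io s0 (Ph p0 p1 u)) (pev io s0 (Ph p0 p1 v)) => a b c d f ha hb; field.
by rewrite ha hb.
Qed.

Lemma mm_form u : mm u * pev io s0 (Ph p0 p1 p1) = pev io s0 (Ph p0 p1 u).
Proof.
rewrite /mm /nP; move: a0 Php0; move: (pev io s0 (Ah p0)) (pev io s0 (Ph p0 p1 p1)) (pev io s0 (Ph p0 p1 u)) => a b c ha hb; field.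
by rewrite ha hb.
Qed.

Lemma qq_B3 u v : regular io s3 y3 (B3 b2) (qq u v).
Proof.
apply: (@regular_S3 _ _ two0 three0 p0 p0_neq0 _ io W plW b0 b1 b2 s0 (c_gen c0) y3 p1 _ 4 2 0 (qform u v) p1_free sp3 (qq_3 u v) (qform_homog u v)).
- by rewrite expr0 mulr1 -[4%N]/(2 * 2)%N; apply: dhomogMn; exact: Ph_homog.
- exact: qform_S0.
by rewrite expr0 mulr1 rmorphXn /= qq_form.
Qed.

Lemma gg_B3 u v w : regular io s3 y3 (B3 b2) (gg u v w).
Proof.
apply: (@regular_S3 _ _ two0 three0 p0 p0_neq0 _ io W plW b0 b1 b2 s0 (c_gen c0) y3 p1 _ 9 3 1 (gform u v w) p1_free sp3 (gg_3 u v w) (gform_homog u v w)).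
- by rewrite -[9%N]/(2 * 3 + 3 * 1)%N; apply: dhomogM; apply: dhomogMn; [exact: Ph_homog|exact: Gh_homog].
- exact: gform_S0.
rewrite expr1 (rmorphM (pev io s0)) (rmorphXn (pev io s0)) /= (pev_gform io).
rewrite fmorphV rmorph_nat -(mm_form u) -(mm_form v) -(mm_form w) -(qq_form v w) -(qq_form u w) -(qq_form u v) /gg.
have -> : G u v w / Gp = pev io s0 (Gh p0 u v w) / pev io s0 (Gh p0 p1 p1 p1).
  rewrite /nG; move: a0 Ghp0; move: (pev io s0 (Ah p0)) (pev io s0 (Gh p0 u v w)) (pev io s0 (Gh p0 p1 p1 p1)) => a b c ha hb; field.
  by rewrite ha hb.
move: Php0 Ghp0; move: (pev io s0 (Ph p0 p1 p1)) (pev io s0 (Gh p0 u v w)) (pev io s0 (Gh p0 p1 p1 p1)).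
move: (mm u) (mm v) (mm w) (qq v w) (qq u w) (qq u v) => *; field.
by apply/andP; split.
Qed.

Lemma eps_B3 : regular io s3 y3 (B3 b2) eps.
Proof.
apply: (@regular_S3 _ _ two0 three0 p0 p0_neq0 _ io W plW b0 b1 b2 s0 (c_gen c0) y3 p1 _ 6 0 2 _ p1_free sp3 eps_3 (D_homog p1)).
- by rewrite expr0 mul1r -[6%N]/(3 * 2)%N; apply: dhomogMn; exact: Gh_homog.
- move=> y /S0_square [M [hP hG]]; rewrite pev_id (rmorphB (pev idfun y)) !(rmorphXn (pev idfun y)) /= hP hG.
  by move: (M _) => *; ring.
rewrite expr0 mul1r (rmorphB (pev io s0) (_ ^+ 3)) !(rmorphXn (pev io s0)) /= /eps /nP /nG.
move: a0 Ghp0; move: (pev io s0 (Ah p0)) (pev io s0 (Ph p0 p1 p1)) (pev io s0 (Gh p0 p1 p1 p1)) => a b c ha hb; field.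
by rewrite ha hb.
Qed.


(** The terms [eps], [qq], [gg] are divided by a minimal one, [al3], and then
    [al3], [eps / al3], [gg / al3] by a minimal one, [al4]; by the lower bounds
    [Ep / (al3 al4)] has the value [0] for all [p].  Its leading terms are those
    of [eps mm^6 + 3/4 mm^2 qq^2 - 2 mm^3 gg], which have different degrees
    along the lines through [p1]. *)
Lemma second_pass : False.
Proof.
have bP := nP_bilin io p0 s0; have tG := nG_trilin io p0 s0.
have bq := qq_bilin; have tg := gg_trilin.
pose vp := Pp ^+ 3 / Gp ^+ 2; pose tau := Gp / Pp.
have ev : vp = 1 + eps by rewrite /eps addrC subrK.
have im u : integral W (mm u) := regular_integral plW sp3 (mm_3 u).
have iq u v : integral W (qq u v) := regular_integral plW sp3 (qq_3 u v).
have ig u v w : integral W (gg u v w) := regular_integral plW sp3 (gg_3 u v w).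
have ie : integral W eps := regular_integral plW sp3 eps_3.
have [al3 [m3 d3e d3q d3g]] := tensor_min eps (fun i j => qq (e i) (e j)) (fun i j l => gg (e i) (e j) (e l)).
have al30 : al3 != 0.
  apply/eqP => a3; rewrite a3 in d3e d3q d3g; have [p /eqP] := D_nonzero; apply.
  rewrite D_Ep /Ep -/vp ev (divides0 d3e).
  have -> : qq p p = 0 by apply: (bilin_eq0 bq) => i j; exact: divides0.
  have -> : gg p p p = 0 by apply: (trilin_eq0 tg) => i j l; exact: divides0.
  by move: (mm p) => *; ring.
have al3B : regular io s3 y3 (B3 b2) al3.
  by case: m3 => [->|[[i [j ->]]|[i [j [l ->]]]]]; [exact: eps_B3|exact: qq_B3|exact: gg_B3].
have [al4 [m4 d43 d4e d4g]] := tensor_min al3 (fun _ _ => eps / al3) (fun i j l => gg (e i) (e j) (e l) / al3).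
have al40 : al4 != 0 by apply: contraNneq al30 => a4; rewrite a4 in d43; rewrite (divides0 d43).
pose q4_ u v := qq u v / al3; pose g4 u v w := gg u v w / al3; pose g5 u v w := gg u v w / al3 / al4.
have bq4 : bilin io q4_ by exact: bilinZ.
have tg4 : trilin io g4 by exact: trilinZ.
have tg5 : trilin io g5 by do 2!apply: trilinZ.
have iq4 : forall u v, integral W (q4_ u v) by apply: (bilin_integral bq4) => i j; apply: divides_integral.
have ig4 : forall u v w, integral W (g4 u v w) by apply: (trilin_integral tg4) => i j l; apply: divides_integral.
have ig5 : forall u v w, integral W (g5 u v w) by apply: (trilin_integral tg5) => i j l; apply: divides_integral.
have ie4 : integral W (eps / al3) by exact: divides_integral.
have ie5 : integral W (eps / al3 / al4) by apply: divides_integral => //; exact: (d4e ord0 ord0).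
have iw5 : integral W (al3 / al4) by exact: divides_integral.
have i3 : integral W al3 := regular_integral plW sp3 al3B.
have i4 : integral W al4.
  case: m4 => [->|[[_ [_ ->]]|[i [j [l ->]]]]] //; exact: ig4.
have ip1 : integral W pi1 := regular_integral plW (c_base c1) (c_pi c1).
have iu1 : integral W (tau / pi1).
  have -> : tau / pi1 = Gp / pi0 / pi1 * (Pp / pi0)^-1.
    by rewrite /tau; move: Pp Gp pi0 pi1 Pp0 q0 q1 => *; field; do ?[apply/andP; split].
  by apply: (integralM plW); [exact: unitary_integral uG|exact: unitary_integral (unitaryV uP)].
have itau : integral W tau.
  by rewrite -(divfK q1 tau); exact: (integralM plW).
have uvp : unitary vp by exists 1; rewrite ?oner_eq0.
have vp0 := unitary_neq0 uvp.
have tvp : tau * tau = Pp / vp.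
  by rewrite /tau /vp; move: Pp Gp Pp0 Gp0 => a b *; field; apply/andP.
have ib i : integral W (nB io p0 s0 (e i)).
  apply: (regular_integral plW (c_base c0) (Z := @pempty _ _)).
  by apply: (@regular_form _ _ _ _ _ _ 1) => //; [exact: Bh_homog|exact: Ah_homog].
(* The coordinates of the generic point in the last chart. *)
pose x4 := mkp (fun i => nB io p0 s0 (e i)) (fun i => mm (e i)) (fun i j => q4_ (e i) (e j))
  (fun i j l => g4 (e i) (e j) (e l)) tau (eps / al3) al3.
have ix4 : coords_integral x4 by elim/idx_ind => *; rewrite !mkpE.
have ix3 := sub3_integral ix4; have ix2 := sub2_integral ix3.
have ix1 := sub1_integral ix2; have ix0 := sub0_integral ix1.
have kq u v : al3 * q4_ u v = qq u v by rewrite /q4_ mulrC divfK.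
have kg u v w : al3 * g4 u v w = gg u v w by rewrite /g4 mulrC divfK.
have ke : al3 * (eps / al3) = eps by rewrite mulrC divfK.
have ch0 : chart io W s0 y0 psi0 (sub0 (sub1 (sub2 (io 2%:R^-1) (sub3 x4)))).
  apply: chart0 => [i|i j|i j l]; rewrite !mkpE // /sym3 ?mkpE ke -ev ?kq ?kg.
    by rewrite tvp (P_mm (e i)) mulrA divfK.
  rewrite tvp (G_mm (e i)) fmorphV rmorph_nat 2!mulrA.
  by have -> : Pp / vp * tau * vp = Gp by rewrite /tau mulrAC divfK // mulrC divfK.
have ch1 : chart io W s1 y1 psi1 (sub1 (sub2 (io 2%:R^-1) (sub3 x4))).
  apply: (chart_up0 ix1 ch0); rewrite !mkpE tvp mulrAC.
  by apply: (integralM plW); [exact: unitary_integral uP|exact: unitary_integral (unitaryV uvp)].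
have ch2 : chart io W s2 y2 psi2 (sub2 (io 2%:R^-1) (sub3 x4)).
  by apply: (chart_up1 ix2 ch1); rewrite !mkpE.
have ch3 : chart io W s3 y3 psi3 (sub3 x4).
  apply: (chart_up2 ix3 ch2); rewrite !mkpE.
  have -> : tau / pi2 = tau / pi1 * (pi1 / pi2) by rewrite mulrA divfK.
  by apply: (integralM plW) => //; exact: unitary_integral uS.
have ch4 : chart io W s4 y4 psi4 x4.
  apply: (chart_up3 ix4 ch3); rewrite !mkpE.
  exact: (regular_integral plW (c_next plW c3) (c_div plW c3 al3B)).
have r3 : integral W (pi3 / al3).
  apply: divides_integral => //; apply: (lower3 ix3 ch3) => [|i j|i j l]; rewrite !mkpE ?ke ?kq ?kg //.
have r4 : integral W (pi4 / al4).
  apply: divides_integral => //; apply: (lower4 ix4 ch4) => [||i j l]; rewrite !mkpE //.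
    exact: (d4e ord0 ord0).
  exact: d4g.
have E0 p : W (Ep p / (al3 * al4)) 0.
  have [b hb] : integral W (((Gp / pi0 / pi1)^-1) ^+ 2 * (pi1 / pi2)^-1 * (pi3 / al3) * (pi4 / al4)).
    do 2?[apply: (integralM plW) => //]; apply: (integralM plW).
      by apply: (integralX plW); exact: unitary_integral (unitaryV uG).
    exact: unitary_integral (unitaryV uS).
  have := plM pW (disc_value p) hb; rewrite mul0r; congr W; rewrite D_Ep.
  by move: (Ep p) Gp pi0 pi1 pi2 pi3 pi4 Gp0 q0 q1 q2 q3 q4 => *; field; do ?[apply/andP; split].
have W0 : W 0 0 := pl0 pW.
have We : W eps 0 by rewrite -(subrr (1 : k)); apply: (plB pW) => //; exact: (pl1 pW).
pose rm u := res W (mm u); pose rq u v := res W (qq u v); pose rg u v w := res W (gg u v w).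
have Lm := res_linear plW mm_linear im; have Lq := res_bilin plW bq iq; have Lg := res_trilin plW tg ig.
rewrite -/rm -/rq -/rg in Lm Lq Lg.
have rm1 : rm p1 = 1 by rewrite /rm mm_p1; exact: (res_eq plW (pl1 pW)).
have rq1 u : rq p1 u = 0 by rewrite /rq qq_p1; exact: (res_eq plW W0).
have rg1 : rg p1 p1 p1 = 0 by rewrite /rg gg_p1; exact: (res_eq plW W0).
have Wh : W 2%:R^-1 2%:R^-1 by have := plC pW 2%:R^-1; rewrite fmorphV rmorph_nat.
have Wn i : W i%:R i%:R by have := plC pW i%:R; rewrite rmorph_nat.
have Wm u : W (mm u) (rm u) by exact: resP.
have Wq u v : W (qq u v) (rq u v) by exact: resP.
have Wg u v w : W (gg u v w) (rg u v w) by exact: resP.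
(* Before the division; this makes the values of qq and gg zero. *)
have first p : (rm p ^+ 2 + rq p p) ^+ 3 = (rm p ^+ 3 + 3%:R / 2%:R * rm p * rq p p + rg p p p) ^+ 2.
  have h1 : W (Ep p) (1 * (rm p ^+ 2 + rq p p) ^+ 3 - (rm p ^+ 3 + 3%:R / 2%:R * rm p * rq p p + rg p p p) ^+ 2).
    apply: (plB pW).
      by apply: (plM pW) => //; apply: (plX pW); apply: (plD pW) => //; exact: (plX pW).
    apply: (plX pW); apply: (plD pW) => //; apply: (plD pW); first exact: (plX pW).
    by do 2?[apply: (plM pW) => //]; exact: (plM pW).
  have h2 : W (Ep p) 0.
    have [b hb] : integral W (al3 * al4) by exact: (integralM plW).
    by have := plM pW (E0 p) hb; rewrite mul0r divfK // mulf_neq0.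
  by apply/eqP; rewrite -subr_eq0; apply/eqP; have := pl_inj pW h1 h2; rewrite mul1r.
(* Lines through p1 are parametrised by their points in the kernel of rm. *)
have dec p : p = rm p *: p1 + (p - rm p *: p1) by rewrite addrC subrK.
have rmk p : rm (p - rm p *: p1) = 0.
  have := linear1D (rm p *: p1) (p - rm p *: p1) Lm; rewrite -dec (linear1Z _ _ Lm) rm1 /= mulr1.
  by move/eqP; rewrite -[X in X == _]addr0 (inj_eq (addrI _)) => /eqP.
have rml c p : rm (c *: p1 + (p - rm p *: p1)) = c by rewrite (Lm c) rm1 rmk mulr1 addr0.
have sq p : [/\ rq (p - rm p *: p1) (p - rm p *: p1) = 0, rg p1 p1 (p - rm p *: p1) = 0,
   rg p1 (p - rm p *: p1) (p - rm p *: p1) = 0 & rg (p - rm p *: p1) (p - rm p *: p1) (p - rm p *: p1) = 0].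
  apply: (square_along_line two0 three0) => c; have := first (c *: p1 + (p - rm p *: p1)).
  by rewrite rml (bilin_along _ _ Lq rq1) (trilin_along _ _ Lg rg1).
have rq0 p : rq p p = 0 by case: (sq p) => h _ _ _; rewrite (dec p) (bilin_along _ _ Lq rq1).
have rg0 p : rg p p p = 0.
  by case: (sq p) => _ h1 h2 h3; rewrite (dec p) (trilin_along _ _ Lg rg1) h1 h2 h3 !mulr0 !mul0r !addr0.
pose rq4 u v := res W (q4_ u v); pose rg5 u v w := res W (g5 u v w).
have Lq4 := res_bilin plW bq4 iq4; have Lg5 := res_trilin plW tg5 ig5; rewrite -/rq4 -/rg5 in Lq4 Lg5.
have rq41 u : rq4 p1 u = 0 by rewrite /rq4 /q4_ qq_p1 mul0r; exact: (res_eq plW W0).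
have rg51 : rg5 p1 p1 p1 = 0 by rewrite /rg5 /g5 gg_p1 !mul0r; exact: (res_eq plW W0).
pose re5 := res W (eps / al3 / al4); pose rw5 := res W (al3 / al4).
have Wq4 u v : W (q4_ u v) (rq4 u v) by exact: resP.
have Wg5 u v w : W (g5 u v w) (rg5 u v w) by exact: resP.
have We5 : W (eps / al3 / al4) re5 by exact: resP.
have Ww5 : W (al3 / al4) rw5 by exact: resP.
(* After the division; all other terms contain a factor of value zero. *)
have second p : re5 * rm p ^+ 6 + 3%:R / 4%:R * rw5 * rq4 p p ^+ 2 * rm p ^+ 2 - 2%:R * rm p ^+ 3 * rg5 p p p = 0.
  have W4 : W 4%:R^-1 4%:R^-1 by have := plC pW 4%:R^-1; rewrite fmorphV rmorph_nat.
  have h1 : W (eps / al3 / al4 * (mm p ^+ 2 + qq p p) ^+ 3 + 3%:R / 4%:R * (al3 / al4) * q4_ p p ^+ 2 * mm p ^+ 2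
     - 2%:R * mm p ^+ 3 * g5 p p p + (al3 / al4 * q4_ p p ^+ 2 * qq p p - gg p p p * g5 p p p - 3%:R * mm p * qq p p * g5 p p p))
    (re5 * (rm p ^+ 2 + rq p p) ^+ 3 + 3%:R / 4%:R * rw5 * rq4 p p ^+ 2 * rm p ^+ 2 - 2%:R * rm p ^+ 3 * rg5 p p p
     + (rw5 * rq4 p p ^+ 2 * rq p p - rg p p p * rg5 p p p - 3%:R * rm p * rq p p * rg5 p p p)).
    by repeat first [exact: Wn|exact: W4|exact: Wm|exact: Wq|exact: Wg|exact: Wq4|exact: Wg5|exact: We5|exact: Ww5
      |apply: (plB pW)|apply: (plD pW)|apply: (plM pW)|apply: (plX pW)].
  have := E0 p; have -> : Ep p / (al3 * al4) = eps / al3 / al4 * (mm p ^+ 2 + qq p p) ^+ 3 + 3%:R / 4%:R * (al3 / al4) * q4_ p p ^+ 2 * mm p ^+ 2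
     - 2%:R * mm p ^+ 3 * g5 p p p + (al3 / al4 * q4_ p p ^+ 2 * qq p p - gg p p p * g5 p p p - 3%:R * mm p * qq p p * g5 p p p).
    have f0 : (4%:R : K) != 0 by rewrite (natrM K 2 2) mulf_neq0.
    rewrite /Ep -/vp ev /q4_ /g5; move: (mm p) (qq p p) (gg p p p) eps => *; field.
    by do ?[apply/andP; split].
  move/(pl_inj pW h1); rewrite rq0 rg0 addr0 => h2; rewrite -[RHS]h2; move: (rm p) (rq4 p p) (rg5 p p p) => *; ring.
have van p : [/\ re5 = 0, 3%:R / 4%:R * rw5 * rq4 (p - rm p *: p1) (p - rm p *: p1) ^+ 2 = 0,
   rg5 p1 p1 (p - rm p *: p1) = 0, rg5 p1 (p - rm p *: p1) (p - rm p *: p1) = 0 &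
   rg5 (p - rm p *: p1) (p - rm p *: p1) (p - rm p *: p1) = 0].
  apply: (vanish_along_line two0 three0) => c; have := second (c *: p1 + (p - rm p *: p1)).
  by rewrite rml (bilin_along _ _ Lq4 rq41) (trilin_along _ _ Lg5 rg51).
have re50 : re5 = 0 by case: (van 0).
have rg50 : forall u v w, rg5 u v w = 0.
  apply: (trilin_polar two0 three0 Lg5) => p; case: (van p) => _ _ h1 h2 h3.
  by rewrite (dec p) (trilin_along _ _ Lg5 rg51) h1 h2 h3 !mulr0 !mul0r !addr0.
have one u : u != 0 -> W (u / u) 1 by move=> h; rewrite divff //; exact: (pl1 pW).
have no1 : ~ W 1 0 by move=> h; have := pl_inj pW (pl1 pW) h => /eqP; rewrite oner_eq0.
have ea4 : al4 = al3.
  case: m4 => [//|[[_ [_ ea]]|[i [j [l ea]]]]]; exfalso; apply: no1.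
    by have := We5; rewrite re50 -{1}ea divff.
  by have := Wg5 (e i) (e j) (e l); rewrite rg50 /g5 -ea divff.
have rw51 : rw5 = 1 by apply: (pl_inj pW Ww5); rewrite ea4; exact: one.
have rq40 : forall u v, rq4 u v = 0.
  apply: (bilin_polar two0 Lq4) => p; case: (van p) => _ h _ _ _.
  rewrite (dec p) (bilin_along _ _ Lq4 rq41); move/eqP: h.
  rewrite rw51 mulr1 mulf_eq0 expf_eq0 mulf_eq0 invr_eq0 (negbTE three0) (natrM k 2 2) mulf_eq0 (negbTE two0) /=.
  by move/eqP.
apply: no1; case: m3 => [ea|[[i [j ea]]|[i [j [l ea]]]]].
- have : W (al4 * (eps / al3 / al4)) 0.
    by have [b hb] := i4; have := plM pW hb We5; rewrite re50 mulr0.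
  by rewrite -{1}ea divff // mulrC divfK.
- by have := Wq4 (e i) (e j); rewrite rq40 /q4_ -ea divff.
have : W (al4 * g5 (e i) (e j) (e l)) 0.
  by have [b hb] := i4; have := plM pW hb (Wg5 (e i) (e j) (e l)); rewrite rg50 mulr0.
by rewrite /g5 -ea divff // mulrC divfK.
Qed.

End SecondPass.

Lemma no_common_point : False.
Proof. by have [p1 [uP uG hW uS]] := first_pass; exact: (second_pass uP uG hW uS). Qed.

End Tower.

Section Conclusion.
Variables (k : closedFieldType) (n : nat).
Hypothesis two0 : (2%:R : k) != 0.
Hypothesis three0 : (3%:R : k) != 0.
Hypothesis n_gt0 : (0 < n)%N.
Notation N0 := (cubic_dim k n).

Lemma charts_exist (b0 : blowup (@V0 k n) B0) (b1 : blowup (blowup_variety b0) (B1 b0))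
  (b2 : blowup (blowup_variety b1) (B2 b1)) (b3 : blowup (blowup_variety b2) (B3 b2)) :
  let psi0 := psi0 k n in
  exists A0, factors b0 (psubst (sg0 k n) psi0) (vs0 n) A0 /\
  let psi1 := segreR (psubst (sg0 k n) psi0) A0 in
  exists A1, factors b1 (psubst (sg1 k n) psi1) (vs0 n) A1 /\
  let psi2 := segreR (psubst (sg1 k n) psi1) A1 in
  exists A2, factors b2 (psubst (sg2 k n) psi2) (vs0 n) A2 /\
  let psi3 := segreR (psubst (sg2 k n) psi2) A2 in
  exists A3, factors b3 (psubst (sg3 k n) psi3) (vs2 n) A3.
Proof.
cbv zeta.
have [|A0 hA0] := chart_factor b0 (psi := psubst (sg0 k n) (psi0 k n)) (l := vs0 n).
  move=> x hx; rewrite (evf_psubst idfun) (evf_sg0 idfun); apply: center0_point.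
  by split=> *; rewrite mkpE hx mul0r.
exists A0; split=> //.
have [|A1 hA1] := chart_factor b1 (psi := psubst (sg1 k n) (segreR (psubst (sg0 k n) (psi0 k n)) A0)) (l := vs0 n).
  move=> x hx; rewrite pat_sub1; apply: (center1_point three0 hA0) => *.
    by rewrite mkpE hx mul0r.
  by rewrite mkpE hx mul0r.
exists A1; split=> //.
have [|A2 hA2] := chart_factor b2 (psi := psubst (sg2 k n) (segreR (psubst (sg1 k n) (segreR (psubst (sg0 k n) (psi0 k n)) A0)) A1)) (l := vs0 n).
  by move=> x hx; rewrite pat_sub2; apply: (center2_point three0 hA0 hA1); rewrite mkpE.
exists A2; split=> //.
have [|A3 hA3] := chart_factor b3 (psi := psubst (sg3 k n) (segreR (psubst (sg2 k n)
   (segreR (psubst (sg1 k n) (segreR (psubst (sg0 k n) (psi0 k n)) A0)) A1)) A2)) (l := vs2 n).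
  by move=> x hx; rewrite pat_sub3; apply: (center3_point two0 hA0 hA1 hA2) => *; rewrite mkpE hx mul0r.
by exists A3.
Qed.

Definition gen_field := {fraction {mpoly k[N0]}}.
Definition gen_embed : {rmorphism k -> gen_field} := @tofrac {mpoly k[N0]} \o @mpolyC N0 k.
Definition gen_coord : 'rV[gen_field]_N0 := \row_i tofrac ('X_i : {mpoly k[N0]}).

Lemma gen_coord_generic : generic_point gen_embed (@V0 k n) gen_coord.
Proof.
move=> e g e0 hg; have -> : pev gen_embed gen_coord g = tofrac g.
  rewrite -{2}[g]pev_vars (pev_comp (@mpolyC N0 k) (@tofrac {mpoly k[N0]})).
  by congr pev; apply/rowP => i; rewrite !mxE.
split=> [v|/eqP].
  apply/eqP; rewrite tofrac_eq0; apply/eqP/mpoly_zero_test => x.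
  have [->|x0] := eqVneq x 0; first exact: pev_homog0 hg.
  by rewrite -pev_id v.
by rewrite tofrac_eq0 => /eqP -> x _; rewrite pev_id rmorph0.
Qed.

Lemma intersection_empty (b0 : blowup (@V0 k n) B0) (b1 : blowup (blowup_variety b0) (B1 b0))
  (b2 : blowup (blowup_variety b1) (B2 b1)) (b3 : blowup (blowup_variety b2) (B3 b2))
  (b4 : blowup (blowup_variety b3) (B4 b3)) y :
  blowup_variety b4 y -> (forall ell : 'M[k]_(2, n.+1), row_free ell ->
    transform b4 (transform b3 (transform b2 (transform b1 (transform b0 (line_condition ell))))) y) -> False.
Proof.
move=> Vy hL.
have g0 := gen_coord_generic.
have g1 := generic_next (b := b0) g0; have g2 := generic_next (b := b1) g1; have g3 := generic_next (b := b2) g2.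
have g4 := generic_next (b := b3) g3; have g5 := generic_next (b := b4) g4.
have y0 : y != 0 by case: Vy.
have [W plW s5] := generic_place g5 Vy y0.
have cl N (V B : pset k N) (b : blowup V B) : closed_set (blowup_variety b) by exact: closed_closure.
have co N (V B : pset k N) (b : blowup V B) : cone (blowup_variety b) by exact: cone_closure.
have [y4 [z4 [e5 s4 t4]]] := spec_segre plW s5; rewrite {}e5 in Vy hL {y0 s5}.
have V4 := spec_below (cl _ _ _ b3) Vy.
have [y3 [z3 [e4 s3 t3]]] := spec_segre plW s4; subst y4; have V3 := spec_below (cl _ _ _ b2) V4.
have [y2 [z2 [e3 s2 t2]]] := spec_segre plW s3; subst y3; have V2 := spec_below (cl _ _ _ b1) V3.
have [y1 [z1 [e2 s1 t1]]] := spec_segre plW s2; subst y2; have V1 := spec_below (cl _ _ _ b0) V2.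
have [y0 [z0 [e1 s0 t0]]] := spec_segre plW s1; subst y1; have Vy0 := spec_below (@closed_V0 k n) V1.
have /rV0Pn [i0 yi0] : y0 != 0 := Vy0.
have nz M (s : 'rV[gen_field]_M) z : specialises W s z -> exists j, z 0 j != 0 by case=> /rV0Pn.
have [j0 zj0] := nz _ _ _ t0; have [j1 zj1] := nz _ _ _ t1; have [j2 zj2] := nz _ _ _ t2.
have [j3 zj3] := nz _ _ _ t3; have [j4 zj4] := nz _ _ _ t4.
have yi1 : segreR y0 z0 0 (mxvec_index i0 j0) != 0 by rewrite segreRE mulf_neq0.
have yi2 : segreR (segreR y0 z0) z1 0 (mxvec_index (mxvec_index i0 j0) j1) != 0 by rewrite segreRE mulf_neq0.
have yi3 : segreR (segreR (segreR y0 z0) z1) z2 0 (mxvec_index (mxvec_index (mxvec_index i0 j0) j1) j2) != 0.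
  by rewrite segreRE mulf_neq0.
have yi4 : segreR (segreR (segreR (segreR y0 z0) z1) z2) z3 0
   (mxvec_index (mxvec_index (mxvec_index (mxvec_index i0 j0) j1) j2) j3) != 0 by rewrite segreRE mulf_neq0.
have c0 := Centered g0 (@cone_V0 k n) Vy0 s0 t0 yi0 zj0.
have c1 := Centered g1 (co _ _ _ _) V1 s1 t1 yi1 zj1.
have c2 := Centered g2 (co _ _ _ _) V2 s2 t2 yi2 zj2.
have c3 := Centered g3 (co _ _ _ _) V3 s3 t3 yi3 zj3.
have c4 := Centered g4 (co _ _ _ _) V4 s4 t4 yi4 zj4.
have [p0 hp0] : exists p0, pev idfun y0 (Ah p0) != 0.
  apply: NNPP => no; move/eqP: (Vy0 : y0 != 0); apply; apply/eqP; rewrite -cubic_of0; apply/eqP.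
  apply: mpoly_zero_test => p; apply/eqP/negPn/negP => h; apply: no; exists p.
  by rewrite /Ah trE pol_diag //; exact: cubic_of_homog.
have [A0 [hA0 [A1 [hA1 [A2 [hA2 [A3 hA3]]]]]]] := charts_exist b3.
exact: (no_common_point plW two0 three0 c0 c1 c2 c3 c4 hp0 hL hA0 hA1 hA2 hA3 n_gt0).
Qed.

End Conclusion.

Theorem corollary2p23 (k : closedFieldType) (n : nat)
  (hn : (2 <= n)%N)
  (char2 : 2%N \notin [pchar k]) (char3 : 3%N \notin [pchar k])
  (b0 : blowup (@V0 k n) B0)
  (b1 : blowup (blowup_variety b0) (B1 b0))
  (b2 : blowup (blowup_variety b1) (B2 b1))
  (b3 : blowup (blowup_variety b2) (B3 b2))
  (b4 : blowup (blowup_variety b3) (B4 b3)) :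
  ~ exists y : 'rV[k]_(cubic_dim k n * bl_size b0 * bl_size b1 * bl_size b2
                       * bl_size b3 * bl_size b4),
      blowup_variety b4 y /\
      forall ell : 'M[k]_(2, n.+1), row_free ell ->
        transform b4 (transform b3 (transform b2 (transform b1
          (transform b0 (line_condition ell))))) y.
Proof.
have two0 : (2%:R : k) != 0 by move: char2; rewrite inE.
have three0 : (3%:R : k) != 0 by move: char3; rewrite inE.
by case=> y [Vy hL]; exact: (intersection_empty two0 three0 (ltnW hn) Vy hL).
Qed.
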